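(* Let $u>0$ and let $p(z)=\sum_{r=0}^Rp_rz^r$ with $R\ge1$, $p_R\ne0$. For $z\in Z_\delta^{(j,k)}$ ($j,k=0,\pm1$, $j<k$) the solutions $w^{(j,k)}(u,z)$ of $d^2w/dz^2-u^2zw=p(z)$ are given by $$w^{(j,k)}(u,z)=\frac{1}{u^2}\sum_{s=0}^{n-1}\frac{\hat G_s(z)}{u^{2s}}+\hat\varepsilon_n^{(j,k)}(u,z),$$ where $$\hat G_0(z)=-\sum_{r=0}^Rp_rz^{r-1},\qquad\hat G_{s+1}(z)=z^{-1}\hat G_s''(z)\quad(s=0,1,2,\dots),$$ and with the error bound $$\left|\hat\varepsilon_n^{(j,k)}(u,z)\right|\le\frac{1}{u^{2n+2}}\left\{|\hat G_n(z)|+\frac{1}{2|z|^{1/4}}\int_{\hat{\mathcal{L}}^{(j,k)}(z)}\left|\{t^{1/4}\hat G_n(t)\}'dt\right|\right\}$$ $$\qquad+\frac{5\hat L_n^{(j,k)}(u,z)}{32u^{2n+3}|z|^{1/4}}\left\{1-\frac{5}{32u}\int_{\hat{\mathcal{L}}^{(j,k)}(z)}\left|\frac{dt}{t^{5/2}}\right|\right\}^{-1}\int_{\hat{\mathcal{L}}^{(j,k)}(z)}\left|\frac{dt}{t^{5/2}}\right|,$$ where $$\hat L_n^{(j,k)}(u,z)=\sup_{t\in\hat{\mathcal{L}}^{(j,k)}(z)}\left|t^{1/4}\hat G_n(t)\right|+\frac12\int_{\hat{\mathcal{L}}^{(j,k)}(z)}\left|\{t^{1/4}\hat G_n(t)\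}'dt\right|.$$
   Context: $\mathrm{Ai}_j(x)=\mathrm{Ai}(xe^{-2\pi ij/3})$ for $j=0,\pm1$. The fundamental particular solutions are $$w^{(-1,1)}(u,z)=2\pi iu^{-2/3}\Big\{\mathrm{Ai}_{-1}(u^{2/3}z)\int_{\infty e^{2\pi i/3}}^zp(t)\mathrm{Ai}_1(u^{2/3}t)dt-\mathrm{Ai}_1(u^{2/3}z)\int_{\infty e^{-2\pi i/3}}^zp(t)\mathrm{Ai}_{-1}(u^{2/3}t)dt\Big\},$$ $$w^{(-1,0)}(u,z)=2\pi e^{\pi i/6}u^{-2/3}\Big\{\mathrm{Ai}_{-1}(u^{2/3}z)\int_\infty^zp(t)\mathrm{Ai}(u^{2/3}t)dt-\mathrm{Ai}(u^{2/3}z)\int_{\infty e^{-2\pi i/3}}^zp(t)\mathrm{Ai}_{-1}(u^{2/3}t)dt\Big\},$$ $$w^{(0,1)}(u,z)=2\pi e^{-\pi i/6}u^{-2/3}\Big\{\mathrm{Ai}_1(u^{2/3}z)\int_\infty^zp(t)\mathrm{Ai}(u^{2/3}t)dt-\mathrm{Ai}(u^{2/3}z)\int_{\infty e^{2\pi i/3}}^zp(t)\mathrm{Ai}_1(u^{2/3}t)dt\Big\}.$$ For arbitrary small $\delta>0$, $Z_\delta^{(0,1)}=\{z:-\frac13\pi+\delta\le\arg z\le\pi-\delta,\ |z|\ge\delta\}$, $Z_\delta^{(-1,0)}$ is its complex conjugate, and $Z_\delta^{(-1,1)}=\{z:|\arg(-z)|\le\frac23\pi-\delta,\ |z|\ge\delta\}$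 (that is, $\mathbf{S}_j\cup\mathbf{S}_k$, with $\mathbf{S}_j=\{z:|\arg(ze^{-2\pi ij/3})|\le\frac13\pi\}$, with neighbourhoods of the boundary rays and of $0$ removed). Reference points: $z^{(0)}$ at infinity in the direction of the positive real axis and $z^{(\pm1)}=\infty e^{\pm2\pi i/3}$. $\hat{\mathcal{L}}^{(j,k)}(z)$ is a path in $\mathbf{S}_j\cup\mathbf{S}_k$ avoiding $0$, linking $z^{(j)}$ and $z^{(k)}$ and containing $z$, consisting of a finite chain of $R_2$ arcs (parametrization with continuous second derivative and nonvanishing first derivative), along which $\Re(ut^{3/2})$ (with a branch of $t^{3/2}$ continuous in the domain) is monotonic. Standing assumptions for the bound: $n$ is a positive integer for which the integrals and supremum exist (for the integrals involving $\{t^{1/4}\hat G_n(t)\}'$ to converge at infinity one requires $n\ge\frac13R$), and $u$ is sufficiently large that $\frac{5}{32u}\int_{\hat{\mathcal{L}}^{(j,k)}(z)}|t^{-5/2}dt|<1$. *)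

(* Defs.v *)
From Stdlib Require Import Reals ZArith List.
From Coquelicot Require Import Coquelicot.
Open Scope R_scope.

Definition Cexp (z : C) : C := (exp (Re z) * cos (Im z), exp (Re z) * sin (Im z)).

Definition cis (theta : R) : C := Cexp (Ci * RtoC theta)%C.

(** Principal argument, in ]-PI, PI] (for z <> 0). *)
Definition Carg (z : C) : R :=
  if Rle_dec 0 (Im z) then acos (Re z / Cmod z) else - acos (Re z / Cmod z).

(** "lo <= arg z <= hi" for some determination of the argument. *)
Definition arg_between (lo hi : R) (z : C) : Prop :=
  exists theta : R, lo <= theta <= hi /\ z = (RtoC (Cmod z) * cis theta)%C.

(** int_{infinity e^{i theta}}^z f(t) dt, along the ray t = z + r e^{i theta},
    r decreasing from +oo to 0.  Below, f is always entire and exponentially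
    small in a sector around the direction theta, so the choice of path from
    infinity e^{i theta} to z is immaterial. *)
Definition int_from_infty (theta : R) (f : C -> C) (z : C) : C :=
  (- RInt_gen (V := C_R_CompleteNormedModule)
       (fun r : R => f (z + RtoC r * cis theta) * cis theta)%C
       (at_point 0) (Rbar_locally p_infty))%C.

(** Ai(z) = 1/(2 pi i) int_{oo e^{-i pi/3}}^{oo e^{i pi/3}} exp(t^3/3 - z t) dt,
    the contour being taken through the origin; this holds for all complex z. *)
Definition Ai (z : C) : C :=
  let f := fun t : C => Cexp (t ^ 3 / RtoC 3 - z * t)%C in
  ((int_from_infty (- (PI / 3)) f (RtoC 0) - int_from_infty (PI / 3) f (RtoC 0))
     / (RtoC 2 * RtoC PI * Ci))%C.

(** Argument of the reference point at infinity z^(j), and of the bisector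
    of the sector S_j. *)
Definition dir (j : Z) : R := 2 * PI * IZR j / 3.

Definition Aij (j : Z) (z : C) : C := Ai (z * cis (- dir j))%C.

Definition poly_eval (d : nat) (p : nat -> C) (z : C) : C :=
  sum_n (G := C_AbelianMonoid) (fun r => (p r * z ^ r)%C) d.

Section ParticularSolutions.

Variables (d : nat) (p : nat -> C) (u : R).

Let U : C := RtoC (Rpower u (2 / 3)).
Let c : C := (RtoC (2 * PI) * RtoC (Rpower u (- (2 / 3))))%C.

(** Ai_a(u^{2/3} z) int_{z^(b)}^z p(t) Ai_b(u^{2/3} t) dt *)
Let term (a b : Z) (z : C) : C :=
  (Aij a (U * z) *
   int_from_infty (dir b) (fun t => poly_eval d p t * Aij b (U * t)) z)%C.

(** w^(j,k); only the three pairs with -1 <= j < k <= 1 are meaningful. *)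
Definition w (j k : Z) (z : C) : C :=
  match j, k with
  | (-1)%Z, 1%Z => (c * Ci * (term (-1) 1 z - term 1 (-1) z))%C
  | (-1)%Z, 0%Z => (c * cis (PI / 6) * (term (-1) 0 z - term 0 (-1) z))%C
  | 0%Z, 1%Z => (c * cis (- (PI / 6)) * (term 1 0 z - term 0 1 z))%C
  | _, _ => RtoC 0
  end.

Definition is_solution (f : C -> C) : Prop :=
  exists f1 f2 : C -> C,
    (forall z : C, is_derive (K := C_AbsRing) (V := C_NormedModule) f z (f1 z)) /\
    (forall z : C, is_derive (K := C_AbsRing) (V := C_NormedModule) f1 z (f2 z)) /\
    (forall z : C, (f2 z - RtoC (u ^ 2) * z * f z)%C = poly_eval d p z).

(** r = 0 contributes the term p_0 / z, whence z^r / z for z^{r-1}. *)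
Fixpoint Ghat (s : nat) : C -> C :=
  match s with
  | O => fun z => (- sum_n (G := C_AbelianMonoid) (fun r => (p r * (z ^ r / z))%C) d)%C
  | S s' => fun z => (C_derive (C_derive (Ghat s')) z / z)%C
  end.

(** u^{-2} sum_{s=0}^{n-1} Ghat_s(z) / u^{2s}, for n >= 1. *)
Definition expansion (n : nat) (z : C) : C :=
  (RtoC (/ u ^ 2) *
   sum_n (G := C_AbelianMonoid) (fun s => Ghat s z / RtoC (u ^ (2 * s))) (n - 1))%C.

End ParticularSolutions.

Definition Zdelta (delta : R) (j k : Z) (z : C) : Prop :=
  match j, k with
  | 0%Z, 1%Z =>
      arg_between (- (1 / 3) * PI + delta) (PI - delta) z /\ delta <= Cmod z
  | (-1)%Z, 0%Z =>
      arg_between (- (1 / 3) * PI + delta) (PI - delta) (Cconj z) /\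
      delta <= Cmod (Cconj z)
  | (-1)%Z, 1%Z =>
      arg_between (- (2 / 3 * PI - delta)) (2 / 3 * PI - delta) (- z)%C /\
      delta <= Cmod z
  | _, _ => False
  end.

Definition Sector (j : Z) (z : C) : Prop :=
  arg_between (- (1 / 3) * PI) (1 / 3 * PI) (z * cis (- dir j))%C.

(** Bisector of S_j U S_k: PI/3, -PI/3, PI for (0,1), (-1,0), (-1,1). *)
Definition mid_dir (j k : Z) : R :=
  if Z.eqb k (j + 1) then (dir j + dir k) / 2 else PI.

(** The power t^a, with the branch of arg t within PI of the bisector of
    S_j U S_k: the cut lies outside this union, so that the branch is
    holomorphic on a neighbourhood of (S_j U S_k) \ {0}. *)
Definition cpow (j k : Z) (a : R) (t : C) : C :=
  (RtoC (Rpower (Cmod t) a) *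
   cis (a * (mid_dir j k + Carg (t * cis (- mid_dir j k)))))%C.

(** gamma restricted to the (possibly unbounded) closed interval [a, b] is an
    R_2 arc.  Being the restriction of a C^2 function on R amounts to being C^2
    on [a, b], with one-sided derivatives at finite end points. *)
Definition R2_arc (gamma : R -> C) (a b : Rbar) : Prop :=
  exists g g1 g2 : R -> C,
    (forall x : R, is_derive (K := R_AbsRing) (V := C_R_NormedModule) g x (g1 x)) /\
    (forall x : R, is_derive (K := R_AbsRing) (V := C_R_NormedModule) g1 x (g2 x)) /\
    (forall x : R, continuous (T := R_UniformSpace) (U := C_UniformSpace) g2 x) /\
    (forall x : R, Rbar_le a x -> Rbar_le x b ->
       gamma x = g x /\ g1 x <> RtoC 0).

(** Finite chain of R_2 arcs on [a, +oo[ with break points the list l. *)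
Fixpoint R2_chain (gamma : R -> C) (a : Rbar) (l : list R) : Prop :=
  match l with
  | nil => R2_arc gamma a p_infty
  | (b :: l')%list =>
      Rbar_lt a b /\ R2_arc gamma a b /\ R2_chain gamma b l'
  end.

(** gamma(x) tends to infinity e^{i theta} along the filter F. *)
Definition to_infty_dir (theta : R) (F : (R -> Prop) -> Prop) (gamma : R -> C) : Prop :=
  filterlim (fun x => Cmod (gamma x)) F (Rbar_locally p_infty) /\
  filterlim (fun x => gamma x / RtoC (Cmod (gamma x)))%C F
    (locally (T := C_UniformSpace) (cis theta)).

Definition monotonic (f : R -> R) : Prop :=
  (forall x y : R, x <= y -> f x <= f y) \/ (forall x y : R, x <= y -> f y <= f x).

(** The path from z^(j) to z^(k) through z, parametrized by the whole real line. *)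
Definition is_path (u : R) (j k : Z) (z : C) (gamma : R -> C) : Prop :=
  (exists l : list R, R2_chain gamma m_infty l) /\
  to_infty_dir (dir j) (Rbar_locally m_infty) gamma /\
  to_infty_dir (dir k) (Rbar_locally p_infty) gamma /\
  (exists x : R, gamma x = z) /\
  (forall x : R, gamma x <> RtoC 0) /\
  (forall x : R, Sector j (gamma x) \/ Sector k (gamma x)) /\
  monotonic (fun x => Re (RtoC u * cpow j k (3 / 2) (gamma x))%C).

(** |gamma'(x)|; the values at the finitely many break points are irrelevant
    for the integrals below. *)
Definition speed (gamma : R -> C) (x : R) : R :=
  Cmod (Derive (fun y => Re (gamma y)) x, Derive (fun y => Im (gamma y)) x).

Definition abs_integrand (gamma : R -> C) (f : C -> C) (x : R) : R :=
  Cmod (f (gamma x)) * speed gamma x.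

Definition abs_int_exists (gamma : R -> C) (f : C -> C) : Prop :=
  ex_RInt_gen (abs_integrand gamma f) (Rbar_locally m_infty) (Rbar_locally p_infty).

Definition abs_int (gamma : R -> C) (f : C -> C) : R :=
  RInt_gen (abs_integrand gamma f) (Rbar_locally m_infty) (Rbar_locally p_infty).

Definition qG (d : nat) (p : nat -> C) (j k : Z) (n : nat) (t : C) : C :=
  (cpow j k (1 / 4) t * Ghat d p n t)%C.

Definition qI (j k : Z) (t : C) : C := (RtoC 1 / cpow j k (5 / 2) t)%C.

Definition qG_values (d : nat) (p : nat -> C) (j k : Z) (n : nat) (gamma : R -> C)
    (y : R) : Prop :=
  exists x : R, y = Cmod (qG d p j k n (gamma x)).

Definition Lhat (d : nat) (p : nat -> C) (j k : Z) (n : nat) (gamma : R -> C) : R :=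
  real (Lub_Rbar (qG_values d p j k n gamma)) +
  1 / 2 * abs_int gamma (C_derive (qG d p j k n)).

(* Main.v *)
Require Import Defs.
From Stdlib Require Import Reals ZArith List Lra Lia Psatz.
From Coquelicot Require Import Coquelicot.
Open Scope R_scope.

(** Write xi = (2/3) t^(3/2), eta = t^(1/4) (w - expansion) and g = t^(1/4) Ghat_n. The recursion for
    the Ghat_s makes the residual of the truncated expansion equal to u^(-2n) t Ghat_n, so that eta
    satisfies d^2 eta / d xi^2 = (u^2 - (5/16) t^(-3)) eta - u^(-2n) g. With theta = d eta / d xi, the functions
      P = e^(-u xi) (theta + u eta - u^(-2n-1) g),   Q = e^(u xi) (theta - u eta + u^(-2n-1) g)
    have derivatives in t bounded by e^(-+ u Re xi) ((5/16) |t^(-5/2) eta| + u^(-2n-1) |g'|), and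
    eta = u^(-2n-2) g + (e^(u xi) P - e^(-u xi) Q) / (2u). As Re xi is monotonic on the path, integrating P
    from one end and Q from the other bounds eta by its own supremum times a factor less than 1, once P
    and Q are known to vanish at these ends. For this, crude bounds of Ai suffice: Ai decays
    exponentially near the positive axis and is O(exp((2/3) (1 + eps) |z|^(3/2))) everywhere, both by
    moving the vertex of the contour. The equation for w needs the Wronskian of the Ai_j, hence the
    value Ai(0) Ai'(0) = -1/(2 PI sqrt 3), a product of two real moments. *)


(** Since [w] is given by explicit integrals, the error is simply [w] minus the expansion; what has
    to be shown is that this particular difference grows slowly enough at both ends. The obstacle is
    circular: bounding eta by its own supremum presupposes that the supremum is finite, while the
    estimates for [Ai] only give growth. This growth merely has to stay below that of e^(u |xi|).
    With s^3 = u |t|^(3/2), so that u |xi| = (2/3) s^3, each term of [w] near an end is, up to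
    polynomial factors, a product of one factor bounded by e^(-s^3/2) and one bounded by e^((2/3) (s
    + 2)^3), hence below e^((3/10) s^3) for large s. This gap makes P and Q vanish at their ends,
    and it makes a weighted supremum of eta finite, the weight being 1 at the point of interest. The
    term g inside P and Q is an integration by parts carried out beforehand: it leaves only g' under
    the integral, which is why the bound consists of |Ghat_n| at the point z itself and of the
    variation of t^(1/4) Ghat_n. *)

(** * Derivatives in a complex and in a real variable *)

Notation cderiv := (is_derive (K := C_AbsRing) (V := C_NormedModule)).
Notation rderiv := (is_derive (K := R_AbsRing) (V := C_R_NormedModule)).

(** The library definition quantifies over filters and depends on the module structure put on C. The
    form with increments and [Cmod] is the same for a complex and for a real variable, so that
    [chain_eps] can serve both. *)
Lemma cderiv_eps (f : C -> C) (z l : C) :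
  cderiv f z l <->
  forall eps, 0 < eps -> exists del, 0 < del /\
    forall h, Cmod h < del -> Cmod (f (z + h) - f z - h * l)%C <= eps * Cmod h.
Proof.
  split.
  - intros [_ H] eps Heps.
    destruct (H z (fun P HP => HP) (mkposreal eps Heps)) as [del Hd].
    exists del. split. apply cond_pos.
    intros h Hh. specialize (Hd (z + h)%C).
    assert (B : @ball (AbsRing_UniformSpace C_AbsRing) z del (z + h)%C).
    { change (Cmod ((z + h) - z)%C < del). now replace (z + h - z)%C with h by ring. }
    specialize (Hd B).
    change (Cmod (f (z + h) - f z - ((z + h) - z) * l)%C <= eps * Cmod ((z + h) - z)%C) in Hd.
    now replace (z + h - z)%C with h in Hd by ring.
  - intros H. split. apply is_linear_scal_l.
    intros x Hx eps.
    assert (E := @is_filter_lim_locally_unique C_AbsRing (AbsRing_NormedModule C_AbsRing) z x Hx). subst x.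
    destruct (H eps (cond_pos eps)) as [del [Hd1 Hd]].
    exists (mkposreal del Hd1).
    assert (A : forall y : C, Cmod (y - z)%C < del ->
      Cmod (f y - f z - (y - z) * l)%C <= eps * Cmod (y - z)%C).
    { intros y Hy. specialize (Hd (y - z)%C Hy).
      now replace (z + (y - z))%C with y in Hd by ring. }
    exact A.
Qed.

Lemma rderiv_eps (f : R -> C) (x : R) (l : C) :
  rderiv f x l <->
  forall eps, 0 < eps -> exists del, 0 < del /\
    forall h, Rabs h < del -> Cmod (f (x + h)%R - f x - RtoC h * l)%C <= eps * Rabs h.
Proof.
  assert (S : forall (a : R) (l : C), @scal R_AbsRing C_R_NormedModule a l = (RtoC a * l)%C).
  { intros a [p q]. unfold scal; simpl. unfold prod_scal, scal; simpl.
    unfold mult; simpl. unfold Cmult; simpl. f_equal; ring. }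
  split.
  - intros [_ H] eps Heps.
    destruct (H x (fun P HP => HP) (mkposreal eps Heps)) as [del Hd].
    exists del. split. apply cond_pos.
    intros h Hh. specialize (Hd (x + h)).
    assert (B : ball x del (x + h)).
    { change (Rabs ((x + h) - x) < del). now replace (x + h - x) with h by ring. }
    specialize (Hd B). rewrite <- Cmod_norm in Hd. rewrite S in Hd.
    change (Cmod (f (x + h)%R - f x - RtoC ((x + h) - x) * l)%C <= eps * Rabs ((x + h) - x)) in Hd.
    now replace (x + h - x) with h in Hd by ring.
  - intros H. split. apply is_linear_scal_l.
    intros y Hy eps.
    assert (E := @is_filter_lim_locally_unique R_AbsRing R_NormedModule x y Hy). subst y.
    destruct (H eps (cond_pos eps)) as [del [Hd1 Hd]].
    exists (mkposreal del Hd1).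
    assert (A : forall y : R, Rabs (y - x) < del ->
      Cmod (f y - f x - RtoC (y - x) * l)%C <= eps * Rabs (y - x)).
    { intros y Hy'. specialize (Hd (y - x) Hy').
      now replace (x + (y - x)) with y in Hd by ring. }
    intros y Hy'. rewrite <- Cmod_norm. rewrite S. exact (A y Hy').
Qed.

Lemma Cmod_minus_le (a b : C) : Cmod (a - b)%C <= Cmod a + Cmod b.
Proof. unfold Cminus. rewrite <- (Cmod_opp b). apply Cmod_triangle. Qed.

Lemma Cmod_minus_sym (a b : C) : Cmod (a - b)%C = Cmod (b - a)%C.
Proof. rewrite <- Cmod_opp. f_equal. ring. Qed.

Lemma cderiv_ext_loc (f g : C -> C) (z l : C) (r : R) :
  0 < r -> (forall h, Cmod h < r -> f (z + h)%C = g (z + h)%C) ->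
  cderiv f z l -> cderiv g z l.
Proof.
  intros Hr E H. rewrite cderiv_eps in *. intros eps He.
  destruct (H eps He) as [del [Hd1 Hd]].
  exists (Rmin del r). split. now apply Rmin_pos.
  intros h Hh. rewrite <- E, <- (Cplus_0_r z), <- E.
  - rewrite Cplus_0_r. apply Hd. eapply Rlt_le_trans; [apply Hh | apply Rmin_l].
  - rewrite Cmod_0; lra.
  - eapply Rlt_le_trans; [apply Hh | apply Rmin_r].
Qed.

Lemma cderiv_ext (f g : C -> C) (z l : C) :
  (forall t, f t = g t) -> cderiv f z l -> cderiv g z l.
Proof. intros E. apply (cderiv_ext_loc f g z l 1); [lra | intros; apply E]. Qed.

Lemma rderiv_ext (f g : R -> C) (x : R) (l : C) :
  (forall t, f t = g t) -> rderiv f x l -> rderiv g x l.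
Proof. intros E. apply is_derive_ext, E. Qed.

Lemma cderiv_lip (f : C -> C) (z l : C) : cderiv f z l ->
  exists del, 0 < del /\ forall h, Cmod h < del -> Cmod (f (z + h) - f z)%C <= (Cmod l + 1) * Cmod h.
Proof.
  intros H. rewrite cderiv_eps in H. destruct (H 1 Rlt_0_1) as [del [Hd1 Hd]].
  exists del. split; auto. intros h Hh. specialize (Hd h Hh).
  replace (f (z + h) - f z)%C with ((f (z + h) - f z - h * l) + h * l)%C by ring.
  eapply Rle_trans. apply Cmod_triangle. rewrite Cmod_mult. lra.
Qed.

Lemma cderiv_const (c z : C) : cderiv (fun _ => c) z (RtoC 0).
Proof. apply (is_derive_const (K := C_AbsRing) (V := C_NormedModule)). Qed.

Lemma cderiv_id (z : C) : cderiv (fun t => t) z (RtoC 1).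
Proof.
  apply cderiv_eps. intros eps He. exists 1. split. lra. intros h _.
  replace (z + h - z - h * 1)%C with (RtoC 0) by ring. rewrite Cmod_0.
  apply Rmult_le_pos; [lra | apply Cmod_ge_0].
Qed.

Lemma cderiv_plus (f g : C -> C) (z a b : C) :
  cderiv f z a -> cderiv g z b -> cderiv (fun t => (f t + g t)%C) z (a + b)%C.
Proof. apply (is_derive_plus (K := C_AbsRing) (V := C_NormedModule)). Qed.

Lemma cderiv_opp (f : C -> C) (z a : C) :
  cderiv f z a -> cderiv (fun t => (- f t)%C) z (- a)%C.
Proof. apply (is_derive_opp (K := C_AbsRing) (V := C_NormedModule)). Qed.

Lemma cderiv_minus (f g : C -> C) (z a b : C) :
  cderiv f z a -> cderiv g z b -> cderiv (fun t => (f t - g t)%C) z (a - b)%C.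
Proof. apply (is_derive_minus (K := C_AbsRing) (V := C_NormedModule)). Qed.

(* The increment k h, with linear part m h * b, is plugged into f; X is C or R. *)
Lemma chain_eps (X : Type) (nx : X -> R) (f : C -> C) (k m : X -> C) (z a b : C) :
  cderiv f z a -> (forall h, Cmod (m h) = nx h) ->
  (forall eps, 0 < eps -> exists del, 0 < del /\
    forall h, nx h < del -> Cmod (k h - m h * b)%C <= eps * nx h) ->
  forall eps, 0 < eps -> exists del, 0 < del /\
    forall h, nx h < del -> Cmod (f (z + k h) - f z - m h * (b * a))%C <= eps * nx h.
Proof.
  intros Hf Hm Hg eps He. rewrite cderiv_eps in Hf.
  assert (Ha := Cmod_ge_0 a). assert (Hb := Cmod_ge_0 b).
  destruct (Hg 1 Rlt_0_1) as [d1 [Hd1 L]].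
  destruct (Hf (eps / 2 / (Cmod b + 1))) as [d2 [Hd2 F]].
  { repeat apply Rdiv_lt_0_compat; lra. }
  destruct (Hg (eps / 2 / (Cmod a + 1))) as [d3 [Hd3 G]].
  { repeat apply Rdiv_lt_0_compat; lra. }
  exists (Rmin (Rmin d1 d3) (d2 / (Cmod b + 1))). split.
  { repeat apply Rmin_pos; auto. apply Rdiv_lt_0_compat; lra. }
  intros h Hh. assert (H0 : 0 <= nx h) by (rewrite <- Hm; apply Cmod_ge_0).
  assert (h13 := Rlt_le_trans _ _ _ Hh (Rmin_l _ _)).
  assert (h2 := Rlt_le_trans _ _ _ Hh (Rmin_r _ _)).
  specialize (L h (Rlt_le_trans _ _ _ h13 (Rmin_l _ _))).
  specialize (G h (Rlt_le_trans _ _ _ h13 (Rmin_r _ _))).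
  assert (Lk : Cmod (k h) <= (Cmod b + 1) * nx h).
  { replace (k h) with ((k h - m h * b) + m h * b)%C by ring.
    eapply Rle_trans. apply Cmod_triangle. rewrite Cmod_mult, Hm. lra. }
  assert (k2 : Cmod (k h) < d2).
  { eapply Rle_lt_trans. apply Lk.
    apply Rmult_lt_compat_l with (r := Cmod b + 1) in h2; [|lra].
    replace ((Cmod b + 1) * (d2 / (Cmod b + 1))) with d2 in h2 by (field; lra). auto. }
  specialize (F (k h) k2).
  replace (f (z + k h) - f z - m h * (b * a))%C
    with ((f (z + k h) - f z - k h * a) + (k h - m h * b) * a)%C by ring.
  eapply Rle_trans. apply Cmod_triangle. rewrite Cmod_mult.
  assert (Cmod (f (z + k h) - f z - k h * a)%C <= eps / 2 * nx h).
  { eapply Rle_trans. apply F.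
    replace (eps / 2 * nx h) with (eps / 2 / (Cmod b + 1) * ((Cmod b + 1) * nx h)) by (field; lra).
    apply Rmult_le_compat_l; auto. left. repeat apply Rdiv_lt_0_compat; lra. }
  assert (Cmod (k h - m h * b)%C * Cmod a <= eps / 2 * nx h).
  { eapply Rle_trans. apply Rmult_le_compat; try apply Cmod_ge_0. apply G. apply Rle_refl.
    replace (eps / 2 * nx h) with (eps / 2 / (Cmod a + 1) * nx h * (Cmod a + 1)) by (field; lra).
    apply Rmult_le_compat_l; [|lra]. apply Rmult_le_pos; auto.
    left. repeat apply Rdiv_lt_0_compat; lra. }
  lra.
Qed.

Lemma cderiv_comp (f g : C -> C) (z a b : C) :
  cderiv f (g z) a -> cderiv g z b -> cderiv (fun t => f (g t)) z (b * a)%C.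
Proof.
  intros Hf Hg. rewrite cderiv_eps in *. intros eps He.
  destruct (chain_eps C Cmod f (fun h => g (z + h) - g z)%C (fun h => h) (g z) a b) with (eps := eps)
    as [del [Hd1 Hd]]; auto. { now apply cderiv_eps. }
  exists del. split; auto. intros h Hh. specialize (Hd h Hh).
  now replace (g z + (g (z + h) - g z))%C with (g (z + h)%C) in Hd by ring.
Qed.

Lemma rderiv_comp (f : C -> C) (g : R -> C) (x : R) (a b : C) :
  cderiv f (g x) a -> rderiv g x b -> rderiv (fun t => f (g t)) x (b * a)%C.
Proof.
  intros Hf Hg. rewrite rderiv_eps in *. intros eps He.
  destruct (chain_eps R Rabs f (fun h => g (x + h)%R - g x)%C RtoC (g x) a b) with (eps := eps)
    as [del [Hd1 Hd]]; auto. { intros; apply Cmod_R. }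
  exists del. split; auto. intros h Hh. specialize (Hd h Hh).
  now replace (g x + (g (x + h)%R - g x))%C with (g (x + h)%R) in Hd by ring.
Qed.

Lemma cderiv_sqr (z : C) : cderiv (fun t => (t * t)%C) z (2 * z)%C.
Proof.
  apply cderiv_eps. intros eps He. exists eps. split; auto. intros h Hh.
  replace ((z + h) * (z + h) - z * z - h * (2 * z))%C with (h * h)%C by ring.
  rewrite Cmod_mult. apply Rmult_le_compat_r. apply Cmod_ge_0. lra.
Qed.

Lemma cderiv_scal (c : C) (f : C -> C) (z a : C) :
  cderiv f z a -> cderiv (fun t => (c * f t)%C) z (c * a)%C.
Proof.
  intros H. rewrite Cmult_comm.
  apply (cderiv_comp (fun t => (c * t)%C) f z c a); auto.
  apply cderiv_eps. intros eps He. exists 1. split. lra. intros h _.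
  replace (c * (f z + h) - c * f z - h * c)%C with (RtoC 0) by ring. rewrite Cmod_0.
  apply Rmult_le_pos; [lra | apply Cmod_ge_0].
Qed.

(* Products by polarization: 4 f g = (f + g)^2 - (f - g)^2. *)
Lemma cderiv_mult (f g : C -> C) (z a b : C) :
  cderiv f z a -> cderiv g z b -> cderiv (fun t => (f t * g t)%C) z (a * g z + f z * b)%C.
Proof.
  intros Hf Hg.
  apply cderiv_ext with (fun t => (/ 4 * ((f t + g t) * (f t + g t) - (f t - g t) * (f t - g t)))%C).
  { intros t. field. }
  replace (a * g z + f z * b)%C with
    (/ 4 * ((a + b) * (2 * (f z + g z)) - (a - b) * (2 * (f z - g z))))%C by field.
  apply cderiv_scal, cderiv_minus.
  - apply (cderiv_comp (fun t => t * t)%C (fun t => f t + g t)%C); [apply cderiv_sqr | now apply cderiv_plus].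
  - apply (cderiv_comp (fun t => t * t)%C (fun t => f t - g t)%C); [apply cderiv_sqr | now apply cderiv_minus].
Qed.

Lemma rderiv_const (c : C) (x : R) : rderiv (fun _ => c) x (RtoC 0).
Proof. apply (is_derive_const (K := R_AbsRing) (V := C_R_NormedModule)). Qed.

Lemma rderiv_plus (f g : R -> C) (x : R) (a b : C) :
  rderiv f x a -> rderiv g x b -> rderiv (fun t => (f t + g t)%C) x (a + b)%C.
Proof. apply (is_derive_plus (K := R_AbsRing) (V := C_R_NormedModule)). Qed.

Lemma rderiv_minus (f g : R -> C) (x : R) (a b : C) :
  rderiv f x a -> rderiv g x b -> rderiv (fun t => (f t - g t)%C) x (a - b)%C.
Proof. apply (is_derive_minus (K := R_AbsRing) (V := C_R_NormedModule)). Qed.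

Lemma rderiv_scal (c : C) (f : R -> C) (x : R) (a : C) :
  rderiv f x a -> rderiv (fun t => (c * f t)%C) x (c * a)%C.
Proof.
  intros H. rewrite (Cmult_comm c a).
  apply (rderiv_comp (fun t => (c * t)%C) f x c a); auto.
  assert (E := cderiv_scal c (fun t => t) (f x) 1 (cderiv_id (f x))).
  now rewrite Cmult_1_r in E.
Qed.

Lemma rderiv_mult (f g : R -> C) (x : R) (a b : C) :
  rderiv f x a -> rderiv g x b -> rderiv (fun t => (f t * g t)%C) x (a * g x + f x * b)%C.
Proof.
  intros Hf Hg.
  apply rderiv_ext with (fun t => (/ 4 * ((f t + g t) * (f t + g t) - (f t - g t) * (f t - g t)))%C).
  { intros t. field. }
  replace (a * g x + f x * b)%C with
    (/ 4 * ((a + b) * (2 * (f x + g x)) - (a - b) * (2 * (f x - g x))))%C by field.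
  apply rderiv_scal, rderiv_minus.
  - apply (rderiv_comp (fun t => t * t)%C (fun t => f t + g t)%C); [apply cderiv_sqr | now apply rderiv_plus].
  - apply (rderiv_comp (fun t => t * t)%C (fun t => f t - g t)%C); [apply cderiv_sqr | now apply rderiv_minus].
Qed.

Lemma rderiv_line (z e : C) (x : R) : rderiv (fun r => (z + RtoC r * e)%C) x e.
Proof.
  apply rderiv_eps. intros eps He. exists 1. split. lra. intros h _.
  rewrite RtoC_plus.
  replace (z + (x + h) * e - (z + x * e) - h * e)%C with (RtoC 0) by ring.
  rewrite Cmod_0. apply Rmult_le_pos; [lra | apply Rabs_pos].
Qed.

Lemma rderiv_continuous (f : R -> C) (x : R) (l : C) :
  rderiv f x l -> continuous (T := R_UniformSpace) (U := C_UniformSpace) f x.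
Proof.
  intros H. apply (ex_derive_continuous (K := R_AbsRing) (V := C_R_NormedModule)). now exists l.
Qed.

(** For complex values the mean value theorem fails, so the inequality is read off from the integral
    of the derivative; this is why continuity of [df] is asked for. *)
Lemma Cmod_diff_le_deriv (f df : R -> C) (a b K : R) : a <= b ->
  (forall x, a <= x <= b -> rderiv f x (df x)) ->
  (forall x, a <= x <= b -> continuous (T := R_UniformSpace) (U := C_UniformSpace) df x) ->
  (forall x, a <= x <= b -> Cmod (df x) <= K) ->
  Cmod (f b - f a)%C <= K * (b - a).
Proof.
  intros Hab Hd Hc HK.
  assert (I : is_RInt (V := C_R_CompleteNormedModule) df a b (minus (f b) (f a))).
  { apply (is_RInt_derive (V := C_R_CompleteNormedModule));
    rewrite Rmin_left, Rmax_right by auto; auto. }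
  rewrite Rmult_comm.
  assert (N := Cmod_norm (f b - f a)%C). rewrite N.
  apply (norm_RInt_le_const (V := C_R_NormedModule) df a b _ K Hab); auto.
  intros x Hx. rewrite <- Cmod_norm. auto.
Qed.

Lemma Cmod_diff_le_segment (f f1 f2 : C -> C) (z h : C) (K : R) :
  (forall s, 0 <= s <= 1 -> cderiv f (z + RtoC s * h)%C (f1 (z + RtoC s * h)%C)) ->
  (forall s, 0 <= s <= 1 -> cderiv f1 (z + RtoC s * h)%C (f2 (z + RtoC s * h)%C)) ->
  (forall s, 0 <= s <= 1 -> Cmod (f1 (z + RtoC s * h)%C) <= K) ->
  Cmod (f (z + h) - f z)%C <= K * Cmod h.
Proof.
  intros H1 H2 HK.
  assert (E := Cmod_diff_le_deriv (fun s => f (z + RtoC s * h)%C)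
    (fun s => h * f1 (z + RtoC s * h))%C 0 1 (K * Cmod h) Rle_0_1).
  cbv beta in E. replace (z + RtoC 1 * h)%C with (z + h)%C in E by ring.
  replace (z + RtoC 0 * h)%C with z in E by ring.
  replace (K * Cmod h) with (K * Cmod h * (1 - 0)) by ring. apply E; clear E.
  - intros x Hx. apply (rderiv_comp f (fun s => z + RtoC s * h)%C); [auto | apply rderiv_line].
  - intros x Hx. eapply rderiv_continuous. apply rderiv_scal.
    apply (rderiv_comp f1 (fun s => z + RtoC s * h)%C); [auto | apply rderiv_line].
  - intros x Hx. rewrite Cmod_mult, Rmult_comm. apply Rmult_le_compat_r; [apply Cmod_ge_0 | auto].
Qed.

(* The mean value inequality applied to t |-> f t - (t - z) f1 z. *)
Lemma Cmod_taylor (f f1 f2 f3 : C -> C) (z h : C) (K : R) :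
  (forall s, 0 <= s <= 1 -> cderiv f (z + RtoC s * h)%C (f1 (z + RtoC s * h)%C)) ->
  (forall s, 0 <= s <= 1 -> cderiv f1 (z + RtoC s * h)%C (f2 (z + RtoC s * h)%C)) ->
  (forall s, 0 <= s <= 1 -> cderiv f2 (z + RtoC s * h)%C (f3 (z + RtoC s * h)%C)) ->
  (forall s, 0 <= s <= 1 -> Cmod (f2 (z + RtoC s * h)%C) <= K) ->
  Cmod (f (z + h) - f z - h * f1 z)%C <= K * Cmod h ^ 2.
Proof.
  intros H1 H2 H3 HK.
  assert (K0 : 0 <= K) by (eapply Rle_trans; [apply Cmod_ge_0 | apply (HK 0); lra]).
  assert (E := Cmod_diff_le_segment (fun t => f t - (t - z) * f1 z)%C
    (fun t => f1 t - f1 z)%C f2 z h (K * Cmod h)).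
  replace (f (z + h) - f z - h * f1 z)%C with
    (f (z + h) - (z + h - z) * f1 z - (f z - (z - z) * f1 z))%C by ring.
  replace (K * Cmod h ^ 2) with (K * Cmod h * Cmod h) by ring. apply E; clear E.
  - intros s Hs. apply cderiv_minus; auto.
    assert (E := cderiv_mult (fun t => t - z)%C (fun _ => f1 z) (z + RtoC s * h)%C (1 - 0)%C 0%C
       (cderiv_minus _ _ _ _ _ (cderiv_id _) (cderiv_const z _)) (cderiv_const _ _)).
    simpl in E. replace ((1 - 0) * f1 z + (z + s * h - z) * 0)%C with (f1 z) in E by ring. exact E.
  - intros s Hs. replace (f2 (z + RtoC s * h)%C) with (f2 (z + RtoC s * h)%C - 0)%C by ring.
    apply cderiv_minus; [auto | apply cderiv_const].
  - intros s Hs.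
    assert (E := Cmod_diff_le_segment f1 f2 f3 z (RtoC s * h)%C K).
    assert (A : forall s', 0 <= s' <= 1 -> (z + RtoC s' * (RtoC s * h))%C = (z + RtoC (s' * s) * h)%C /\ 0 <= s' * s <= 1).
    { intros s' Hs'. split. rewrite RtoC_mult. ring. split. apply Rmult_le_pos; lra.
      rewrite <- (Rmult_1_r 1). apply Rmult_le_compat; lra. }
    eapply Rle_trans. apply E.
    + intros s' Hs'. destruct (A s' Hs') as [-> ?]. auto.
    + intros s' Hs'. destruct (A s' Hs') as [-> ?]. auto.
    + intros s' Hs'. destruct (A s' Hs') as [-> ?]. auto.
    + apply Rmult_le_compat_l; auto. rewrite Cmod_mult, Cmod_R, Rabs_right by lra.
      rewrite <- (Rmult_1_l (Cmod h)) at 2. apply Rmult_le_compat_r; [apply Cmod_ge_0 | lra].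
Qed.

Lemma Cmod_le_abs (z : C) : Cmod z <= Rabs (Re z) + Rabs (Im z).
Proof.
  replace z with (RtoC (Re z) + RtoC (Im z) * Ci)%C at 1.
  - eapply Rle_trans. apply Cmod_triangle. rewrite Cmod_mult, !Cmod_R, Cmod_Ci. lra.
  - destruct z as [x y]. unfold Cplus, Cmult, RtoC, Ci; simpl. f_equal; ring.
Qed.

Lemma im_le_Cmod (c : C) : Rabs (Im c) <= Cmod c.
Proof. eapply Rle_trans; [|apply Rmax_Cmod]. apply Rmax_r. Qed.

Lemma Re_lower (z : C) : - Cmod z <= Re z.
Proof. assert (H := re_le_Cmod z). apply Rabs_le_between in H. lra. Qed.

Lemma Rabs_sign (s : R) : s = 1 \/ s = -1 -> Rabs s = 1.
Proof. intros [-> | ->]; unfold Rabs; destruct Rcase_abs; lra. Qed.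

Lemma rderiv_pair (a b : R -> R) (x a' b' : R) :
  is_derive a x a' -> is_derive b x b' -> rderiv (fun t => (a t, b t)) x (a', b').
Proof.
  intros Ha Hb. apply rderiv_ext with (fun t => (RtoC (a t) + Ci * RtoC (b t))%C).
  { intros t. unfold Cplus, Cmult, RtoC, Ci; simpl. f_equal; ring. }
  replace (a', b') with (RtoC a' + Ci * RtoC b')%C
    by (unfold Cplus, Cmult, RtoC, Ci; simpl; f_equal; ring).
  assert (A : forall (c : R -> R) c', is_derive c x c' -> rderiv (fun t => RtoC (c t)) x (RtoC c')).
  { intros c c' H. apply rderiv_eps. intros eps He.
    apply is_derive_Reals in H. destruct (H eps He) as [del Hd].
    exists del. split. apply cond_pos. intros h Hh.
    rewrite <- !RtoC_minus, <- RtoC_mult, <- RtoC_minus, Cmod_R.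
    destruct (Req_dec h 0) as [-> | Hn].
    - rewrite Rplus_0_r. replace (c x - c x - 0 * c') with 0 by ring. rewrite Rabs_R0. lra.
    - specialize (Hd h Hn Hh).
      replace (c (x + h) - c x - h * c') with (((c (x + h) - c x) / h - c') * h) by (field; auto).
      rewrite Rabs_mult. apply Rmult_le_compat_r; [apply Rabs_pos | lra]. }
  apply rderiv_plus; [now apply A | now apply rderiv_scal, A].
Qed.

(** * The complex exponential *)

Lemma Cexp_plus (a b : C) : Cexp (a + b) = (Cexp a * Cexp b)%C.
Proof.
  destruct a as [a1 a2], b as [b1 b2]. unfold Cexp, Cplus, Cmult; simpl.
  rewrite exp_plus, cos_plus, sin_plus. f_equal; ring.
Qed.

Lemma Cexp_RtoC (x : R) : Cexp (RtoC x) = RtoC (exp x).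
Proof. unfold Cexp, RtoC; simpl. rewrite cos_0, sin_0. f_equal; ring. Qed.

Lemma Cexp_0 : Cexp (RtoC 0) = RtoC 1.
Proof. now rewrite Cexp_RtoC, exp_0. Qed.

Lemma Cmod_Cexp (z : C) : Cmod (Cexp z) = exp (Re z).
Proof.
  unfold Cexp, Cmod; simpl.
  replace (exp (Re z) * cos (Im z) * (exp (Re z) * cos (Im z) * 1) +
    exp (Re z) * sin (Im z) * (exp (Re z) * sin (Im z) * 1)) with (Rsqr (exp (Re z))).
  - apply sqrt_Rsqr. left; apply exp_pos.
  - assert (H := sin2_cos2 (Im z)). unfold Rsqr in *. nra.
Qed.

Lemma Cexp_neq_0 (z : C) : Cexp z <> RtoC 0.
Proof. apply Cmod_gt_0. rewrite Cmod_Cexp. apply exp_pos. Qed.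

Lemma cis_eq (t : R) : cis t = (cos t, sin t).
Proof.
  unfold cis, Cexp, Ci, RtoC, Cmult; simpl.
  replace (0 * t - 1 * 0) with 0 by ring. replace (0 * 0 + 1 * t) with t by ring.
  rewrite exp_0. f_equal; ring.
Qed.

Lemma cis_0 : cis 0 = RtoC 1.
Proof. rewrite cis_eq, cos_0, sin_0. reflexivity. Qed.

Lemma cis_plus (a b : R) : cis (a + b) = (cis a * cis b)%C.
Proof. unfold cis. rewrite RtoC_plus, <- Cexp_plus. f_equal. ring. Qed.

Lemma Cmod_cis (t : R) : Cmod (cis t) = 1.
Proof.
  unfold cis. rewrite Cmod_Cexp. unfold Ci, RtoC, Cmult; simpl.
  replace (0 * t - 1 * 0) with 0 by ring. apply exp_0.
Qed.

Lemma cis_neq_0 (t : R) : cis t <> RtoC 0.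
Proof. apply Cexp_neq_0. Qed.

Lemma cis_opp_r (t : R) : (cis t * cis (- t))%C = RtoC 1.
Proof. rewrite <- cis_plus, Rplus_opp_r. apply cis_0. Qed.

Lemma cis_pow (t : R) (n : nat) : (cis t ^ n)%C = cis (INR n * t).
Proof.
  induction n.
  - simpl. rewrite Rmult_0_l. now rewrite cis_0.
  - rewrite Cpow_S, IHn, S_INR, <- cis_plus. f_equal; ring.
Qed.

Lemma cis_2PI (t : R) : cis (t + 2 * PI) = cis t.
Proof. rewrite !cis_eq, cos_plus, sin_plus, cos_2PI, sin_2PI. f_equal; ring. Qed.

Lemma exp_le (x y : R) : x <= y -> exp x <= exp y.
Proof. intros [H | ->]; [left; now apply exp_increasing | right; auto]. Qed.

Lemma exp_ge_id (x : R) : x <= exp x.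
Proof. generalize (exp_ineq1_le x). lra. Qed.

(* The mean value inequality on [0, 1] for s |-> exp (s w), then for s |-> exp (s w) - s w. *)
Lemma Cexp_taylor (w : C) : Cmod (Cexp w - 1 - w)%C <= exp (Cmod w) * Cmod w ^ 2.
Proof.
  assert (D : forall s, rderiv (fun s => Cexp (RtoC s * w)) s (w * Cexp (RtoC s * w))%C).
  { intros s. destruct w as [x y].
    apply rderiv_ext with (fun s => (exp (s * x) * cos (s * y), exp (s * x) * sin (s * y))).
    { intros t. unfold Cexp, Cmult, RtoC; simpl.
      replace (t * x - 0 * y) with (t * x) by ring. replace (t * y + 0 * x) with (t * y) by ring. auto. }
    replace ((x, y) * Cexp (RtoC s * (x, y)))%C with
      (x * (exp (s * x) * cos (s * y)) - y * (exp (s * x) * sin (s * y)),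
       x * (exp (s * x) * sin (s * y)) + y * (exp (s * x) * cos (s * y))).
    - apply rderiv_pair; auto_derive; auto; ring.
    - unfold Cexp, Cmult, RtoC; simpl.
      replace (s * x - 0 * y) with (s * x) by ring. replace (s * y + 0 * x) with (s * y) by ring. auto. }
  assert (M : forall s, 0 <= s <= 1 -> Cmod (Cexp (RtoC s * w)) <= exp (Cmod w)).
  { intros s Hs. rewrite Cmod_Cexp. apply exp_le.
    eapply Rle_trans. apply Rle_abs. eapply Rle_trans. apply re_le_Cmod.
    rewrite Cmod_mult, Cmod_R, Rabs_right by lra.
    rewrite <- (Rmult_1_l (Cmod w)) at 2. apply Rmult_le_compat_r; [apply Cmod_ge_0 | lra]. }
  assert (M1 : forall s, 0 <= s <= 1 -> Cmod (Cexp (RtoC s * w) - 1)%C <= exp (Cmod w) * Cmod w).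
  { intros s Hs.
    assert (E := Cmod_diff_le_deriv (fun s => Cexp (RtoC s * w)) (fun s => w * Cexp (RtoC s * w))%C
      0 s (Cmod w * exp (Cmod w))). cbv beta in E.
    replace (RtoC 0 * w)%C with (RtoC 0) in E by ring. rewrite Cexp_0 in E.
    eapply Rle_trans. apply E.
    - lra.
    - intros; apply D.
    - intros x _. eapply rderiv_continuous, rderiv_scal, D.
    - intros x Hx. rewrite Cmod_mult. apply Rmult_le_compat_l; [apply Cmod_ge_0 | apply M; lra].
    - assert (0 <= Cmod w * exp (Cmod w)).
      { apply Rmult_le_pos; [apply Cmod_ge_0 | left; apply exp_pos]. } nra. }
  assert (E := Cmod_diff_le_deriv (fun s => Cexp (RtoC s * w) - RtoC s * w)%C
      (fun s => w * Cexp (RtoC s * w) - w)%C 0 1 (exp (Cmod w) * Cmod w ^ 2)). cbv beta in E.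
  replace (RtoC 0 * w)%C with (RtoC 0) in E by ring. rewrite Cexp_0 in E.
  replace (RtoC 1 * w)%C with w in E by ring.
  replace (Cexp w - 1 - w)%C with (Cexp w - w - (1 - 0))%C by ring.
  replace (exp (Cmod w) * Cmod w ^ 2) with (exp (Cmod w) * Cmod w ^ 2 * (1 - 0)) by ring.
  assert (Dw : forall x, rderiv (fun s => RtoC s * w)%C x w).
  { intros x. apply rderiv_ext with (fun s => 0 + RtoC s * w)%C. intros; ring. apply rderiv_line. }
  apply E.
  - lra.
  - intros x _. apply rderiv_minus; auto.
  - intros x _. eapply rderiv_continuous, rderiv_minus; [apply rderiv_scal, D | apply rderiv_const].
  - intros x Hx. replace (w * Cexp (RtoC x * w) - w)%C with (w * (Cexp (RtoC x * w) - 1))%C by ring.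
    rewrite Cmod_mult. replace (exp (Cmod w) * Cmod w ^ 2) with (Cmod w * (exp (Cmod w) * Cmod w)) by ring.
    apply Rmult_le_compat_l; [apply Cmod_ge_0 | now apply M1].
Qed.

Lemma cderiv_Cexp (z : C) : cderiv Cexp z (Cexp z).
Proof.
  apply cderiv_eps. intros eps He.
  assert (P : 0 < Cmod (Cexp z) * exp 1).
  { apply Rmult_lt_0_compat; [apply Cmod_gt_0, Cexp_neq_0 | apply exp_pos]. }
  exists (Rmin 1 (eps / (Cmod (Cexp z) * exp 1))). split.
  { apply Rmin_pos; [lra | now apply Rdiv_lt_0_compat]. }
  intros h Hh.
  assert (h1 : Cmod h < 1) by (eapply Rlt_le_trans; [apply Hh | apply Rmin_l]).
  assert (h2 : Cmod h < eps / (Cmod (Cexp z) * exp 1)) by (eapply Rlt_le_trans; [apply Hh | apply Rmin_r]).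
  rewrite Cexp_plus.
  replace (Cexp z * Cexp h - Cexp z - h * Cexp z)%C with (Cexp z * (Cexp h - 1 - h))%C by ring.
  rewrite Cmod_mult. eapply Rle_trans.
  { apply Rmult_le_compat_l; [apply Cmod_ge_0 | apply Cexp_taylor]. }
  assert (E : exp (Cmod h) <= exp 1) by (apply exp_le; lra).
  assert (P2 : 0 < exp (Cmod h)) by apply exp_pos.
  apply (Rmult_lt_compat_l (Cmod (Cexp z) * exp 1)) in h2; auto.
  replace (Cmod (Cexp z) * exp 1 * (eps / (Cmod (Cexp z) * exp 1))) with eps in h2
   by (field; split; [apply Rgt_not_eq, exp_pos | apply Rgt_not_eq, Cmod_gt_0, Cexp_neq_0]).
  assert (H0 := Cmod_ge_0 h). assert (Hz := Cmod_ge_0 (Cexp z)).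
  replace (Cmod (Cexp z) * (exp (Cmod h) * Cmod h ^ 2)) with
    ((Cmod (Cexp z) * exp (Cmod h) * Cmod h) * Cmod h) by ring.
  apply Rmult_le_compat_r; auto.
  left. eapply Rle_lt_trans; [|apply h2].
  apply Rmult_le_compat_r; auto. apply Rmult_le_compat_l; auto.
Qed.

(** * Integrals over a half-line of exponentially decaying functions *)

Notation Ccont := (continuous (T := R_UniformSpace) (U := C_UniformSpace)).
Notation CRInt := (RInt (V := C_R_CompleteNormedModule)).
Notation is_CRInt := (is_RInt (V := C_R_NormedModule)).

Lemma norm_CR (x : C) : @norm R_AbsRing C_R_NormedModule x = Cmod x.
Proof. symmetry. exact (Cmod_norm x). Qed.

Lemma Ccont_eps (f : R -> C) (x : R) :
  Ccont f x <-> forall eps, 0 < eps -> exists del, 0 < del /\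
    forall y, Rabs (y - x) < del -> Cmod (f y - f x)%C < eps.
Proof.
  split.
  - intros H eps He.
    destruct (H _ (locally_ball_norm (V := C_R_NormedModule) (f x) (mkposreal eps He))) as [d Hd].
    exists d. split. apply cond_pos. intros y Hy. specialize (Hd y Hy).
    unfold ball_norm in Hd. rewrite <- Cmod_norm in Hd. exact Hd.
  - intros H P [eps HP]. destruct (H eps (cond_pos eps)) as [d [Hd1 Hd]].
    exists (mkposreal d Hd1). intros y Hy. apply HP, (norm_compat1 (V := C_R_NormedModule)).
    change (@norm R_AbsRing C_R_NormedModule (f y - f x)%C < eps).
    rewrite norm_CR. now apply Hd.
Qed.

Lemma Ccont_comp (F : C -> C) (l : C) (f : R -> C) (x : R) :
  cderiv F (f x) l -> Ccont f x -> Ccont (fun r => F (f r)) x.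
Proof.
  intros HF Hf. rewrite Ccont_eps in *. intros eps He.
  destruct (cderiv_lip F (f x) l HF) as [d1 [Hd1 L]]. assert (Hl := Cmod_ge_0 l).
  destruct (Hf (Rmin d1 (eps / (Cmod l + 1)))) as [d [Hd1' Hd]].
  { apply Rmin_pos; auto. apply Rdiv_lt_0_compat; lra. }
  exists d. split; auto. intros y Hy. specialize (Hd y Hy).
  assert (Hd' := Rlt_le_trans _ _ _ Hd (Rmin_l _ _)).
  assert (Hd'' := Rlt_le_trans _ _ _ Hd (Rmin_r _ _)).
  specialize (L _ Hd'). replace (f x + (f y - f x))%C with (f y) in L by ring.
  eapply Rle_lt_trans. apply L.
  apply Rmult_lt_compat_l with (r := Cmod l + 1) in Hd''; [|lra].
  replace ((Cmod l + 1) * (eps / (Cmod l + 1))) with eps in Hd'' by (field; lra). auto.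
Qed.

Lemma Ccont_lin (c1 c2 : C) (f g : R -> C) (x : R) :
  Ccont f x -> Ccont g x -> Ccont (fun r => c1 * f r + c2 * g r)%C x.
Proof.
  intros Hf Hg. apply (continuous_plus (V := C_R_NormedModule)).
  - apply (Ccont_comp (fun t => c1 * t)%C (c1 * 1)%C f); auto. apply cderiv_scal, cderiv_id.
  - apply (Ccont_comp (fun t => c2 * t)%C (c2 * 1)%C g); auto. apply cderiv_scal, cderiv_id.
Qed.

Definition Iinf (f : R -> C) : C :=
  RInt_gen (V := C_R_CompleteNormedModule) f (at_point 0) (Rbar_locally p_infty).

Lemma CRInt_correct (f : R -> C) (a b : R) :
  (forall r, Ccont f r) -> is_CRInt f a b (CRInt f a b).
Proof.
  intros H. apply (RInt_correct (V := C_R_CompleteNormedModule)).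
  apply (ex_RInt_continuous (V := C_R_CompleteNormedModule)). auto.
Qed.

Lemma CRInt_unique (f : R -> C) (a b : R) (l : C) : is_CRInt f a b l -> CRInt f a b = l.
Proof. apply (is_RInt_unique (V := C_R_CompleteNormedModule)). Qed.

Lemma is_CRInt_scal (c : C) (f : R -> C) (a b : R) (l : C) :
  is_CRInt f a b l -> is_CRInt (fun r => c * f r)%C a b (c * l)%C.
Proof.
  intros H.
  assert (H1 := is_RInt_fct_extend_fst (U := R_NormedModule) (V := R_NormedModule) f a b l H).
  assert (H2 := is_RInt_fct_extend_snd (U := R_NormedModule) (V := R_NormedModule) f a b l H).
  apply (is_RInt_fct_extend_pair (U := R_NormedModule) (V := R_NormedModule)); simpl.
  - apply (is_RInt_minus (V := R_NormedModule)); now apply (is_RInt_scal (V := R_NormedModule)).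
  - apply (is_RInt_plus (V := R_NormedModule)); now apply (is_RInt_scal (V := R_NormedModule)).
Qed.

Lemma Iinf_eq (f : R -> C) (L : C) :
  (forall r, Ccont f r) ->
  (forall eps, 0 < eps -> exists M, forall b, M <= b -> Cmod (CRInt f 0 b - L)%C <= eps) ->
  Iinf f = L.
Proof.
  intros Hc HL. unfold Iinf.
  apply (is_RInt_gen_unique (V := C_R_CompleteNormedModule)).
  intros P [eps HP].
  destruct (HL (eps / 2)) as [M HM]. { assert (H := cond_pos eps). lra. }
  apply Filter_prod with (fun x => x = 0) (fun b => M < b).
  - reflexivity.
  - now exists M.
  - intros a b -> Hb. exists (CRInt f 0 b). split; [now apply CRInt_correct|].
    apply HP, (norm_compat1 (V := C_R_NormedModule)).
    change (@norm R_AbsRing C_R_NormedModule (CRInt f 0 b - L)%C < eps).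
    rewrite norm_CR. specialize (HM b (Rlt_le _ _ Hb)). assert (H := cond_pos eps). lra.
Qed.

Lemma exp_bound_ge_0 (f : R -> C) (K : R) :
  (forall r, 0 <= r -> Cmod (f r) <= K * exp (- r)) -> 0 <= K.
Proof.
  intros H. specialize (H 0 (Rle_refl 0)). rewrite Ropp_0, exp_0 in H.
  assert (P := Cmod_ge_0 (f 0)). lra.
Qed.

Lemma CRInt_exp_bound (f : R -> C) (K a b : R) : (forall r, Ccont f r) ->
  (forall r, 0 <= r -> Cmod (f r) <= K * exp (- r)) -> 0 <= a <= b ->
  Cmod (CRInt f 0 b - CRInt f 0 a)%C <= K * exp (- a).
Proof.
  intros Hc HK Hab.
  assert (K0 : 0 <= K) by exact (exp_bound_ge_0 _ _ HK).
  assert (E : (CRInt f 0 b - CRInt f 0 a)%C = CRInt f a b).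
  { symmetry. apply CRInt_unique.
    replace (CRInt f 0 b - CRInt f 0 a)%C with (plus (opp (CRInt f 0 a)) (CRInt f 0 b) : C_R_NormedModule).
    - apply (is_RInt_Chasles (V := C_R_NormedModule)) with 0; [apply (is_RInt_swap (V := C_R_NormedModule))|]; now apply CRInt_correct.
    - change (- CRInt f 0 a + CRInt f 0 b = CRInt f 0 b - CRInt f 0 a)%C. ring. }
  rewrite E. assert (N := Cmod_norm (CRInt f a b)). rewrite N.
  apply Rle_trans with (K * exp (- a) - K * exp (- b)).
  - apply (norm_RInt_le (V := C_R_NormedModule) f (fun r => K * exp (- r)) a b).
    + lra.
    + intros x Hx. rewrite <- Cmod_norm. apply HK; lra.
    + now apply CRInt_correct.
    + replace (K * exp (- a) - K * exp (- b)) with (minus (- (K * exp (- b))) (- (K * exp (- a))))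
        by (unfold minus, plus, opp; simpl; ring).
      apply (is_RInt_derive (fun r => - (K * exp (- r)))).
      * intros x _. auto_derive; auto. ring.
      * intros x _. apply (ex_derive_continuous (fun r => K * exp (- r))). auto_derive; auto.
  - assert (0 <= K * exp (- b)) by (apply Rmult_le_pos; [lra | left; apply exp_pos]). lra.
Qed.

Lemma exp_opp_small (K eps : R) : 0 <= K -> 0 < eps ->
  exists M, 0 <= M /\ forall b, M <= b -> K * exp (- b) <= eps.
Proof.
  intros HK He. exists (K / eps). split.
  { apply Rmult_le_pos; [auto | left; now apply Rinv_0_lt_compat]. }
  intros b Hb. rewrite exp_Ropp.
  assert (H := exp_pos b). apply Rmult_le_reg_r with (exp b); auto.
  rewrite Rmult_assoc, Rinv_l, Rmult_1_r by lra.
  apply Rle_trans with (eps * b).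
  - apply Rmult_le_compat_l with (r := eps) in Hb; [|lra].
    replace (eps * (K / eps)) with K in Hb by (field; lra). auto.
  - apply Rmult_le_compat_l; [lra | apply exp_ge_id].
Qed.

(** All integrands on the half-line are normalized to decay like e^(-r). A single constant K then
    controls convergence (by the Cauchy criterion), the tail beyond b and, with b = 0, the size of
    the integral. *)
Lemma Iinf_trunc (f : R -> C) (K : R) : (forall r, Ccont f r) ->
  (forall r, 0 <= r -> Cmod (f r) <= K * exp (- r)) ->
  forall b, 0 <= b -> Cmod (CRInt f 0 b - Iinf f)%C <= K * exp (- b).
Proof.
  intros Hc HK.
  assert (K0 : 0 <= K) by exact (exp_bound_ge_0 _ _ HK).
  assert (L : exists L : C_R_CompleteNormedModule, filterlim (fun b => CRInt f 0 b) (Rbar_locally p_infty) (locally L)).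
  { apply (filterlim_locally_cauchy (U := C_R_CompleteNormedModule)). intros eps.
    destruct (exp_opp_small K (eps / 2) K0) as [M [HM0 HM]]. { assert (H := cond_pos eps). lra. }
    exists (fun b => M < b). split. now exists M.
    assert (G : forall u v, M < u <= v -> Cmod (CRInt f 0 v - CRInt f 0 u)%C < eps).
    { intros u v Huv. eapply Rle_lt_trans. apply (CRInt_exp_bound f K); auto. lra.
      eapply Rle_lt_trans. apply HM. lra. assert (H := cond_pos eps). lra. }
    intros u v Hu Hv. apply (norm_compat1 (V := C_R_NormedModule)).
    change (@norm R_AbsRing C_R_NormedModule (CRInt f 0 v - CRInt f 0 u)%C < eps).
    rewrite norm_CR. destruct (Rle_dec u v).
    - apply G. lra.
    - rewrite Cmod_minus_sym. apply G. lra. }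
  destruct L as [L HL].
  assert (T : forall b, 0 <= b -> Cmod (CRInt f 0 b - L)%C <= K * exp (- b)).
  { intros b Hb. apply le_epsilon. intros eps He.
    assert (HL' := HL (fun y => ball_norm (V := C_R_NormedModule) L (mkposreal eps He) y)).
    destruct (HL' (locally_ball_norm (V := C_R_NormedModule) L (mkposreal eps He))) as [M HM].
    set (c := Rmax b (M + 1)).
    specialize (HM c). assert (Mc : M < c) by (unfold c; generalize (Rmax_r b (M + 1)); lra).
    specialize (HM Mc). unfold ball_norm in HM. rewrite <- Cmod_norm in HM.
    change (Cmod (CRInt f 0 c - L)%C < eps) in HM.
    assert (B := CRInt_exp_bound f K b c Hc HK (conj Hb (Rmax_l _ _))).
    replace (CRInt f 0 b - L)%C with ((CRInt f 0 c - L) - (CRInt f 0 c - CRInt f 0 b))%C by ring.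
    eapply Rle_trans. apply Cmod_minus_le. lra. }
  assert (E : Iinf f = L).
  { apply Iinf_eq; auto. intros eps He. destruct (exp_opp_small K eps K0 He) as [M [HM0 HM]].
    exists M. intros b Hb. eapply Rle_trans. apply T. lra. now apply HM. }
  rewrite E. exact T.
Qed.

Lemma Iinf_bound (f : R -> C) (K : R) : (forall r, Ccont f r) ->
  (forall r, 0 <= r -> Cmod (f r) <= K * exp (- r)) -> Cmod (Iinf f) <= K.
Proof.
  intros Hc HK. assert (H := Iinf_trunc f K Hc HK 0 (Rle_refl 0)).
  rewrite (CRInt_unique f 0 0 (RtoC 0)) in H by apply (is_RInt_point (V := C_R_NormedModule)).
  rewrite Ropp_0, exp_0 in H. replace (0 - Iinf f)%C with (- Iinf f)%C in H by ring.
  rewrite Cmod_opp in H. lra.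
Qed.

Lemma Iinf_ext (f g : R -> C) : (forall r, f r = g r) -> (forall r, Ccont f r) -> 
  (exists K, forall r, 0 <= r -> Cmod (f r) <= K * exp (- r)) -> Iinf f = Iinf g.
Proof.
  intros E Hc [K HK]. symmetry. assert (Hg : forall r, Ccont g r).
  { intros r. apply (continuous_ext f); auto. }
  assert (K0 : 0 <= K) by exact (exp_bound_ge_0 _ _ HK).
  apply Iinf_eq; auto. intros eps He.
  destruct (exp_opp_small K eps K0 He) as [M [HM0 HM]]. exists M. intros b Hb.
  rewrite <- (RInt_ext (V := C_R_CompleteNormedModule) f) by auto.
  eapply Rle_trans. apply (Iinf_trunc f K); auto. lra. now apply HM.
Qed.

Lemma Iinf_lin (c1 c2 : C) (f g : R -> C) (K1 K2 : R) :
  (forall r, Ccont f r) -> (forall r, Ccont g r) ->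
  (forall r, 0 <= r -> Cmod (f r) <= K1 * exp (- r)) ->
  (forall r, 0 <= r -> Cmod (g r) <= K2 * exp (- r)) ->
  Iinf (fun r => c1 * f r + c2 * g r)%C = (c1 * Iinf f + c2 * Iinf g)%C.
Proof.
  intros Hf Hg HK1 HK2.
  assert (K10 : 0 <= K1) by exact (exp_bound_ge_0 _ _ HK1).
  assert (K20 : 0 <= K2) by exact (exp_bound_ge_0 _ _ HK2).
  assert (P1 := Cmod_ge_0 c1). assert (P2 := Cmod_ge_0 c2).
  apply Iinf_eq. { intros r. now apply Ccont_lin. } intros eps He.
  destruct (exp_opp_small (Cmod c1 * K1 + Cmod c2 * K2) eps) as [M [HM0 HM]]; auto.
  { assert (0 <= Cmod c1 * K1) by now apply Rmult_le_pos.
    assert (0 <= Cmod c2 * K2) by now apply Rmult_le_pos. lra. }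
  exists M. intros b Hb.
  rewrite (CRInt_unique _ 0 b (c1 * CRInt f 0 b + c2 * CRInt g 0 b)%C).
  2: { apply (is_RInt_plus (V := C_R_NormedModule)); apply is_CRInt_scal; now apply CRInt_correct. }
  replace (c1 * CRInt f 0 b + c2 * CRInt g 0 b - (c1 * Iinf f + c2 * Iinf g))%C with
    (c1 * (CRInt f 0 b - Iinf f) + c2 * (CRInt g 0 b - Iinf g))%C by ring.
  eapply Rle_trans. apply Cmod_triangle. rewrite !Cmod_mult.
  assert (A1 := Iinf_trunc f K1 Hf HK1 b ltac:(lra)).
  assert (A2 := Iinf_trunc g K2 Hg HK2 b ltac:(lra)).
  specialize (HM b Hb).
  apply Rmult_le_compat_l with (r := Cmod c1) in A1; auto.
  apply Rmult_le_compat_l with (r := Cmod c2) in A2; auto. lra.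
Qed.

Lemma Iinf_derive (F f : R -> C) (K : R) :
  (forall r, rderiv F r (f r)) -> (forall r, Ccont f r) ->
  (forall r, 0 <= r -> Cmod (F r) <= K * exp (- r)) ->
  Iinf f = (- F 0)%C.
Proof.
  intros HF Hc HK.
  assert (K0 : 0 <= K) by exact (exp_bound_ge_0 _ _ HK).
  apply Iinf_eq; auto. intros eps He.
  destruct (exp_opp_small K eps K0 He) as [M [HM0 HM]]. exists M. intros b Hb.
  rewrite (CRInt_unique f 0 b (F b - F 0)%C).
  - replace (F b - F 0 - - F 0)%C with (F b) by ring.
    eapply Rle_trans. apply HK. lra. now apply HM.
  - apply (is_RInt_derive (V := C_R_CompleteNormedModule) F f); auto.
Qed.

(* Differentiation under the integral sign; the second derivative Phi2 controls the Taylor remainder. *)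
Lemma Iinf_cderiv (Phi Phi1 Phi2 Phi3 : C -> R -> C) :
  (forall z r, cderiv (fun z => Phi z r) z (Phi1 z r)) ->
  (forall z r, cderiv (fun z => Phi1 z r) z (Phi2 z r)) ->
  (forall z r, cderiv (fun z => Phi2 z r) z (Phi3 z r)) ->
  (forall z r, Ccont (Phi z) r) -> (forall z r, Ccont (Phi1 z) r) ->
  (forall B, exists K, forall z r, Cmod z <= B -> 0 <= r -> Cmod (Phi z r) <= K * exp (- r)) ->
  (forall B, exists K, forall z r, Cmod z <= B -> 0 <= r -> Cmod (Phi1 z r) <= K * exp (- r)) ->
  (forall B, exists K, forall z r, Cmod z <= B -> 0 <= r -> Cmod (Phi2 z r) <= K * exp (- r)) ->
  forall z, cderiv (fun z => Iinf (Phi z)) z (Iinf (Phi1 z)).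
Proof.
  intros D0 D1 D2 C0 C1 B0 B1 B2 z.
  destruct (B0 (Cmod z + 1)) as [K0 HK0]. destruct (B1 (Cmod z + 1)) as [K1 HK1].
  destruct (B2 (Cmod z + 1)) as [K2 HK2].
  assert (K2p : 0 <= K2).
  { specialize (HK2 z 0 ltac:(lra) (Rle_refl 0)). rewrite Ropp_0, exp_0 in HK2.
    assert (H := Cmod_ge_0 (Phi2 z 0)). lra. }
  apply cderiv_eps. intros eps He.
  (* The 1 keeps the segment from z to z + h in the ball of radius |z| + 1, where K0, K1 and K2 are
     uniform. *)
  exists (Rmin 1 (eps / (K2 + 1))). split.
  { apply Rmin_pos; [lra | apply Rdiv_lt_0_compat; lra]. }
  intros h Hh.
  assert (h1 : Cmod h < 1) by (eapply Rlt_le_trans; [apply Hh | apply Rmin_l]).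
  assert (h2 : Cmod h < eps / (K2 + 1)) by (eapply Rlt_le_trans; [apply Hh | apply Rmin_r]).
  assert (zh : Cmod (z + h)%C <= Cmod z + 1) by (eapply Rle_trans; [apply Cmod_triangle | lra]).
  assert (A1 : forall r, 0 <= r -> Cmod (Phi (z + h)%C r - Phi z r)%C <= (K0 + K0) * exp (- r)).
  { intros r Hr. eapply Rle_trans. apply Cmod_minus_le.
    assert (E1 := HK0 (z + h)%C r zh Hr). assert (E2 := HK0 z r ltac:(lra) Hr). lra. }
  assert (C2 : forall r, Ccont (fun r => Phi (z + h)%C r - Phi z r)%C r).
  { intros r. now apply (continuous_minus (V := C_R_NormedModule)). }
  assert (E1 : Iinf (fun r => Phi (z + h)%C r - Phi z r)%C = (Iinf (Phi (z + h)%C) - Iinf (Phi z))%C).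
  { replace (Iinf (Phi (z + h)%C) - Iinf (Phi z))%C with (1 * Iinf (Phi (z + h)%C) + (- (1)) * Iinf (Phi z))%C by ring.
    rewrite <- (Iinf_lin _ _ _ _ K0 K0); auto.
    - apply Iinf_ext; auto. intros; ring. eauto.
    - intros r Hr. apply HK0; auto. lra. }
  rewrite <- E1.
  assert (E2 : (Iinf (fun r => Phi (z + h)%C r - Phi z r) - h * Iinf (Phi1 z))%C =
    Iinf (fun r => 1 * (Phi (z + h)%C r - Phi z r) + (- h) * Phi1 z r)%C).
  { rewrite (Iinf_lin _ _ _ _ (K0 + K0) K1); auto. ring. intros r Hr. apply HK1; auto. lra. }
  rewrite E2.
  apply Rle_trans with (K2 * Cmod h ^ 2).
  - apply Iinf_bound. { intros r. now apply Ccont_lin. }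
    intros r Hr.
    replace (1 * (Phi (z + h)%C r - Phi z r) + - h * Phi1 z r)%C with
      (Phi (z + h)%C r - Phi z r - h * Phi1 z r)%C by ring.
    replace (K2 * Cmod h ^ 2 * exp (- r)) with (K2 * exp (- r) * Cmod h ^ 2) by ring.
    apply (Cmod_taylor (fun z => Phi z r) (fun z => Phi1 z r) (fun z => Phi2 z r) (fun z => Phi3 z r)); auto.
    intros s Hs. apply HK2; auto. eapply Rle_trans. apply Cmod_triangle.
    rewrite Cmod_mult, Cmod_R, Rabs_right by lra. assert (H := Cmod_ge_0 h). nra.
  - replace (K2 * Cmod h ^ 2) with (K2 * Cmod h * Cmod h) by ring.
    assert (H := Cmod_ge_0 h). apply Rmult_le_compat_r; auto.
    apply Rmult_lt_compat_l with (r := K2 + 1) in h2; [|lra].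
    replace ((K2 + 1) * (eps / (K2 + 1))) with eps in h2 by (field; lra). nra.
Qed.

(** * Rational functions with poles at most at the origin *)

(** [b] tells whether a pole is allowed, in which case the value at 0 is irrelevant. *)
Inductive alg (b : bool) : (C -> C) -> Prop :=
| alg_const (c : C) : alg b (fun _ => c)
| alg_id : alg b (fun t => t)
| alg_inv : b = true -> alg b (fun t => / t)%C
| alg_plus (f g : C -> C) : alg b f -> alg b g -> alg b (fun t => f t + g t)%C
| alg_mult (f g : C -> C) : alg b f -> alg b g -> alg b (fun t => f t * g t)%C
| alg_ext (f g : C -> C) : alg b f -> (forall t, (b = true -> t <> RtoC 0) -> f t = g t) -> alg b g.

Lemma cderiv_inv (z : C) : z <> RtoC 0 -> cderiv (fun t => / t)%C z (- (/ z * / z))%C.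
Proof.
  intros Hz. apply cderiv_eps. intros eps He.
  assert (Mz : 0 < Cmod z) by now apply Cmod_gt_0.
  exists (Rmin (Cmod z / 2) (eps * Cmod z ^ 3 / 2)). split.
  { apply Rmin_pos; [lra|]. assert (0 < Cmod z ^ 3) by now apply pow_lt. nra. }
  intros h Hh.
  assert (h1 : Cmod h < Cmod z / 2) by (eapply Rlt_le_trans; [apply Hh | apply Rmin_l]).
  assert (h2 : Cmod h < eps * Cmod z ^ 3 / 2) by (eapply Rlt_le_trans; [apply Hh | apply Rmin_r]).
  assert (M2 : Cmod z / 2 <= Cmod (z + h)%C).
  { assert (E := Cmod_minus_le (z + h) h). replace (z + h - h)%C with z in E by ring. lra. }
  assert (Hzh : (z + h)%C <> RtoC 0) by (apply Cmod_gt_0; lra).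
  replace (/ (z + h) - / z - h * - (/ z * / z))%C with (h * h / (z * z * (z + h)))%C by now field.
  assert (Hd : (z * z * (z + h))%C <> RtoC 0) by now repeat apply Cmult_neq_0.
  rewrite Cmod_div, !Cmod_mult by auto. unfold Rdiv.
  replace (Cmod h * Cmod h * / (Cmod z * Cmod z * Cmod (z + h)%C)) with
    ((Cmod h * / (Cmod z * Cmod z * Cmod (z + h)%C)) * Cmod h) by ring.
  apply Rmult_le_compat_r; [apply Cmod_ge_0|].
  assert (D : 0 < Cmod z * Cmod z * Cmod (z + h)%C) by (repeat apply Rmult_lt_0_compat; lra).
  apply Rmult_le_reg_r with (Cmod z * Cmod z * Cmod (z + h)%C); auto.
  rewrite Rmult_assoc, Rinv_l, Rmult_1_r by lra.
  left. eapply Rlt_le_trans. apply h2.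
  replace (eps * Cmod z ^ 3 / 2) with (eps * Cmod z * Cmod z * (Cmod z / 2)) by field.
  rewrite <- !Rmult_assoc. apply Rmult_le_compat_l; auto.
  repeat apply Rmult_le_pos; lra.
Qed.

Lemma alg_derive (b : bool) (f : C -> C) : alg b f ->
  exists f', alg b f' /\ forall z, (b = true -> z <> RtoC 0) -> cderiv f z (f' z).
Proof.
  induction 1 as [c| |E|f g Hf [f' [Af Df]] Hg [g' [Ag Dg]]|f g Hf [f' [Af Df]] Hg [g' [Ag Dg]]|f g Hf [f' [Af Df]] E].
  - exists (fun _ => RtoC 0). split. constructor. intros; apply cderiv_const.
  - exists (fun _ => RtoC 1). split. constructor. intros; apply cderiv_id.
  - exists (fun z => RtoC (-1) * (/ z * / z))%C. split.
    + repeat constructor; auto.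
    + intros z Hz. replace (RtoC (-1) * (/ z * / z))%C with (- (/ z * / z))%C by ring.
      apply cderiv_inv; auto.
  - exists (fun z => f' z + g' z)%C. split. now constructor. intros. apply cderiv_plus; auto.
  - exists (fun z => f' z * g z + f z * g' z)%C. split. repeat constructor; auto.
    intros. apply cderiv_mult; auto.
  - exists f'. split; auto. intros z Hz. destruct b.
    + apply (cderiv_ext_loc f g z (f' z) (Cmod z)); auto. now apply Cmod_gt_0, Hz.
      intros h Hh. apply E. intros _ A. assert (z = - h)%C by (replace z with (z + h - h)%C by ring; rewrite A; ring).
      subst z. rewrite Cmod_opp in Hh. lra.
    + apply (cderiv_ext f g); [intros t; apply E; discriminate | auto].
Qed.

Lemma alg_growth (b : bool) (f : C -> C) : alg b f ->
  exists K N, 0 <= K /\ forall t, (b = true -> 1 <= Cmod t) -> Cmod (f t) <= K * (1 + Cmod t) ^ N.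
Proof.
  assert (P : forall t (n m : nat), (n <= m)%nat -> (1 + Cmod t) ^ n <= (1 + Cmod t) ^ m).
  { intros t n m Hnm. apply Rle_pow; auto. generalize (Cmod_ge_0 t); lra. }
  assert (P0 : forall t (n : nat), 0 <= (1 + Cmod t) ^ n).
  { intros t n. apply pow_le. generalize (Cmod_ge_0 t); lra. }
  induction 1 as [c| |E|f g Hf [K1 [N1 [P1 B1]]] Hg [K2 [N2 [P2 B2]]]|f g Hf [K1 [N1 [P1 B1]]] Hg [K2 [N2 [P2 B2]]]|f g Hf [K1 [N1 [P1 B1]]] E].
  - exists (Cmod c), 0%nat. split. apply Cmod_ge_0. intros; simpl; lra.
  - exists 1, 1%nat. split. lra. intros; simpl; lra.
  - exists 1, 0%nat. split. lra. intros t Ht. specialize (Ht E). simpl.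
    rewrite Cmod_inv by (apply Cmod_gt_0; lra). rewrite Rmult_1_r.
    rewrite <- Rinv_1. apply Rinv_le_contravar; lra.
  - exists (K1 + K2), (N1 + N2)%nat. split. lra. intros t Ht. specialize (B1 t Ht). specialize (B2 t Ht).
    eapply Rle_trans. apply Cmod_triangle.
    assert (Q1 := P t N1 (N1 + N2)%nat ltac:(lia)). assert (Q2 := P t N2 (N1 + N2)%nat ltac:(lia)).
    apply Rmult_le_compat_l with (r := K1) in Q1; auto. apply Rmult_le_compat_l with (r := K2) in Q2; auto. lra.
  - exists (K1 * K2), (N1 + N2)%nat. split. now apply Rmult_le_pos. intros t Ht.
    rewrite Cmod_mult, pow_add.
    replace (K1 * K2 * ((1 + Cmod t) ^ N1 * (1 + Cmod t) ^ N2)) with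
     ((K1 * (1 + Cmod t) ^ N1) * (K2 * (1 + Cmod t) ^ N2)) by ring.
    apply Rmult_le_compat; try apply Cmod_ge_0; auto.
  - exists K1, N1. split; auto. intros t Ht. rewrite <- E; auto.
    intros Eb. apply Cmod_gt_0. specialize (Ht Eb). lra.
Qed.

Lemma alg_pow (b : bool) (n : nat) : alg b (fun t => t ^ n)%C.
Proof. induction n; simpl; repeat constructor; auto. Qed.

Lemma alg_sum (b : bool) (F : nat -> C -> C) (n : nat) :
  (forall i, alg b (F i)) -> alg b (fun t => sum_n (G := C_AbelianMonoid) (fun i => F i t) n).
Proof.
  intros HF. induction n.
  - apply alg_ext with (F 0%nat); auto. intros. now rewrite sum_O.
  - apply alg_ext with (fun t => sum_n (G := C_AbelianMonoid) (fun i => F i t) n + F (S n) t)%C.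
    + now constructor.
    + intros. now rewrite sum_Sn.
Qed.

Lemma alg_poly (d : nat) (p : nat -> C) : alg false (poly_eval d p).
Proof. apply (alg_sum false (fun r z => p r * z ^ r)%C). intros i. repeat constructor. apply alg_pow. Qed.

(** * Integrals from infinity *)

(** Faster than every exponential, because a factor t costs one unit of the rate [lam]: only so is
    the class stable under multiplication by polynomials. Uniformity for z in a ball is what
    differentiation under the integral requires. *)
Definition Dec (theta : R) (f : C -> C) : Prop :=
  forall lam B, exists K, forall z r, Cmod z <= B -> 0 <= r ->
    Cmod (f (z + RtoC r * cis theta)%C) <= K * exp (- (lam * r)).

Lemma Dec_ext (theta : R) (f g : C -> C) : (forall t, f t = g t) -> Dec theta f -> Dec theta g.
Proof.
  intros E H lam B. destruct (H lam B) as [K HK]. exists K. intros. rewrite <- E. auto.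
Qed.

Lemma Dec_scal (theta : R) (c : C) (f : C -> C) : Dec theta f -> Dec theta (fun t => c * f t)%C.
Proof.
  intros H lam B. destruct (H lam B) as [K HK]. exists (Cmod c * K). intros.
  rewrite Cmod_mult, Rmult_assoc. apply Rmult_le_compat_l; [apply Cmod_ge_0 | auto].
Qed.

Lemma Dec_plus (theta : R) (f g : C -> C) : Dec theta f -> Dec theta g -> Dec theta (fun t => f t + g t)%C.
Proof.
  intros H1 H2 lam B. destruct (H1 lam B) as [K1 HK1]. destruct (H2 lam B) as [K2 HK2].
  exists (K1 + K2). intros z r Hz Hr. eapply Rle_trans. apply Cmod_triangle.
  specialize (HK1 z r Hz Hr). specialize (HK2 z r Hz Hr). lra.
Qed.

Lemma Dec_id (theta : R) (f : C -> C) : Dec theta f -> Dec theta (fun t => t * f t)%C.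
Proof.
  intros H lam B. destruct (H (lam + 1) B) as [K HK]. exists ((Rabs B + 1) * K). intros z r Hz Hr.
  specialize (HK z r Hz Hr). rewrite Cmod_mult.
  assert (E : Cmod (z + RtoC r * cis theta)%C <= (Rabs B + 1) * exp r).
  { eapply Rle_trans. apply Cmod_triangle. rewrite Cmod_mult, Cmod_cis, Cmod_R, Rabs_right by lra.
    assert (A1 := Rle_abs B). assert (A2 := Rabs_pos B). assert (A3 := exp_ineq1_le r). nra. }
  replace ((Rabs B + 1) * K * exp (- (lam * r))) with (((Rabs B + 1) * exp r) * (K * exp (- ((lam + 1) * r)))).
  - apply Rmult_le_compat; auto; apply Cmod_ge_0.
  - replace (- (lam * r)) with (r + - ((lam + 1) * r)) by ring. rewrite exp_plus. ring.
Qed.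

Lemma Dec_alg (theta : R) (q : C -> C) : alg false q ->
  forall f, Dec theta f -> Dec theta (fun t => q t * f t)%C.
Proof.
  induction 1 as [c| |E|q1 q2 H1 I1 H2 I2|q1 q2 H1 I1 H2 I2|q1 q2 H1 I1 E]; intros f Hf.
  - now apply Dec_scal.
  - now apply Dec_id.
  - discriminate.
  - apply Dec_ext with (fun t => q1 t * f t + q2 t * f t)%C. intros; ring.
    apply Dec_plus; auto.
  - apply Dec_ext with (fun t => q1 t * (q2 t * f t))%C. intros; ring. auto.
  - apply Dec_ext with (fun t => q1 t * f t)%C; auto. intros t. rewrite E; auto.
Qed.

Lemma int_from_infty_eq (theta : R) (f : C -> C) (z : C) :
  int_from_infty theta f z = (- Iinf (fun r => f (z + RtoC r * cis theta) * cis theta))%C.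
Proof. reflexivity. Qed.

Lemma ray_cont (f f1 : C -> C) (z e : C) (r : R) :
  (forall t, cderiv f t (f1 t)) -> Ccont (fun r => f (z + RtoC r * e) * e)%C r.
Proof.
  intros D. apply (continuous_ext (fun r => e * f (z + RtoC r * e))%C). { intros; simpl; ring. }
  eapply rderiv_continuous. apply rderiv_scal.
  apply (rderiv_comp f (fun r => z + RtoC r * e)%C); [apply D | apply rderiv_line].
Qed.

Lemma Dec_bound (theta : R) (f : C -> C) : Dec theta f ->
  forall B, exists K, forall z r, Cmod z <= B -> 0 <= r ->
    Cmod (f (z + RtoC r * cis theta) * cis theta)%C <= K * exp (- r).
Proof.
  intros H B. destruct (H 1 B) as [K HK]. exists K. intros z r Hz Hr.
  rewrite Cmod_mult, Cmod_cis, Rmult_1_r. specialize (HK z r Hz Hr). now rewrite Rmult_1_l in HK.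
Qed.

Lemma cderiv_shift (f : C -> C) (z a l : C) : cderiv f (z + a)%C l -> cderiv (fun t => f (t + a)%C) z l.
Proof.
  intros H. replace l with ((1 + 0) * l)%C by ring.
  apply (cderiv_comp f (fun t => t + a)%C); auto. apply cderiv_plus; [apply cderiv_id | apply cderiv_const].
Qed.

Lemma cderiv_mult_r (f : C -> C) (c z a : C) : cderiv f z a -> cderiv (fun t => f t * c)%C z (a * c)%C.
Proof.
  intros H. rewrite Cmult_comm. apply cderiv_ext with (fun t => c * f t)%C. intros; ring.
  now apply cderiv_scal.
Qed.

(** The ray is translated together with z, so z enters through the integrand only. Differentiation
    under the integral yields the integral of f' along the same ray, which the fundamental theorem
    evaluates to f z. *)
Lemma cderiv_int_from_infty (theta : R) (f f1 f2 f3 : C -> C) :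
  (forall t, cderiv f t (f1 t)) -> (forall t, cderiv f1 t (f2 t)) -> (forall t, cderiv f2 t (f3 t)) ->
  Dec theta f -> Dec theta f1 -> Dec theta f2 ->
  forall z, cderiv (int_from_infty theta f) z (f z).
Proof.
  intros D0 D1 D2 E0 E1 E2 z. set (e := cis theta).
  assert (H := Iinf_cderiv (fun z r => f (z + RtoC r * e) * e)%C (fun z r => f1 (z + RtoC r * e) * e)%C
    (fun z r => f2 (z + RtoC r * e) * e)%C (fun z r => f3 (z + RtoC r * e) * e)%C).
  replace (f z) with (- Iinf (fun r => f1 (z + RtoC r * e) * e))%C.
  - apply cderiv_opp. apply H; try (intros; apply cderiv_mult_r, (cderiv_shift _ _ (RtoC r * e)); auto).
    + intros; now apply (ray_cont f f1).
    + intros; now apply (ray_cont f1 f2).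
    + now apply Dec_bound.
    + now apply Dec_bound.
    + now apply Dec_bound.
  - destruct (E0 1 (Cmod z)) as [K HK].
    rewrite (Iinf_derive (fun r => f (z + RtoC r * e))%C _ K).
    + rewrite Cmult_0_l, Cplus_0_r. ring.
    + intros r. rewrite Cmult_comm. apply (rderiv_comp f (fun r => z + RtoC r * e)%C); [auto | apply rderiv_line].
    + intros; now apply (ray_cont f1 f2).
    + intros r Hr. specialize (HK z r (Rle_refl _) Hr). now rewrite Rmult_1_l in HK.
Qed.

Lemma int_from_infty_bound (theta : R) (f f1 : C -> C) (z : C) (K : R) :
  (forall t, cderiv f t (f1 t)) ->
  (forall r, 0 <= r -> Cmod (f (z + RtoC r * cis theta)%C) <= K * exp (- r)) ->
  Cmod (int_from_infty theta f z) <= K.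
Proof.
  intros D H. rewrite int_from_infty_eq, Cmod_opp. apply Iinf_bound.
  - intros r. now apply (ray_cont f f1).
  - intros r Hr. rewrite Cmod_mult, Cmod_cis, Rmult_1_r. auto.
Qed.

(** * The Airy function *)

Definition kern (z t : C) : C := Cexp (t ^ 3 / RtoC 3 - z * t)%C.

Lemma cderiv_pow3 (t : C) : cderiv (fun t => t ^ 3 / RtoC 3)%C t (t ^ 2)%C.
Proof.
  apply cderiv_ext with (fun t => / 3 * (t * (t * t)))%C.
  { intros s. simpl. field. }
  replace (t ^ 2)%C with (/ 3 * (1 * (t * t) + t * (2 * t)))%C by (simpl; field).
  apply cderiv_scal. apply (cderiv_mult (fun t => t) (fun t => t * t)%C).
  apply cderiv_id. apply cderiv_sqr.
Qed.

Lemma cderiv_kern_t (z t : C) : cderiv (kern z) t ((t ^ 2 - z) * kern z t)%C.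
Proof.
  apply (cderiv_comp Cexp (fun t => t ^ 3 / RtoC 3 - z * t)%C). apply cderiv_Cexp.
  apply cderiv_minus. apply cderiv_pow3.
  assert (E := cderiv_scal z (fun t => t) t 1 (cderiv_id t)). now rewrite Cmult_1_r in E.
Qed.

Lemma cderiv_kern_z (z t : C) : cderiv (fun z => kern z t) z (- t * kern z t)%C.
Proof.
  apply (cderiv_comp Cexp (fun z => t ^ 3 / RtoC 3 - z * t)%C). apply cderiv_Cexp.
  replace (- t)%C with (0 - 1 * t)%C by ring.
  apply cderiv_minus. apply cderiv_const. apply cderiv_mult_r, cderiv_id.
Qed.

(** This characterizes e^(i PI/3) and e^(-i PI/3) together, so that both halves of the Airy contour
    are treated at once. *)
Definition cube_dir (e : C) : Prop := Re e = 1 / 2 /\ Im e ^ 2 = 3 / 4.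

Lemma cube_dir_cis : cube_dir (cis (PI / 3)) /\ cube_dir (cis (- (PI / 3))).
Proof.
  assert (S : sqrt 3 * sqrt 3 = 3) by (apply sqrt_sqrt; lra).
  split; split; rewrite cis_eq; unfold Re, Im; simpl.
  - apply cos_PI3.
  - rewrite sin_PI3. nra.
  - rewrite cos_neg. apply cos_PI3.
  - rewrite sin_neg, sin_PI3. nra.
Qed.

Lemma Cmod_cube_dir (e : C) : cube_dir e -> Cmod e = 1.
Proof.
  intros [H1 H2]. assert (H := Cmod2_alt e). rewrite H1, H2 in H.
  assert (P := Cmod_ge_0 e). nra.
Qed.

Lemma cube_dir_pow3 (e : C) : cube_dir e -> (e ^ 3)%C = (- (1))%C.
Proof.
  intros [H1 H2]. destruct e as [x y]. unfold Re, Im in *; simpl in H1, H2.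
  assert (Y : y * y = 3 / 4) by (simpl in H2; lra). simpl. unfold Cmult, Copp, RtoC; simpl. f_equal.
  - transitivity (x * x * x - 3 * x * (y * y)). ring. rewrite H1, Y. field.
  - transitivity (y * (3 * x * x - y * y)). ring. rewrite H1, Y. field.
Qed.

Lemma Cmod_kern (z t : C) : Cmod (kern z t) = exp (Re t ^ 3 / 3 - Re t * Im t ^ 2 - Re (z * t)%C).
Proof.
  unfold kern. rewrite Cmod_Cexp. f_equal.
  replace (t ^ 3 / RtoC 3)%C with (RtoC (/ 3) * (t * (t * t)))%C.
  - destruct t as [x y], z as [a b]. unfold Cminus, Cplus, Copp, Cmult, RtoC, Re, Im; simpl. field.
  - rewrite RtoC_inv by lra. simpl. field.
Qed.

Lemma cubic_bound (A B : R) : 0 <= A -> 0 <= B ->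
  exists K, forall r, 0 <= r -> A * r ^ 2 + B * r - r ^ 3 / 3 <= K.
Proof.
  intros HA HB. set (M := 3 * (A + B + 1)). exists (A * M ^ 2 + B * M). intros r Hr.
  assert (0 <= M) by (unfold M; lra).
  destruct (Rle_dec r M).
  - assert (r ^ 2 <= M ^ 2) by (apply pow_incr; lra).
    assert (0 <= r ^ 3) by (apply pow_le; lra).
    assert (A * r ^ 2 <= A * M ^ 2) by (apply Rmult_le_compat_l; lra).
    assert (B * r <= B * M) by (apply Rmult_le_compat_l; lra). lra.
  - assert (r >= M) by lra.
    assert (0 <= A * M ^ 2) by (apply Rmult_le_pos; [lra | apply pow2_ge_0]).
    assert (0 <= B * M) by (apply Rmult_le_pos; lra).
    assert (1 <= r) by (unfold M in *; lra).
    assert (r ^ 3 / 3 >= (A + B + 1) * r ^ 2).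
    { replace (r ^ 3 / 3) with (r / 3 * r ^ 2) by field.
      apply Rle_ge, Rmult_le_compat_r; [apply pow2_ge_0 | unfold M in *; lra]. }
    assert (B * r <= B * r ^ 2) by (apply Rmult_le_compat_l; auto; nra).
    assert (0 <= r ^ 2) by apply pow2_ge_0. lra.
Qed.

(** Because e^3 = -1, the cube of t + r e contributes -r^3/3 to the exponent. Everything else,
    collected in [v], is at most quadratic in r with coefficients bounded in terms of B, so
    [cubic_bound] absorbs it together with [lam] r. *)
Lemma kern_decay (e : C) : cube_dir e -> forall lam B, exists K, forall z t r,
  Cmod z <= B -> Cmod t <= B -> 0 <= r -> Cmod (kern z (t + RtoC r * e)) <= K * exp (- (lam * r)).
Proof.
  intros He lam B. assert (N := Cmod_cube_dir e He). assert (HB := Rabs_pos B). set (b := Rabs B) in *.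
  destruct (cubic_bound b (b ^ 2 + b + Rabs lam)) as [K HK].
  { lra. } { assert (H1 := pow2_ge_0 b). assert (H2 := Rabs_pos lam). lra. }
  exists (exp (b ^ 3 + b ^ 2 + K)). intros z t r Hz Ht Hr.
  assert (Bb : B <= b) by apply Rle_abs.
  set (v := (/ 3 * (t * t * t) + RtoC r * (t * t * e) + RtoC (r ^ 2) * (t * (e * e)) - z * (t + RtoC r * e))%C).
  assert (E : ((t + RtoC r * e) ^ 3 / RtoC 3 - z * (t + RtoC r * e))%C = (v + RtoC (- r ^ 3 / 3))%C).
  { unfold v. rewrite RtoC_div, RtoC_opp, !RtoC_pow by lra.
    replace (- RtoC r ^ 3)%C with (RtoC r ^ 3 * e ^ 3)%C by (rewrite (cube_dir_pow3 e He); ring).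
    simpl. field. }
  unfold kern. rewrite E, Cexp_plus, Cexp_RtoC, Cmod_mult, Cmod_Cexp, Cmod_R.
  rewrite (Rabs_right (exp (- r ^ 3 / 3))) by (left; apply exp_pos).
  rewrite <- !exp_plus. apply exp_le.
  assert (Hv : Cmod v <= b ^ 3 + b ^ 2 * r + b * r ^ 2 + b * (b + r)).
  { assert (H0 := Cmod_ge_0 t). assert (b2 : 0 <= b ^ 2) by apply pow2_ge_0.
    assert (T2 : Cmod t * Cmod t <= b ^ 2) by (simpl; rewrite Rmult_1_r; apply Rmult_le_compat; lra).
    assert (T3 : Cmod t * Cmod t * Cmod t <= b ^ 2 * b) by (apply Rmult_le_compat; nra).
    unfold v. eapply Rle_trans. apply Cmod_minus_le. apply Rplus_le_compat.
    - eapply Rle_trans. apply Cmod_triangle. apply Rplus_le_compat.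
      + eapply Rle_trans. apply Cmod_triangle. rewrite !Cmod_mult, N, Cmod_inv, !Cmod_R, !Rabs_right by (lra || (intros X; apply RtoC_inj in X; lra)).
        apply Rplus_le_compat; [simpl in *; nra|]. rewrite Rmult_1_r, Rmult_comm. now apply Rmult_le_compat_r.
      + rewrite !Cmod_mult, N, Cmod_R, Rabs_right, !Rmult_1_r, Rmult_comm by apply Rle_ge, pow2_ge_0.
        apply Rmult_le_compat_r. apply pow2_ge_0. lra.
    - rewrite Cmod_mult. apply Rmult_le_compat; try apply Cmod_ge_0. lra.
      eapply Rle_trans. apply Cmod_triangle. rewrite Cmod_mult, N, Cmod_R, Rabs_right by lra. lra. }
  assert (HK' := HK r Hr). assert (Rv := Rle_abs (Re v)). assert (Cv := re_le_Cmod v).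
  assert (Hl : lam * r <= Rabs lam * r) by (apply Rmult_le_compat_r; [lra | apply Rle_abs]).
  lra.
Qed.

Lemma kern_Dec (theta : R) (z : C) : cube_dir (cis theta) -> Dec theta (kern z).
Proof.
  intros He lam B. destruct (kern_decay _ He lam (Rmax B (Cmod z))) as [K HK].
  exists K. intros t r Ht Hr. apply HK; auto. apply Rmax_r. eapply Rle_trans; [apply Ht | apply Rmax_l].
Qed.

(** The m-th derivative in z of int_0^(infinity e^(i theta)) exp (t^3/3 - z t) dt. *)
Definition J (m : nat) (theta : R) (z : C) : C :=
  Iinf (fun r => (- (0 + RtoC r * cis theta)) ^ m * kern z (0 + RtoC r * cis theta) * cis theta)%C.

Lemma alg_opp_pow (m : nat) : alg false (fun t => (- t) ^ m)%C.
Proof.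
  apply alg_ext with (fun t => RtoC ((-1) ^ m) * t ^ m)%C.
  - repeat constructor. apply alg_pow.
  - intros s _. rewrite RtoC_pow, <- Cpow_mult_l. f_equal. ring.
Qed.

Lemma cderiv_wkern (z t : C) (m : nat) :
  exists l : C -> C, forall t, cderiv (fun t => (- t) ^ m * kern z t)%C t (l t).
Proof.
  destruct (alg_derive _ _ (alg_opp_pow m)) as [q [_ Hq]].
  eexists. intros s. apply cderiv_mult. apply Hq. discriminate. apply cderiv_kern_t.
Qed.

Lemma exp_pow (n : nat) (x : R) : exp x ^ n = exp (INR n * x).
Proof.
  induction n.
  - simpl. now rewrite Rmult_0_l, exp_0.
  - rewrite S_INR. simpl. rewrite IHn, <- exp_plus. f_equal; ring.
Qed.

Lemma pow_le_exp (m : nat) (r : R) : 0 <= r -> r ^ m <= exp (INR m * r).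
Proof.
  intros Hr. induction m.
  - simpl. rewrite Rmult_0_l, exp_0. lra.
  - rewrite S_INR. replace ((INR m + 1) * r) with (r + INR m * r) by ring. rewrite exp_plus. simpl.
    apply Rmult_le_compat; auto. apply pow_le; auto. apply exp_ge_id.
Qed.

Lemma wkern_bound (m : nat) (theta : R) : cube_dir (cis theta) ->
  forall B, exists K, forall z r, Cmod z <= B -> 0 <= r ->
   Cmod ((- (0 + RtoC r * cis theta)) ^ m * kern z (0 + RtoC r * cis theta) * cis theta)%C <= K * exp (- r).
Proof.
  intros He B. destruct (kern_decay _ He (INR m + 1) (Rmax 0 B)) as [K HK].
  exists K. intros z r Hz Hr.
  rewrite !Cmod_mult, Cmod_pow, Cmod_opp, Cmod_cis, Rmult_1_r.
  specialize (HK z 0%C r). rewrite Cplus_0_l in *. rewrite Cmod_mult, Cmod_cis, Cmod_R, Rabs_right, Rmult_1_r by lra.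
  apply Rle_trans with (exp (INR m * r) * (K * exp (- ((INR m + 1) * r)))).
  - apply Rmult_le_compat. apply pow_le; lra. apply Cmod_ge_0. now apply pow_le_exp.
    apply HK; auto. eapply Rle_trans; [apply Hz | apply Rmax_r]. rewrite Cmod_0. apply Rmax_l.
  - right. replace (- r) with (INR m * r + - ((INR m + 1) * r)) by ring. rewrite exp_plus. ring.
Qed.

Lemma wkern_cont (m : nat) (theta : R) (z : C) (r : R) :
  Ccont (fun r => (- (0 + RtoC r * cis theta)) ^ m * kern z (0 + RtoC r * cis theta) * cis theta)%C r.
Proof.
  destruct (cderiv_wkern z 0 m) as [l Hl].
  exact (ray_cont (fun t => (- t) ^ m * kern z t)%C l 0 (cis theta) r Hl).
Qed.

Lemma cderiv_J (m : nat) (theta : R) (z : C) : cube_dir (cis theta) ->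
  cderiv (J m theta) z (J (S m) theta z).
Proof.
  intros He.
  assert (D : forall n z r, cderiv (fun z => (- (0 + RtoC r * cis theta)) ^ n * kern z (0 + RtoC r * cis theta) * cis theta)%C z
    ((- (0 + RtoC r * cis theta)) ^ S n * kern z (0 + RtoC r * cis theta) * cis theta)%C).
  { intros n y r. apply cderiv_mult_r. rewrite Cpow_S.
    replace (- (0 + RtoC r * cis theta) * (- (0 + RtoC r * cis theta)) ^ n * kern y (0 + RtoC r * cis theta))%C
      with ((- (0 + RtoC r * cis theta)) ^ n * (- (0 + RtoC r * cis theta) * kern y (0 + RtoC r * cis theta)))%C by ring.
    apply cderiv_scal, cderiv_kern_z. }
  unfold J. eapply (Iinf_cderiv _ _ _ _ (D m) (D (S m)) (D (S (S m)))).
  - intros; apply wkern_cont.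
  - intros; apply wkern_cont.
  - now apply wkern_bound.
  - now apply wkern_bound.
  - now apply wkern_bound.
Qed.

(** (t^2 - z) exp(t^3/3 - z t) is an exact derivative, so only the value at the vertex 0 survives.
    It is the same for the two rays, hence cancels in [Aid] and leaves the Airy equation. *)
Lemma J_airy (theta : R) (z : C) : cube_dir (cis theta) ->
  (J 2 theta z - z * J 0 theta z)%C = (- (1))%C.
Proof.
  intros He. set (e := cis theta).
  destruct (wkern_bound 2 theta He (Cmod z)) as [K2 HK2].
  destruct (wkern_bound 0 theta He (Cmod z)) as [K0 HK0].
  assert (E : Iinf (fun r => 1 * ((- (0 + RtoC r * e)) ^ 2 * kern z (0 + RtoC r * e) * e) +
     (- z) * ((- (0 + RtoC r * e)) ^ 0 * kern z (0 + RtoC r * e) * e))%C = (1 * J 2 theta z + (- z) * J 0 theta z)%C).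
  { apply (Iinf_lin _ _ _ _ K2 K0).
    - intros; apply wkern_cont.
    - intros; apply wkern_cont.
    - intros r Hr. apply HK2; auto. lra.
    - intros r Hr. apply HK0; auto. lra. }
  replace (J 2 theta z - z * J 0 theta z)%C with (1 * J 2 theta z + (- z) * J 0 theta z)%C by ring.
  rewrite <- E. destruct (kern_Dec theta z He 1 0) as [K HK].
  rewrite (Iinf_derive (fun r => kern z (0 + RtoC r * e))%C _ K).
  - f_equal. rewrite Cmult_0_l, Cplus_0_l. unfold kern.
    replace ((RtoC 0) ^ 3 / RtoC 3 - z * 0)%C with (RtoC 0). apply Cexp_0. simpl. field.
  - intros r.
    replace (1 * ((- (0 + RtoC r * e)) ^ 2 * kern z (0 + RtoC r * e) * e) +
     (- z) * ((- (0 + RtoC r * e)) ^ 0 * kern z (0 + RtoC r * e) * e))%C with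
     (e * (((0 + RtoC r * e) ^ 2 - z) * kern z (0 + RtoC r * e)))%C by (simpl; ring).
    apply (rderiv_comp (kern z) (fun r => 0 + RtoC r * e)%C); [apply cderiv_kern_t | apply rderiv_line].
  - intros r. apply Ccont_lin; apply wkern_cont.
  - intros r Hr. specialize (HK 0%C r). rewrite Rmult_1_l in HK. apply HK; auto. rewrite Cmod_0. lra.
Qed.

Definition Aid (m : nat) (z : C) : C :=
  ((J m (PI / 3) z - J m (- (PI / 3)) z) / (RtoC 2 * RtoC PI * Ci))%C.

Lemma Ai_Aid (z : C) : Ai z = Aid 0 z.
Proof.
  assert (E : forall theta, cube_dir (cis theta) ->
    int_from_infty theta (fun t : C => Cexp (t ^ 3 / RtoC 3 - z * t)%C) (RtoC 0) = (- J 0 theta z)%C).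
  { intros theta He. rewrite int_from_infty_eq. f_equal.
    apply Iinf_ext.
    - intros r. simpl pow. unfold kern. ring.
    - intros r. exact (ray_cont (kern z) _ 0 (cis theta) r (cderiv_kern_t z)).
    - destruct (Dec_bound theta (kern z) (kern_Dec _ z He) 0) as [K HK].
      exists K. intros r Hr. apply HK; auto. rewrite Cmod_0. lra. }
  unfold Ai, Aid. rewrite !E by apply cube_dir_cis. f_equal. ring.
Qed.

Lemma cderiv_Aid (m : nat) (z : C) : cderiv (Aid m) z (Aid (S m) z).
Proof. unfold Aid, Cdiv. apply cderiv_mult_r. apply cderiv_minus; apply cderiv_J, cube_dir_cis. Qed.

Lemma two_pi_i_neq_0 : (RtoC 2 * RtoC PI * Ci)%C <> RtoC 0.
Proof.
  assert (H := PI_neq0).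
  apply Cmult_neq_0; [apply Cmult_neq_0|].
  - intros E; apply RtoC_inj in E; lra.
  - intros E; apply RtoC_inj in E; lra.
  - apply Cmod_gt_0. rewrite Cmod_Ci. lra.
Qed.

Lemma Aid_2 (z : C) : Aid 2 z = (z * Aid 0 z)%C.
Proof.
  destruct cube_dir_cis as [E1 E2].
  assert (A1 := J_airy _ z E1). assert (A2 := J_airy _ z E2).
  unfold Aid.
  replace (J 2 (PI / 3) z - J 2 (- (PI / 3)) z)%C with
    (z * (J 0 (PI / 3) z - J 0 (- (PI / 3)) z) + ((J 2 (PI / 3) z - z * J 0 (PI / 3) z) -
     (J 2 (- (PI / 3)) z - z * J 0 (- (PI / 3)) z)))%C by ring.
  rewrite A1, A2. field. split.
  - apply Cmod_gt_0. rewrite Cmod_Ci. lra.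
  - intros E; apply RtoC_inj in E; now apply PI_neq0.
Qed.

Lemma cderiv_0_const (f : C -> C) (a : C) : (forall t, cderiv f t (RtoC 0)) -> f a = f (RtoC 0).
Proof.
  intros D.
  assert (E := Cmod_diff_le_segment f (fun _ => RtoC 0) (fun _ => RtoC 0) 0 a 0).
  assert (E' : Cmod (f (0 + a) - f 0)%C <= 0 * Cmod a).
  { apply E; auto. intros; apply cderiv_const. intros; rewrite Cmod_0; lra. }
  rewrite Cplus_0_l in E'.
  assert (Z : (f a - f 0)%C = RtoC 0). { apply Cmod_eq_0. assert (H := Cmod_ge_0 (f a - f 0)%C). lra. }
  replace (f a) with (f a - f 0 + f 0)%C by ring. rewrite Z. ring.
Qed.

(* The right-hand side does not depend on the vertex a of the contour. *)
Lemma Aid_shift (m : nat) (z a : C) :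
  Aid m z = ((int_from_infty (- (PI / 3)) (fun t => (- t) ^ m * kern z t)%C a -
    int_from_infty (PI / 3) (fun t => (- t) ^ m * kern z t)%C a) / (RtoC 2 * RtoC PI * Ci))%C.
Proof.
  set (F := fun a => (int_from_infty (- (PI / 3)) (fun t => (- t) ^ m * kern z t)%C a -
    int_from_infty (PI / 3) (fun t => (- t) ^ m * kern z t)%C a)%C).
  change (Aid m z = F a / (RtoC 2 * RtoC PI * Ci))%C.
  assert (P := alg_opp_pow m).
  assert (N : forall q, alg false q -> exists q1, alg false q1 /\
    forall t, cderiv (fun t => q t * kern z t)%C t (q1 t * kern z t)%C).
  { intros q Hq. destruct (alg_derive false q Hq) as [q' [Aq' Dq]].
    exists (fun t => q' t + q t * (t ^ 2 - z))%C. split.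
    - repeat constructor; auto.
    - intros t. replace ((q' t + q t * (t ^ 2 - z)) * kern z t)%C with
        (q' t * kern z t + q t * ((t ^ 2 - z) * kern z t))%C by ring.
      apply cderiv_mult. apply Dq. discriminate. apply cderiv_kern_t. }
  destruct (N _ P) as [q1 [P1 D0]]. destruct (N _ P1) as [q2 [P2 D1]]. destruct (N _ P2) as [q3 [P3 D2]].
  assert (DF : forall theta, cube_dir (cis theta) -> forall t,
    cderiv (int_from_infty theta (fun t => (- t) ^ m * kern z t)%C) t ((- t) ^ m * kern z t)%C).
  { intros theta He. apply (cderiv_int_from_infty theta _ _ _ _ D0 D1 D2);
    apply Dec_alg; auto; now apply kern_Dec. }
  rewrite (cderiv_0_const F).
  - unfold F, Aid. rewrite !int_from_infty_eq. unfold J. f_equal. ring.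
  - intros t. replace (RtoC 0) with ((- t) ^ m * kern z t - (- t) ^ m * kern z t)%C by ring.
    apply cderiv_minus; apply DF, cube_dir_cis.
Qed.

(** With the vertex moved to a, the real part of the exponent at a + r e is a^3/3 - a Re z + r
    (a^2/2 - Re (z e)) - a r^2/2 - r^3/3. The factor |t|^m costs (1 + a)^m e^(m r), and the 1 in the
    hypothesis pays for the decay e^(-r) of the integrand. What remains is at most k^2 r - r^3/3,
    whose maximum for r >= 0 is (2/3) k^3, at r = k. *)
Lemma Aid_bound (m : nat) (z : C) (a k : R) : 0 <= a -> 0 <= k ->
  (forall e, cube_dir e -> INR m + 1 + a ^ 2 / 2 - Re (z * e)%C <= k ^ 2) ->
  Cmod (Aid m z) <= (1 + a) ^ m * exp (a ^ 3 / 3 - a * Re z + 2 / 3 * k ^ 3).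
Proof.
  intros Ha Hk H. rewrite (Aid_shift m z (RtoC a)).
  set (K := (1 + a) ^ m * exp (a ^ 3 / 3 - a * Re z + 2 / 3 * k ^ 3)).
  assert (B : forall theta, cube_dir (cis theta) ->
     Cmod (int_from_infty theta (fun t => (- t) ^ m * kern z t)%C (RtoC a)) <= K).
  { intros theta He. destruct (cderiv_wkern z 0 m) as [l Hl].
    apply (int_from_infty_bound theta _ l); auto. intros r Hr.
    specialize (H _ He).
    rewrite Cmod_mult, Cmod_pow, Cmod_opp, Cmod_kern.
    assert (L : Cmod (RtoC a + RtoC r * cis theta)%C ^ m <= (1 + a) ^ m * exp (INR m * r)).
    { apply Rle_trans with (((1 + a) * exp r) ^ m).
      - apply pow_incr. split. apply Cmod_ge_0.
        eapply Rle_trans. apply Cmod_triangle. rewrite Cmod_mult, Cmod_cis, !Cmod_R, !Rabs_right by lra.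
        assert (A3 := exp_ineq1_le r). nra.
      - rewrite Rpow_mult_distr, exp_pow. lra. }
    unfold K. rewrite Rmult_assoc, <- exp_plus.
    eapply Rle_trans. apply Rmult_le_compat_r. left; apply exp_pos. apply L.
    rewrite Rmult_assoc. apply Rmult_le_compat_l. apply pow_le; lra.
    rewrite <- exp_plus. apply exp_le.
    destruct He as [He1 He2]. destruct z as [x y], (cis theta) as [p q].
    unfold Re, Im in *; simpl fst in *; simpl snd in *.
    replace (a + (r * p - 0 * q)) with (a + r * p) by ring.
    replace (0 + (r * q + 0 * p)) with (r * q) by ring.
    rewrite He1 in *.
    replace ((a + r * (1 / 2)) ^ 3 / 3 - (a + r * (1 / 2)) * (r * q) ^ 2) with
      (a ^ 3 / 3 + a ^ 2 * r / 2 + a * r ^ 2 / 4 + r ^ 3 / 24 - (a * r ^ 2 + r ^ 3 / 2) * q ^ 2) by field.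
    rewrite He2.
    assert (Q : k ^ 2 * r - r ^ 3 / 3 <= 2 / 3 * k ^ 3).
    { assert (0 <= (r - k) ^ 2 * (r + 2 * k)) by (apply Rmult_le_pos; [apply pow2_ge_0 | lra]).
      replace ((r - k) ^ 2 * (r + 2 * k)) with (r ^ 3 - 3 * k ^ 2 * r + 2 * k ^ 3) in * by ring. lra. }
    apply Rmult_le_compat_r with (r := r) in H; auto.
    assert (0 <= a * r ^ 2) by (apply Rmult_le_pos; [lra | apply pow2_ge_0]).
    nra. }
  destruct cube_dir_cis as [E1 E2]. assert (B1 := B _ E1). assert (B2 := B _ E2).
  rewrite Cmod_div by apply two_pi_i_neq_0.
  rewrite !Cmod_mult, Cmod_Ci, !Cmod_R, !Rabs_right by (generalize PI_RGT_0; lra).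
  assert (P := PI2_1).
  assert (K0 : 0 <= K) by (eapply Rle_trans; [apply Cmod_ge_0 | apply B1]).
  apply Rmult_le_reg_r with (2 * PI * 1). lra.
  unfold Rdiv. rewrite Rmult_assoc, Rinv_l, Rmult_1_r by lra.
  eapply Rle_trans. apply Cmod_minus_le. nra.
Qed.

(** * The Wronskian constant Ai(0) Ai'(0) *)

Definition mom (m : nat) (x : R) : R := RInt (fun r => r ^ m * exp (- r ^ 3 / 3)) 0 x.

(* With r = s v, d/dx (mom 0 x * mom 1 x) = x^2 int_0^1 (1 + v) exp (- x^3 (1 + v^3) / 3) dv, and
   (1 + v) / (1 + v^3) = 1 / (1 - v + v^2): hence mom 0 * mom 1 + mom_rem is constant. *)
Definition mom_rem (x : R) : R :=
  RInt (fun v => exp (- x ^ 3 * (1 + v ^ 3) / 3) / (1 - v + v ^ 2)) 0 1.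

Lemma mom_integrand_cont (m : nat) (r : R) : continuous (fun r => r ^ m * exp (- r ^ 3 / 3)) r.
Proof. apply (ex_derive_continuous (fun r => r ^ m * exp (- r ^ 3 / 3))). auto_derive; auto. Qed.

Lemma ex_RInt_cont (f : R -> R) (a b : R) : (forall r, continuous f r) -> ex_RInt f a b.
Proof. intros H. apply (ex_RInt_continuous (V := R_CompleteNormedModule)). auto. Qed.

Lemma is_derive_mom (m : nat) (x : R) : is_derive (mom m) x (x ^ m * exp (- x ^ 3 / 3)).
Proof.
  apply (is_derive_RInt (fun r => r ^ m * exp (- r ^ 3 / 3)) (mom m) 0).
  - exists (mkposreal 1 Rlt_0_1). intros y _. apply (RInt_correct (V := R_CompleteNormedModule)).
    apply ex_RInt_cont, mom_integrand_cont.
  - apply mom_integrand_cont.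
Qed.

Lemma mom_scaled (m : nat) (x : R) :
  mom m x = x ^ S m * RInt (fun v => v ^ m * exp (- (x * v) ^ 3 / 3)) 0 1.
Proof.
  unfold mom.
  assert (E := RInt_comp_lin (V := R_CompleteNormedModule) (fun r => r ^ m * exp (- r ^ 3 / 3)) x 0 0 1).
  replace (x * 0 + 0) with 0 in E by ring. replace (x * 1 + 0) with x in E by ring.
  rewrite <- E by (apply ex_RInt_cont, mom_integrand_cont).
  rewrite <- (RInt_scal (V := R_CompleteNormedModule)).
  - apply RInt_ext. intros v _. unfold scal; simpl. unfold mult; simpl.
    rewrite Rplus_0_r, Rpow_mult_distr. ring.
  - apply ex_RInt_cont. intros v. apply (ex_derive_continuous (fun v => v ^ m * exp (- (x * v) ^ 3 / 3))).
    auto_derive; auto.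
Qed.

Lemma quad_pos (v : R) : 0 < 1 - v + v ^ 2.
Proof. nra. Qed.

Lemma is_derive_mom_rem (x : R) : is_derive mom_rem x
  (RInt (fun v => - (x ^ 2 * ((1 + v) * exp (- x ^ 3 * (1 + v ^ 3) / 3)))) 0 1).
Proof.
  set (f := fun x v => exp (- x ^ 3 * (1 + v ^ 3) / 3) / (1 - v + v ^ 2)).
  assert (D : forall x v, is_derive (fun u => f u v) x (- (x ^ 2 * ((1 + v) * exp (- x ^ 3 * (1 + v ^ 3) / 3))))).
  { intros y v. unfold f. assert (Q := quad_pos v).
    auto_derive. lra. 
    replace (exp (- y ^ 3 * (1 + v ^ 3) / 3)) with (exp (- (y * (y * (y * 1))) * (1 + v * (v * (v * 1))) * / 3))
      by (f_equal; simpl; field).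
    simpl. field. simpl in Q. lra. }
  replace (RInt (fun v => - (x ^ 2 * ((1 + v) * exp (- x ^ 3 * (1 + v ^ 3) / 3)))) 0 1)
    with (RInt (fun v => Derive (fun u => f u v) x) 0 1).
  2: { apply RInt_ext. intros v _. apply is_derive_unique, D. }
  apply (is_derive_RInt_param f 0 1 x).
  - exists (mkposreal 1 Rlt_0_1). intros y _ v _. eexists. apply D.
  - intros v _.
    apply continuity_2d_pt_ext with (fun x v => - (x ^ 2 * ((1 + v) * exp (- x ^ 3 * (1 + v ^ 3) / 3)))).
    { intros y w. symmetry. apply is_derive_unique, D. }
    assert (I1 := continuity_2d_pt_id1 x v). assert (I2 := continuity_2d_pt_id2 x v).
    assert (CC := continuity_2d_pt_const x v).
    assert (PW : forall g n, continuity_2d_pt g x v -> continuity_2d_pt (fun a b => g a b ^ n) x v).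
    { intros g n Hg. induction n; simpl; auto. now apply continuity_2d_pt_mult. }
    apply continuity_2d_pt_opp, continuity_2d_pt_mult. now apply (PW (fun u _ => u)).
    apply continuity_2d_pt_mult. now apply continuity_2d_pt_plus.
    apply (continuity_1d_2d_pt_comp exp). apply derivable_continuous_pt, derivable_pt_exp.
    unfold Rdiv. apply continuity_2d_pt_mult; auto. apply continuity_2d_pt_mult.
    apply continuity_2d_pt_opp. now apply (PW (fun u _ => u)).
    apply continuity_2d_pt_plus; auto.
  - exists (mkposreal 1 Rlt_0_1). intros y _. apply ex_RInt_cont. intros v.
    apply (ex_derive_continuous (f y)). unfold f. assert (Q := quad_pos v). auto_derive. simpl in Q. lra.
Qed.

Lemma is_derive_mom_prod (x : R) : is_derive (fun x => mom 0 x * mom 1 x + mom_rem x) x 0.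
Proof.
  set (L := RInt (fun v => - (x ^ 2 * ((1 + v) * exp (- x ^ 3 * (1 + v ^ 3) / 3)))) 0 1).
  assert (D := is_derive_plus (fun x => mom 0 x * mom 1 x) mom_rem x _ _
    (is_derive_mult (mom 0) (mom 1) x _ _ (is_derive_mom 0 x) (is_derive_mom 1 x) Rmult_comm)
    (is_derive_mom_rem x)). fold L in D.
  replace 0 with (plus (plus (mult (x ^ 0 * exp (- x ^ 3 / 3)) (mom 1 x)) (mult (mom 0 x) (x ^ 1 * exp (- x ^ 3 / 3)))) L).
  exact D.
  unfold plus, mult; simpl plus; simpl mult. change (x ^ 0 * exp (- x ^ 3 / 3) * mom 1 x + mom 0 x * (x ^ 1 * exp (- x ^ 3 / 3)) + L = 0).
  rewrite !mom_scaled.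
  set (I1 := RInt (fun v => v ^ 1 * exp (- (x * v) ^ 3 / 3)) 0 1).
  set (I0 := RInt (fun v => v ^ 0 * exp (- (x * v) ^ 3 / 3)) 0 1).
  assert (C : forall m v, continuous (fun v => v ^ m * exp (- (x * v) ^ 3 / 3)) v).
  { intros m v. apply (ex_derive_continuous (fun v => v ^ m * exp (- (x * v) ^ 3 / 3))). auto_derive; auto. }
  assert (E : L = - (x ^ 2 * exp (- x ^ 3 / 3)) * (I0 + I1)).
  { unfold L. apply is_RInt_unique.
    apply is_RInt_ext with (fun v => scal (- (x ^ 2 * exp (- x ^ 3 / 3)))
      (plus (v ^ 0 * exp (- (x * v) ^ 3 / 3)) (v ^ 1 * exp (- (x * v) ^ 3 / 3)))).
    - intros v _. unfold scal, plus; simpl; unfold mult; simpl.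
      replace (exp (- (x * (x * (x * 1))) * (1 + v * (v * (v * 1))) / 3)) with
        (exp (- (x * (x * (x * 1))) / 3) * exp (- (x * v * (x * v * (x * v * 1))) / 3))
        by (rewrite <- exp_plus; f_equal; field). ring.
    - apply (is_RInt_scal (V := R_NormedModule)), (is_RInt_plus (V := R_NormedModule));
      apply (RInt_correct (V := R_CompleteNormedModule)), ex_RInt_cont, C. }
  rewrite E. simpl. ring.
Qed.

(** At x = 0 the exponential is 1, and 1/(1 - v + v^2) has the primitive (2/sqrt 3) atan ((2 v -
    1)/sqrt 3), where the arctangent runs from -PI/6 to PI/6. *)
Lemma mom_rem_0 : mom_rem 0 = 2 * PI / (3 * sqrt 3).
Proof.
  assert (S : sqrt 3 * sqrt 3 = 3) by (apply sqrt_sqrt; lra).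
  assert (S0 : 0 < sqrt 3) by (apply sqrt_lt_R0; lra).
  unfold mom_rem. apply is_RInt_unique.
  apply is_RInt_ext with (fun v => / (1 - v + v ^ 2)).
  { intros v _. replace (- 0 ^ 3 * (1 + v ^ 3) / 3) with 0 by (simpl; field). rewrite exp_0. match goal with |- @eq _ ?a ?b => change (@eq R a b) end. field.
    generalize (quad_pos v); lra. }
  assert (P : atan (/ sqrt 3) = PI / 6).
  { assert (T := tan_PI6). unfold Rdiv at 2 in T. rewrite Rmult_1_l in T. rewrite <- T.
    apply atan_tan. generalize PI_RGT_0; lra. }
  replace (2 * PI / (3 * sqrt 3)) with
    (minus (2 / sqrt 3 * atan ((2 * 1 - 1) / sqrt 3)) (2 / sqrt 3 * atan ((2 * 0 - 1) / sqrt 3))).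
  - apply (is_RInt_derive (fun v => 2 / sqrt 3 * atan ((2 * v - 1) / sqrt 3))).
    + intros v _. assert (Q := quad_pos v). auto_derive; auto.
      simpl in Q. simpl.
      assert (H : 1 + (2 * v + - (1)) * / sqrt 3 * ((2 * v + - (1)) * / sqrt 3 * 1) = 4 / 3 * (1 - v + v * (v * 1))).
      { apply Rmult_eq_reg_r with (sqrt 3 * sqrt 3). 2: nra. rewrite S at 2. field_simplify; [|lra]. 
        replace (sqrt 3 ^ 2) with 3 by (simpl; lra). ring. }
      rewrite H. apply Rmult_eq_reg_r with (sqrt 3 * sqrt 3). 2: nra. rewrite S at 2. field. lra.
    + intros v _. assert (Q := quad_pos v). apply (ex_derive_continuous (fun v => / (1 - v + v ^ 2))).
      auto_derive. simpl in Q. lra.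
  - replace ((2 * 1 - 1) / sqrt 3) with (/ sqrt 3) by (field; lra).
    replace ((2 * 0 - 1) / sqrt 3) with (- / sqrt 3) by (field; lra).
    rewrite atan_opp, P. unfold minus, plus, opp; simpl. field. lra.
Qed.

Lemma mom_prod (x : R) : mom 0 x * mom 1 x = 2 * PI / (3 * sqrt 3) - mom_rem x.
Proof.
  rewrite <- mom_rem_0.
  assert (E : mom 0 x * mom 1 x + mom_rem x = mom 0 0 * mom 1 0 + mom_rem 0).
  { apply eq_sym, Rminus_diag_uniq. 
    destruct (MVT_gen (fun x => mom 0 x * mom 1 x + mom_rem x) x 0 (fun _ => 0)) as [c [_ Hc]].
    - intros y _. apply is_derive_mom_prod.
    - intros y _. apply derivable_continuous_pt. exists 0. apply is_derive_Reals, is_derive_mom_prod.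
    - rewrite Hc. ring. }
  unfold mom at 3 in E. rewrite RInt_point in E. change zero with 0 in E. lra.
Qed.

Lemma is_lim_exp_bound (f : R -> R) (l K : R) :
  (forall x, 0 <= x -> Rabs (f x - l) <= K * exp (- x)) -> is_lim f p_infty l.
Proof.
  intros H. apply is_lim_spec. intros eps.
  assert (K0 : 0 <= K).
  { specialize (H 0 (Rle_refl 0)). rewrite Ropp_0, exp_0 in H.
    assert (P := Rabs_pos (f 0 - l)). lra. }
  destruct (exp_opp_small K (eps / 2) K0) as [M [HM0 HM]]. { assert (H' := cond_pos eps). lra. }
  exists M. intros x Hx. eapply Rle_lt_trans. apply H. lra.
  eapply Rle_lt_trans. apply HM. lra. assert (H' := cond_pos eps). lra.
Qed.

Lemma is_lim_mom_rem : is_lim mom_rem p_infty 0.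
Proof.
  (* The constants come from x^3/3 >= x - 2/3, that is (x - 1)^2 (x + 2) >= 0, and from 1 - v + v^2
     >= 3/4. *)
  apply (is_lim_exp_bound _ _ (exp (2 / 3) * (4 / 3))). intros x Hx. rewrite Rminus_0_r.
  assert (C : ex_RInt (fun v => exp (- x ^ 3 * (1 + v ^ 3) / 3) / (1 - v + v ^ 2)) 0 1).
  { apply ex_RInt_cont. intros v.
    apply (ex_derive_continuous (fun v => exp (- x ^ 3 * (1 + v ^ 3) / 3) / (1 - v + v ^ 2))).
    assert (Q := quad_pos v). auto_derive. simpl in Q. lra. }
  eapply Rle_trans. apply (abs_RInt_le_const _ 0 1 (exp (2 / 3) * (4 / 3) * exp (- x))); auto. lra.
  2: lra.
  intros v Hv. assert (Q := quad_pos v). rewrite Rabs_right.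
  2: { apply Rle_ge, Rmult_le_pos. left; apply exp_pos. left; now apply Rinv_0_lt_compat. }
  replace (exp (2 / 3) * (4 / 3) * exp (- x)) with (exp (2 / 3 + - x) * (4 / 3)) by (rewrite exp_plus; ring).
  unfold Rdiv at 1. apply Rmult_le_compat. left; apply exp_pos. left; now apply Rinv_0_lt_compat.
  - apply exp_le. assert (0 <= x ^ 3 * v ^ 3) by (apply Rmult_le_pos; apply pow_le; lra).
    assert (0 <= (x - 1) ^ 2 * (x + 2)) by (apply Rmult_le_pos; [apply pow2_ge_0 | lra]). simpl in *. lra.
  - replace (4 / 3) with (/ (3 / 4)) by field. apply Rinv_le_contravar; [lra|]. assert (0 <= (v - 1 / 2) ^ 2) by apply pow2_ge_0. simpl in *. lra.
Qed.

Lemma mom_integrand (theta : R) (m : nat) (r : R) : cube_dir (cis theta) ->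
  ((- (0 + RtoC r * cis theta)) ^ m * kern 0 (0 + RtoC r * cis theta) * cis theta)%C =
  ((- (1)) ^ m * cis theta ^ S m * RtoC (r ^ m * exp (- r ^ 3 / 3)))%C.
Proof.
  intros He. unfold kern.
  replace ((0 + RtoC r * cis theta) ^ 3 / RtoC 3 - 0 * (0 + RtoC r * cis theta))%C with (RtoC (- r ^ 3 / 3)).
  - rewrite Cexp_RtoC, RtoC_mult, RtoC_pow.
    replace (- (0 + RtoC r * cis theta))%C with ((- (1)) * (RtoC r * cis theta))%C by ring.
    rewrite !Cpow_mult_l, Cpow_S. ring.
  - rewrite Cplus_0_l, Cpow_mult_l, (cube_dir_pow3 _ He), <- RtoC_pow, Cmult_0_l, RtoC_div, RtoC_opp by lra. field.
Qed.

Lemma is_RInt_zero (b : R) : is_RInt (V := R_NormedModule) (fun _ => 0) 0 b 0.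
Proof.
  assert (H : forall c : R, c = 0 -> is_RInt (V := R_NormedModule) (fun _ => 0) 0 b c ->
    is_RInt (V := R_NormedModule) (fun _ => 0) 0 b 0) by (intros c ->; auto).
  apply (H (scal (b - 0) 0)); [apply Rmult_0_r | apply (is_RInt_const (V := R_NormedModule))].
Qed.

Lemma CRInt_wkern (theta : R) (m : nat) (x : R) : cube_dir (cis theta) ->
  CRInt (fun r => (- (0 + RtoC r * cis theta)) ^ m * kern 0 (0 + RtoC r * cis theta) * cis theta)%C 0 x =
  ((- (1)) ^ m * cis theta ^ S m * RtoC (mom m x))%C.
Proof.
  intros He. apply CRInt_unique.
  apply (is_RInt_ext (V := C_R_NormedModule) (fun r => (- (1)) ^ m * cis theta ^ S m * RtoC (r ^ m * exp (- r ^ 3 / 3)))%C).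
  - intros r _. now rewrite mom_integrand.
  - apply is_CRInt_scal. apply (is_RInt_fct_extend_pair (U := R_NormedModule) (V := R_NormedModule)); simpl.
    + apply (RInt_correct (V := R_CompleteNormedModule)), ex_RInt_cont, mom_integrand_cont.
    + apply is_RInt_zero.
Qed.

Lemma J_mom (theta : R) (m : nat) : cube_dir (cis theta) ->
  exists K, forall x, 0 <= x ->
    Cmod ((- (1)) ^ m * cis theta ^ S m * RtoC (mom m x) - J m theta 0)%C <= K * exp (- x).
Proof.
  intros He. destruct (wkern_bound m theta He 0) as [K HK]. exists K. intros x Hx.
  rewrite <- CRInt_wkern by auto. apply Iinf_trunc; auto.
  - intros r; apply wkern_cont.
  - intros r Hr. apply HK; auto. rewrite Cmod_0. lra.
Qed.


(** Since e^3 = -1, on both rays the kernel at z = 0 becomes e^(-r^3/3), so [alpha] and [beta] are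
    the complete moments of orders 0 and 1. Each of them is a value of the Gamma function up to a
    power of 3; only their product is elementary, and it is the limit of [mom_prod]. *)
Lemma J_0_values : exists alpha beta : R, alpha * beta = 2 * PI / (3 * sqrt 3) /\
  forall theta, cube_dir (cis theta) ->
    J 0 theta 0 = (cis theta * RtoC alpha)%C /\ J 1 theta 0 = (- (cis theta ^ 2 * RtoC beta))%C.
Proof.
  assert (L : forall m, exists a : R, is_lim (mom m) p_infty a /\
     forall theta, cube_dir (cis theta) ->
      J m theta 0 = ((- (1)) ^ m * cis theta ^ S m * RtoC a)%C).
  { intros m. 
    assert (Nc : forall theta, Cmod ((- (1)) ^ m * cis theta ^ S m)%C = 1).
    { intros theta. rewrite Cmod_mult, !Cmod_pow, Cmod_cis, Cmod_m1, !pow1. ring. }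
    set (c := ((- (1)) ^ m * cis (PI / 3) ^ S m)%C).
    assert (c0 : c <> RtoC 0) by (apply Cmod_gt_0; unfold c; rewrite Nc; lra).
    (* Convergence of the real moment is inherited from the complex integral on one ray; the other
       ray then shares the limit. *)
    assert (La : is_lim (mom m) p_infty (Re (J m (PI / 3) 0 / c)%C)).
    { destruct (J_mom (PI / 3) m) as [K HK]; try apply cube_dir_cis.
      apply (is_lim_exp_bound _ _ K). intros x Hx. specialize (HK x Hx). fold c in HK.
      replace (mom m x - Re (J m (PI / 3) 0 / c)%C) with (Re (RtoC (mom m x) - J m (PI / 3) 0 / c)%C) by reflexivity.
      eapply Rle_trans. apply re_le_Cmod.
      replace (RtoC (mom m x) - J m (PI / 3) 0 / c)%C with ((c * RtoC (mom m x) - J m (PI / 3) 0) / c)%C by (field; auto).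
      rewrite Cmod_div by auto. unfold c at 2. rewrite Nc. lra. }
    exists (Re (J m (PI / 3) 0 / c)%C). split; auto.
    intros theta H1. apply Iinf_eq. { intros; apply wkern_cont. }
    set (a := Re (J m (PI / 3) 0 / c)%C) in *.
    intros eps Heps. apply is_lim_spec in La. destruct (La (mkposreal eps Heps)) as [M HM]. simpl in HM.
    exists (M + 1). intros b Hb.
    rewrite CRInt_wkern by auto.
    replace ((- (1)) ^ m * cis theta ^ S m * RtoC (mom m b) - (- (1)) ^ m * cis theta ^ S m * RtoC a)%C with
      ((- (1)) ^ m * cis theta ^ S m * RtoC (mom m b - a))%C by (rewrite RtoC_minus; ring).
    rewrite Cmod_mult, Nc, Cmod_R, Rmult_1_l. left. apply HM. lra. }
  destruct (L 0%nat) as [a [La Ha]]. destruct (L 1%nat) as [b [Lb Hb]].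
  exists a, b. split.
  - assert (E1 := is_lim_mult (mom 0) (mom 1) p_infty a b La Lb I). simpl in E1.
    assert (E2 : is_lim (fun x => mom 0 x * mom 1 x) p_infty (2 * PI / (3 * sqrt 3))).
    { apply is_lim_ext with (fun x => 2 * PI / (3 * sqrt 3) - mom_rem x). intros; now rewrite mom_prod.
      replace (Finite (2 * PI / (3 * sqrt 3))) with (Rbar_minus (2 * PI / (3 * sqrt 3)) 0) by (simpl; f_equal; ring).
      apply is_lim_minus'. apply is_lim_const. apply is_lim_mom_rem. }
    apply is_lim_unique in E1. apply is_lim_unique in E2. rewrite E1 in E2. now inversion E2.
  - intros theta H1. rewrite Ha, Hb by auto. split; simpl; ring.
Qed.

(** With e and e' the two directions, Ai(0) is proportional to e - e' = i sqrt 3 and Ai'(0) to e^2 -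
    e'^2 = (e - e') (e + e'), where e + e' = 1. *)
Lemma Ai_0_Ai'_0 : (Aid 0 0 * Aid 1 0)%C = RtoC (- / (2 * PI * sqrt 3)).
Proof.
  assert (S : sqrt 3 * sqrt 3 = 3) by (apply sqrt_sqrt; lra).
  assert (S0 : 0 < sqrt 3) by (apply sqrt_lt_R0; lra).
  destruct J_0_values as [a [b [Eab H]]]. destruct cube_dir_cis as [D1 D2].
  destruct (H _ D1) as [H10 H11]. destruct (H _ D2) as [H20 H21].
  unfold Aid. rewrite H10, H11, H20, H21.
  assert (Q : (cis (PI / 3) - cis (- (PI / 3)))%C = (Ci * RtoC (sqrt 3))%C).
  { rewrite !cis_eq, cos_neg, sin_neg, sin_PI3. unfold Cminus, Cplus, Copp, Cmult, Ci, RtoC; simpl. f_equal; field. }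
  assert (Q2 : (cis (PI / 3) + cis (- (PI / 3)))%C = RtoC 1).
  { rewrite !cis_eq, cos_neg, sin_neg, cos_PI3. unfold Cminus, Cplus, Copp, Cmult, Ci, RtoC; simpl. f_equal; field. }
  set (e := cis (PI / 3)) in *. set (e' := cis (- (PI / 3))) in *.
  replace ((e * RtoC a - e' * RtoC a) / (RtoC 2 * RtoC PI * Ci) * ((- (e ^ 2 * RtoC b) - - (e' ^ 2 * RtoC b)) / (RtoC 2 * RtoC PI * Ci)))%C
    with (- ((e - e') * (e - e') * (e + e')) * (RtoC (a * b)) / ((RtoC 2 * RtoC PI * Ci) * (RtoC 2 * RtoC PI * Ci)))%C.
  2: { rewrite RtoC_mult. simpl. field. split. apply Cmod_gt_0. rewrite Cmod_Ci. lra.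
       intros E; apply RtoC_inj in E. now apply PI_neq0. }
  rewrite Q, Q2, Eab.
  replace ((RtoC 2 * RtoC PI * Ci) * (RtoC 2 * RtoC PI * Ci))%C with (RtoC (- (4 * PI * PI))).
  2: { unfold Cmult, RtoC, Ci; simpl. f_equal; ring. }
  replace (- (Ci * RtoC (sqrt 3) * (Ci * RtoC (sqrt 3)) * 1))%C with (RtoC (sqrt 3 * sqrt 3)).
  2: { unfold Cmult, Copp, RtoC, Ci; simpl. f_equal; ring. }
  rewrite S, <- RtoC_mult, <- RtoC_div.
  - f_equal. field. generalize PI_neq0; split; lra.
  - generalize PI_RGT_0; nra.
Qed.

(** * The particular solutions *)


(** The vertex stays at 0. The choice k = s + 2 leaves room for m + 1 <= 2 next to |v| <= s^2. *)
Lemma Aid_growth (m : nat) (v : C) (s : R) : (m <= 1)%nat -> 0 <= s -> Cmod v <= s ^ 2 ->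
  Cmod (Aid m v) <= exp (2 / 3 * (s + 2) ^ 3).
Proof.
  intros Hm Hs Hv.
  assert (H := Aid_bound m v 0 (s + 2) (Rle_refl 0) ltac:(lra)).
  replace (0 ^ 3 / 3 - 0 * Re v + 2 / 3 * (s + 2) ^ 3) with (2 / 3 * (s + 2) ^ 3) in H by (simpl; field).
  rewrite Rplus_0_r, pow1, Rmult_1_l in H. apply H. intros e He.
  assert (E2 := Re_lower (v * e)%C). rewrite Cmod_mult, (Cmod_cube_dir e He) in E2.
  assert (E3 := le_INR _ _ Hm). simpl in E3. nra.
Qed.

(** The vertex a = s is the saddle point of t^3/3 - s^2 t. There a^2/2 nearly cancels Re (v e), so k
    = s/5 is enough once s >= 10. The ideal exponent -(2/3) s^3 loses s^3/100 to the deviation of v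
    and (2/3) (s/5)^3 to k, which still leaves -s^3/2. *)
Lemma Aid_decay (m : nat) (v : C) (s r : R) : (m <= 1)%nat -> 10 <= s -> 0 <= r ->
  Cmod (v - RtoC (s ^ 2))%C <= s ^ 2 / 100 ->
  Cmod (Aid m (v + RtoC r)%C) <= (1 + s) ^ m * exp (- (s ^ 3 / 2) - s * r).
Proof.
  intros Hm Hs Hr Hv.
  eapply Rle_trans. apply (Aid_bound m _ s (s / 5)); try lra.
  - intros e He.
    assert (E : Re ((v + RtoC r) * e)%C = s ^ 2 / 2 + r / 2 + Re ((v - RtoC (s ^ 2)) * e)%C).
    { destruct He as [He _]. destruct v as [x y], e as [p q].
      unfold Cminus, Cplus, Copp, Cmult, RtoC, Re in *; simpl fst in *; simpl snd in *. rewrite He. field. }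
    rewrite E.
    assert (E2 := Re_lower ((v - RtoC (s ^ 2)) * e)%C). rewrite Cmod_mult, (Cmod_cube_dir e He) in E2.
    assert (E3 := le_INR _ _ Hm). simpl in E3. nra.
  - apply Rmult_le_compat_l. apply pow_le; lra. apply exp_le.
    assert (E : Re (v + RtoC r)%C = s ^ 2 + r + Re (v - RtoC (s ^ 2))%C).
    { destruct v as [x y]. unfold Cminus, Cplus, Copp, RtoC, Re; simpl. ring. }
    rewrite E.
    assert (E2 := Re_lower (v - RtoC (s ^ 2))%C).
    assert (E3 : - Re (v - RtoC (s ^ 2))%C * s <= s ^ 2 / 100 * s) by (apply Rmult_le_compat_r; lra).
    assert (E4 : 0 <= s ^ 3) by (apply pow_le; lra). simpl in *. nra.
Qed.

(** A fixed vertex a gives the rate a on the whole ball of radius B. As a is arbitrary, this yields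
    every rate required by [Dec]. *)
Lemma Aid_right_decay (m : nat) (a B : R) : (m <= 1)%nat -> 0 <= a -> 0 <= B -> exists K, forall v r,
  Cmod v <= B -> 0 <= r -> Cmod (Aid m (v + RtoC r)%C) <= K * exp (- (a * r)).
Proof.
  intros Hm Ha HB. set (k := 2 + a + B).
  exists ((1 + a) ^ m * exp (a ^ 3 / 3 + a * B + 2 / 3 * k ^ 3)). intros v r Hv Hr.
  eapply Rle_trans. apply (Aid_bound m _ a k); try (unfold k; lra).
  - intros e He.
    assert (E : Re ((v + RtoC r) * e)%C = r / 2 + Re (v * e)%C).
    { destruct He as [He _]. destruct v as [x y], e as [p q].
      unfold Cplus, Cmult, RtoC, Re in *; simpl fst in *; simpl snd in *. rewrite He. field. }
    rewrite E.
    assert (E2 := Re_lower (v * e)%C). rewrite Cmod_mult, (Cmod_cube_dir e He) in E2.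
    assert (E3 := le_INR _ _ Hm). simpl in E3. unfold k. nra.
  - rewrite Rmult_assoc. apply Rmult_le_compat_l. apply pow_le; lra.
    rewrite <- exp_plus. apply exp_le.
    assert (E : Re (v + RtoC r)%C = r + Re v).
    { destruct v as [x y]. unfold Cplus, RtoC, Re; simpl. ring. }
    rewrite E.
    assert (E2 := Re_lower v). nra.
Qed.

Section Solutions.

Variables (d : nat) (p : nat -> C) (u : R).
Hypothesis hu : 0 < u.

Let U : R := Rpower u (2 / 3).

Lemma U_pos : 0 < U.
Proof. apply exp_pos. Qed.

Lemma U_cube : U ^ 3 = u ^ 2.
Proof.
  unfold U. rewrite <- Rpower_pow, Rpower_mult by apply exp_pos.
  replace (2 / 3 * INR 3) with (INR 2) by (simpl; field). now apply Rpower_pow.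
Qed.

(** The m-th derivative of z |-> Ai_b (u^(2/3) z). *)
Definition Aiu (m : nat) (b : Z) (z : C) : C :=
  ((RtoC U * cis (- dir b)) ^ m * Aid m (RtoC U * cis (- dir b) * z))%C.

Lemma cis_dir_cube (b : Z) : (cis (- dir b) ^ 3)%C = RtoC 1.
Proof.
  rewrite cis_pow. unfold dir. replace (INR 3 * - (2 * PI * IZR b / 3)) with (- IZR b * (2 * PI)) by (simpl; field).
  rewrite cis_eq.
  assert (H : cos (2 * (- IZR b * PI)) = 1 /\ sin (2 * (- IZR b * PI)) = 0).
  { assert (S : sin (- IZR b * PI) = 0). { rewrite <- opp_IZR. apply sin_eq_0_1. now exists (- b)%Z. }
    rewrite cos_2a_sin, sin_2a, S. split; ring. }
  replace (- IZR b * (2 * PI)) with (2 * (- IZR b * PI)) by ring.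
  destruct H as [-> ->]. reflexivity.
Qed.

Lemma Aiu_0 (b : Z) (z : C) : Aiu 0 b z = Aij b (RtoC U * z).
Proof. unfold Aiu, Aij. rewrite Ai_Aid. simpl. rewrite Cmult_1_l. f_equal. ring. Qed.

Lemma cderiv_Aiu (m : nat) (b : Z) (z : C) : cderiv (Aiu m b) z (Aiu (S m) b z).
Proof.
  unfold Aiu. rewrite Cpow_S, (Cmult_comm (RtoC U * cis (- dir b))), <- Cmult_assoc.
  apply cderiv_scal. apply (cderiv_comp (Aid m) (fun z => RtoC U * cis (- dir b) * z)%C).
  apply cderiv_Aid.
  assert (E := cderiv_scal (RtoC U * cis (- dir b)) (fun t => t) z 1 (cderiv_id z)). now rewrite Cmult_1_r in E.
Qed.

(** Rotation by a cube root of unity preserves the Airy equation, and the scaling U = u^(2/3) turns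
    its coefficient into U^3 = u^2. *)
Lemma Aiu_2 (b : Z) (z : C) : Aiu 2 b z = (RtoC (u ^ 2) * z * Aiu 0 b z)%C.
Proof.
  unfold Aiu. rewrite Aid_2, <- U_cube, RtoC_pow.
  replace ((RtoC U * cis (- dir b)) ^ 2 * (RtoC U * cis (- dir b) * z * Aid 0 (RtoC U * cis (- dir b) * z)))%C
    with (RtoC U ^ 3 * (cis (- dir b) ^ 3) * z * Aid 0 (RtoC U * cis (- dir b) * z))%C by ring.
  rewrite cis_dir_cube. simpl. ring.
Qed.

Lemma Aiu_Dec (m : nat) (b : Z) : (m <= 1)%nat -> Dec (dir b) (Aiu m b).
Proof.
  intros Hm lam B. assert (P := U_pos).
  destruct (Aid_right_decay m (Rabs lam / U) (U * Rabs B) Hm) as [K HK].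
  { apply Rmult_le_pos. apply Rabs_pos. left; now apply Rinv_0_lt_compat. }
  { apply Rmult_le_pos. lra. apply Rabs_pos. }
  exists (U ^ m * K). intros z r Hz Hr. unfold Aiu.
  rewrite Cmod_mult, Cmod_pow, Cmod_mult, Cmod_cis, Cmod_R, Rmult_1_r, Rabs_right by lra.
  rewrite Rmult_assoc. apply Rmult_le_compat_l. apply pow_le; lra.
  replace (RtoC U * cis (- dir b) * (z + RtoC r * cis (dir b)))%C with
    (RtoC U * cis (- dir b) * z + RtoC (U * r))%C.
  - eapply Rle_trans. apply HK.
    + rewrite !Cmod_mult, Cmod_cis, Cmod_R, Rmult_1_r, Rabs_right by lra.
      apply Rmult_le_compat_l; [lra|]. eapply Rle_trans. apply Hz. apply Rle_abs.
    + apply Rmult_le_pos; lra.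
    + assert (K0 : 0 <= K).
      { specialize (HK 0%C 0). rewrite Cmod_0 in HK.
        assert (T : 0 <= K * exp (- (Rabs lam / U * 0))).
        { eapply Rle_trans; [|apply HK]; [apply Cmod_ge_0 | apply Rmult_le_pos; [lra | apply Rabs_pos] | lra]. }
        rewrite Rmult_0_r, Ropp_0, exp_0 in T. lra. }
      apply Rmult_le_compat_l; auto. apply exp_le.
      replace (Rabs lam / U * (U * r)) with (Rabs lam * r) by (field; lra).
      assert (E := Rle_abs lam). nra.
  - rewrite RtoC_mult.
    replace (RtoC U * cis (- dir b) * (z + RtoC r * cis (dir b)))%C with
     (RtoC U * cis (- dir b) * z + RtoC U * RtoC r * (cis (dir b) * cis (- dir b)))%C by ring.
    rewrite cis_opp_r. ring.
Qed.

Definition src (b : Z) (t : C) : C := (poly_eval d p t * Aiu 0 b t)%C.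
Definition Fint (b : Z) : C -> C := int_from_infty (dir b) (src b).

(* This class is closed under differentiation, as Ai_b'' = z Ai_b up to scaling. *)
Lemma src_family (b : Z) (q r : C -> C) : alg false q -> alg false r ->
  exists q1 r1, alg false q1 /\ alg false r1 /\
   Dec (dir b) (fun t => q t * Aiu 0 b t + r t * Aiu 1 b t)%C /\
   forall t, cderiv (fun t => q t * Aiu 0 b t + r t * Aiu 1 b t)%C t (q1 t * Aiu 0 b t + r1 t * Aiu 1 b t)%C.
Proof.
  intros Hq Hr. destruct (alg_derive _ _ Hq) as [q' [Aq Dq]]. destruct (alg_derive _ _ Hr) as [r' [Ar Dr]].
  exists (fun t => q' t + r t * (RtoC (u ^ 2) * t))%C, (fun t => q t + r' t)%C.
  split; [|split; [|split]].
  - repeat constructor; auto.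
  - constructor; auto.
  - apply Dec_plus; apply Dec_alg; auto; try (apply Aiu_Dec; lia).
  - intros t.
    replace ((q' t + r t * (RtoC (u ^ 2) * t)) * Aiu 0 b t + (q t + r' t) * Aiu 1 b t)%C with
     ((q' t * Aiu 0 b t + q t * Aiu 1 b t) + (r' t * Aiu 1 b t + r t * Aiu 2 b t))%C by (rewrite Aiu_2; ring).
    apply cderiv_plus; apply cderiv_mult; try apply cderiv_Aiu; [apply Dq | apply Dr]; discriminate.
Qed.

Lemma cderiv_src (b : Z) : exists l : C -> C, forall t, cderiv (src b) t (l t).
Proof.
  destruct (alg_derive _ _ (alg_poly d p)) as [q [_ Dq]].
  eexists. intros t. apply cderiv_mult. apply Dq; discriminate. apply cderiv_Aiu.
Qed.

Lemma cderiv_Fint (b : Z) (z : C) : cderiv (Fint b) z (src b z).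
Proof.
  destruct (src_family b _ _ (alg_poly d p) (alg_const false 0)) as [q1 [r1 [Q1 [R1 [E0 D0]]]]].
  destruct (src_family b _ _ Q1 R1) as [q2 [r2 [Q2 [R2 [E1 D1]]]]].
  destruct (src_family b _ _ Q2 R2) as [q3 [r3 [Q3 [R3 [E2 D2]]]]].
  assert (X : forall t, (poly_eval d p t * Aiu 0 b t + 0 * Aiu 1 b t)%C = src b t) by (intros; unfold src; ring).
  refine (cderiv_int_from_infty (dir b) (src b) _ _ _ _ D1 D2 _ E1 E2 z).
  - intros t. eapply cderiv_ext; [apply X | apply D0].
  - eapply Dec_ext; [apply X | apply E0].
Qed.

Definition Wsol (c : C) (j k : Z) (z : C) : C := (c * (Aiu 0 j z * Fint k z - Aiu 0 k z * Fint j z))%C.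
Definition Wsol1 (c : C) (j k : Z) (z : C) : C := (c * (Aiu 1 j z * Fint k z - Aiu 1 k z * Fint j z))%C.

Definition wronsk (j k : Z) : C :=
  (RtoC U * (Aid 0 0 * Aid 1 0) * (cis (- dir k) - cis (- dir j)))%C.

(** The equation has no first-order term, so the Wronskian is constant. At 0 the rotated functions
    all have the value Ai(0), and their derivatives differ from Ai'(0) by known factors: only the
    product Ai(0) Ai'(0) enters. *)
Lemma Aiu_wronskian (j k : Z) (z : C) : (Aiu 0 j z * Aiu 1 k z - Aiu 1 j z * Aiu 0 k z)%C = wronsk j k.
Proof.
  transitivity (Aiu 0 j 0 * Aiu 1 k 0 - Aiu 1 j 0 * Aiu 0 k 0)%C.
  - apply (cderiv_0_const (fun z => Aiu 0 j z * Aiu 1 k z - Aiu 1 j z * Aiu 0 k z)%C). intros t.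
    replace (RtoC 0) with ((Aiu 1 j t * Aiu 1 k t + Aiu 0 j t * Aiu 2 k t) - (Aiu 2 j t * Aiu 0 k t + Aiu 1 j t * Aiu 1 k t))%C.
    + apply cderiv_minus; apply cderiv_mult; apply cderiv_Aiu.
    + rewrite !Aiu_2. ring.
  - unfold Aiu, wronsk. rewrite !Cmult_0_r. simpl. ring.
Qed.

(** Variation of parameters: the terms in which an integral is differentiated, Ai_j p Ai_k and Ai_k
    p Ai_j, cancel. *)
Lemma cderiv_Wsol (c : C) (j k : Z) (z : C) : cderiv (Wsol c j k) z (Wsol1 c j k z).
Proof.
  replace (Wsol1 c j k z) with (c * ((Aiu 1 j z * Fint k z + Aiu 0 j z * src k z) -
    (Aiu 1 k z * Fint j z + Aiu 0 k z * src j z)))%C by (unfold Wsol1, src; ring).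
  apply cderiv_scal, cderiv_minus; apply cderiv_mult; try apply cderiv_Aiu; apply cderiv_Fint.
Qed.

(** At second order, differentiating the integrals leaves p times c (Ai_j' Ai_k - Ai_k' Ai_j), in
    rescaled variables; this is -c times the Wronskian, so the hypothesis says that the source is
    exactly p. *)
Lemma cderiv_Wsol1 (c : C) (j k : Z) (z : C) : (- c * wronsk j k)%C = RtoC 1 ->
  cderiv (Wsol1 c j k) z (RtoC (u ^ 2) * z * Wsol c j k z + poly_eval d p z)%C.
Proof.
  intros Hc.
  replace (RtoC (u ^ 2) * z * Wsol c j k z + poly_eval d p z)%C with
    (c * ((Aiu 2 j z * Fint k z + Aiu 1 j z * src k z) - (Aiu 2 k z * Fint j z + Aiu 1 k z * src j z)))%C.
  - apply cderiv_scal, cderiv_minus; apply cderiv_mult; try apply cderiv_Aiu; apply cderiv_Fint.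
  - rewrite !Aiu_2. unfold Wsol, src.
    replace (poly_eval d p z) with (poly_eval d p z * (- c * wronsk j k))%C at 3 by (rewrite Hc; ring).
    rewrite <- (Aiu_wronskian j k z). ring.
Qed.

Lemma w_Wsol (j k : Z) : (-1 <= j /\ j < k /\ k <= 1)%Z ->
  exists c, (- c * wronsk j k)%C = RtoC 1 /\ forall z, w d p u j k z = Wsol c j k z.
Proof.
  intros Hjk.
  assert (S : sqrt 3 * sqrt 3 = 3) by (apply sqrt_sqrt; lra).
  assert (S0 : 0 < sqrt 3) by (apply sqrt_lt_R0; lra). assert (P := PI_RGT_0). assert (UP := U_pos).
  set (c := (RtoC (2 * PI) * RtoC (Rpower u (- (2 / 3))))%C).
  (* As Ai(0) Ai'(0) = -1/(2 PI sqrt 3), the prefactor 2 PI u^(-2/3) a is the right one exactly when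
     a turns this difference of cube roots of unity, of modulus sqrt 3, into sqrt 3. *)
  assert (Hc : forall a, (a * (cis (- dir k) - cis (- dir j)))%C = RtoC (sqrt 3) ->
     (- (c * a) * wronsk j k)%C = RtoC 1).
  { intros a Ha. unfold wronsk, c. rewrite Ai_0_Ai'_0, Rpower_Ropp. fold U.
    replace (- (RtoC (2 * PI) * RtoC (/ U) * a) * (RtoC U * RtoC (- / (2 * PI * sqrt 3)) * (cis (- dir k) - cis (- dir j))))%C
     with (RtoC (2 * PI) * RtoC (/ U) * (RtoC U * - RtoC (- / (2 * PI * sqrt 3))) * (a * (cis (- dir k) - cis (- dir j))))%C by ring.
    rewrite Ha, <- !RtoC_opp, <- !RtoC_mult. f_equal. field. lra. }
  assert (T : forall a b z, (Aij a (RtoC U * z) * int_from_infty (dir b) (fun t => poly_eval d p t * Aij b (RtoC U * t))%C z)%C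
     = (Aiu 0 a z * Fint b z)%C).
  { intros a b z. rewrite Aiu_0. f_equal. unfold Fint. rewrite !int_from_infty_eq. f_equal.
    destruct (cderiv_src b) as [l Hl].
    assert (D : Dec (dir b) (src b)) by (apply Dec_alg; [apply alg_poly | apply Aiu_Dec; lia]).
    symmetry. apply Iinf_ext.
    - intros r. unfold src. now rewrite Aiu_0.
    - intros r. now apply (ray_cont (src b) l).
    - destruct (Dec_bound _ _ D (Cmod z)) as [K HK]. exists K. intros r Hr. apply HK; auto. lra. }
  assert (cases : ((j = -1 /\ k = 1) \/ (j = -1 /\ k = 0) \/ (j = 0 /\ k = 1))%Z) by lia.
  destruct cases as [[-> ->]|[[-> ->]|[-> ->]]]; unfold dir in Hc.
  - exists (c * Ci)%C. split.
    + apply Hc. replace (- (2 * PI * 1 / 3)) with (- (2 * (PI / 3))) by field.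
      replace (- (2 * PI * -1 / 3)) with (2 * (PI / 3)) by field.
      rewrite !cis_eq, cos_neg, sin_neg, sin_2PI3, cos_2PI3.
      unfold Cminus, Cplus, Copp, Cmult, Ci, RtoC; simpl. f_equal; field.
    + intros z. unfold w, Wsol. fold U. rewrite !T. reflexivity.
  - exists (c * cis (PI / 6))%C. split.
    + apply Hc. replace (- (2 * PI * 0 / 3)) with 0 by field.
      replace (- (2 * PI * -1 / 3)) with (2 * (PI / 3)) by field.
      rewrite !cis_eq, sin_2PI3, cos_2PI3, cos_0, sin_0, cos_PI6, sin_PI6.
      unfold Cminus, Cplus, Copp, Cmult, Ci, RtoC; simpl. f_equal; field_simplify; nra.
    + intros z. unfold w, Wsol. fold U. rewrite !T. reflexivity.
  (* The minus sign reconciles the order of the two terms: w^(0,1) begins with Ai_1, whereas [Wsol]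
     begins with the lower index. *)
  - exists (c * - cis (- (PI / 6)))%C. split.
    + apply Hc. replace (- (2 * PI * 0 / 3)) with 0 by field.
      replace (- (2 * PI * 1 / 3)) with (- (2 * (PI / 3))) by field.
      rewrite !cis_eq, !cos_neg, !sin_neg, sin_2PI3, cos_2PI3, cos_0, sin_0, cos_PI6, sin_PI6.
      unfold Cminus, Cplus, Copp, Cmult, Ci, RtoC; simpl. f_equal; field_simplify; nra.
    + intros z. unfold w, Wsol. fold U. rewrite !T. fold c. ring.
Qed.

End Solutions.

(** * Crude growth of the particular solutions near the ends *)

Section Growth.

Variables (d : nat) (p : nat -> C) (u : R).
Hypothesis hu : 0 < u.

Let U : R := Rpower u (2 / 3).
Let Upos : 0 < U := U_pos u.

Lemma Aiu_arg_Cmod (b : Z) (z : C) : Cmod (RtoC U * cis (- dir b) * z)%C = U * Cmod z.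
Proof. rewrite !Cmod_mult, Cmod_cis, Cmod_R, Rabs_right, Rmult_1_r by lra. reflexivity. Qed.

Lemma Aiu_growth (m : nat) (b : Z) (z : C) (s : R) : (m <= 1)%nat -> 0 <= s -> U * Cmod z <= s ^ 2 ->
  Cmod (Aiu u m b z) <= U ^ m * exp (2 / 3 * (s + 2) ^ 3).
Proof.
  intros Hm Hs Hz. unfold Aiu. fold U. rewrite Cmod_mult, Cmod_pow, Cmod_mult, Cmod_cis, Cmod_R, Rmult_1_r, Rabs_right by lra.
  apply Rmult_le_compat_l. apply pow_le; lra. apply Aid_growth; auto. now rewrite Aiu_arg_Cmod.
Qed.

Lemma Aiu_decay (m : nat) (b : Z) (z : C) (s r : R) : (m <= 1)%nat -> 10 <= s -> 0 <= r ->
  U * Cmod z = s ^ 2 -> Cmod (z * cis (- dir b) - RtoC (Cmod z))%C <= Cmod z / 100 ->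
  Cmod (Aiu u m b (z + RtoC r * cis (dir b))%C) <= U ^ m * ((1 + s) ^ m * exp (- (s ^ 3 / 2) - s * (U * r))).
Proof.
  intros Hm Hs Hr Hz Hd. unfold Aiu. fold U.
  rewrite Cmod_mult, Cmod_pow, Cmod_mult, Cmod_cis, Cmod_R, Rmult_1_r, Rabs_right by lra.
  apply Rmult_le_compat_l. apply pow_le; lra.
  replace (RtoC U * cis (- dir b) * (z + RtoC r * cis (dir b)))%C with
    (RtoC U * cis (- dir b) * z + RtoC (U * r))%C.
  - apply Aid_decay; auto. apply Rmult_le_pos; lra.
    rewrite <- Hz, RtoC_mult.
    replace (RtoC U * cis (- dir b) * z - RtoC U * RtoC (Cmod z))%C with (RtoC U * (z * cis (- dir b) - RtoC (Cmod z)))%C by ring.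
    rewrite Cmod_mult, Cmod_R, Rabs_right by lra. nra.
  - rewrite RtoC_mult.
    replace (RtoC U * cis (- dir b) * (z + RtoC r * cis (dir b)))%C with
     (RtoC U * cis (- dir b) * z + RtoC U * RtoC r * (cis (dir b) * cis (- dir b)))%C by ring.
    rewrite cis_opp_r. ring.
Qed.

(** The integral from infinity to z differs from its value at 0 by the integral over the segment
    from 0 to z, where the global bound on Ai applies. *)
Lemma Fint_growth (b : Z) : exists K N, 0 <= K /\ forall z s, 0 <= s -> U * Cmod z <= s ^ 2 ->
  Cmod (Fint d p u b z) <= K * (1 + Cmod z) ^ N * exp (2 / 3 * (s + 2) ^ 3).
Proof.
  destruct (alg_growth _ _ (alg_poly d p)) as [K [N [HK HN]]].
  destruct (cderiv_src d p u b) as [l Hl].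
  assert (F0 := Cmod_ge_0 (Fint d p u b 0)).
  exists (K + Cmod (Fint d p u b 0)), (S N). split. lra.
  intros z s Hs Hz. assert (Hz0 := Cmod_ge_0 z).
  set (E := exp (2 / 3 * (s + 2) ^ 3)).
  assert (E1 : 1 <= E).
  { unfold E. rewrite <- exp_0. apply exp_le. assert (0 <= (s + 2) ^ 3) by (apply pow_le; lra). lra. }
  assert (P1 : 1 <= (1 + Cmod z) ^ N) by (apply pow_R1_Rle; lra).
  assert (M := Cmod_diff_le_segment (Fint d p u b) (src d p u b) l 0 z (K * (1 + Cmod z) ^ N * E)).
  rewrite Cplus_0_l in M.
  assert (M' : Cmod (Fint d p u b z - Fint d p u b 0)%C <= K * (1 + Cmod z) ^ N * E * Cmod z).
  { apply M.
    - intros; now apply cderiv_Fint.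
    - auto.
    - intros t Ht. rewrite Cplus_0_l. unfold src. rewrite Cmod_mult.
      assert (T : Cmod (RtoC t * z)%C <= Cmod z).
      { rewrite Cmod_mult, Cmod_R, Rabs_right by lra. nra. }
      apply Rmult_le_compat; try apply Cmod_ge_0.
      + eapply Rle_trans. apply HN. discriminate. apply Rmult_le_compat_l; auto. apply pow_incr.
        assert (H := Cmod_ge_0 (RtoC t * z)%C). lra.
      + eapply Rle_trans. apply (Aiu_growth 0 b _ s); auto. nra. simpl. unfold E. simpl. lra. }
  replace (Fint d p u b z) with ((Fint d p u b z - Fint d p u b 0) + Fint d p u b 0)%C by ring.
  eapply Rle_trans. apply Cmod_triangle. simpl.
  assert (1 <= (1 + Cmod z) * (1 + Cmod z) ^ N * E).
  { assert (1 * 1 <= (1 + Cmod z) * (1 + Cmod z) ^ N) by (apply Rmult_le_compat; lra).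
    assert (1 * 1 <= (1 + Cmod z) * (1 + Cmod z) ^ N * E) by (apply Rmult_le_compat; lra). lra. }
  assert (0 <= K * (1 + Cmod z) ^ N * E) by (apply Rmult_le_pos; [apply Rmult_le_pos|]; lra).
  assert (Cmod (Fint d p u b 0) * 1 <= Cmod (Fint d p u b 0) * ((1 + Cmod z) * (1 + Cmod z) ^ N * E)) by (apply Rmult_le_compat_l; lra).
  lra.
Qed.

Lemma Fint_decay (b : Z) : exists K N s0, 0 <= K /\ 10 <= s0 /\ forall z s, s0 <= s -> U * Cmod z = s ^ 2 ->
  Cmod (z * cis (- dir b) - RtoC (Cmod z))%C <= Cmod z / 100 ->
  Cmod (Fint d p u b z) <= K * (1 + Cmod z) ^ N * exp (- (s ^ 3 / 2)).
Proof.
  destruct (alg_growth _ _ (alg_poly d p)) as [K [N [HK HN]]].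
  destruct (cderiv_src d p u b) as [l Hl].
  (* With s U >= N + 1 the decay e^(-s U r) along the ray beats the polynomial growth e^(N r) of the
     source and leaves e^(-r). *)
  exists K, N, (10 + (INR N + 1) / U).
  assert (N0 : 0 <= (INR N + 1) / U).
  { apply Rmult_le_pos. generalize (pos_INR N); lra. left; now apply Rinv_0_lt_compat. }
  split; auto. split. lra. intros z s Hs Hz Hd. assert (Hz0 := Cmod_ge_0 z).
  apply (int_from_infty_bound _ _ l); auto. intros r Hr. unfold src. rewrite Cmod_mult.
  assert (D := Aiu_decay 0 b z s r (Nat.le_0_l 1) ltac:(lra) Hr Hz Hd). simpl in D. rewrite !Rmult_1_l in D.
  assert (G : Cmod (poly_eval d p (z + RtoC r * cis (dir b))) <= K * ((1 + Cmod z) ^ N * exp (INR N * r))).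
  { eapply Rle_trans. apply HN. discriminate. apply Rmult_le_compat_l; auto.
    apply Rle_trans with (((1 + Cmod z) * exp r) ^ N).
    - apply pow_incr. assert (H := Cmod_ge_0 (z + RtoC r * cis (dir b))%C). split. lra.
      assert (T := Cmod_triangle z (RtoC r * cis (dir b))). rewrite Cmod_mult, Cmod_cis, Cmod_R, Rabs_right in T by lra.
      assert (A3 := exp_ineq1_le r). nra.
    - rewrite Rpow_mult_distr, exp_pow. lra. }
  eapply Rle_trans. apply Rmult_le_compat; try apply Cmod_ge_0. apply G. apply D.
  rewrite !Rmult_assoc. apply Rmult_le_compat_l; auto. apply Rmult_le_compat_l. apply pow_le; lra.
  rewrite <- !exp_plus. apply exp_le.
  assert (sU : INR N + 1 <= s * U).
  { assert ((INR N + 1) / U * U <= s * U) by (apply Rmult_le_compat_r; lra).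
    replace ((INR N + 1) / U * U) with (INR N + 1) in * by (field; lra). lra. }
  assert ((INR N + 1) * r <= s * U * r) by (apply Rmult_le_compat_r; lra). simpl in *. lra.
Qed.

(** In the direction of z^(j), each product pairs a decaying factor (Ai_j, or the integral of p Ai_j
    from z^(j)) with one that may grow. The exponents add up to (2/3) (s + 2)^3 - s^3/2, that is
    s^3/6 plus lower order, and 3/10 leaves room for the polynomial factors. The lemma is stated for
    any order of j and k, so that it serves both ends. *)
Lemma Wsol_growth (c : C) (j k : Z) : exists K s0, 0 <= K /\ 0 <= s0 /\ forall z s, s0 <= s -> U * Cmod z = s ^ 2 ->
  Cmod (z * cis (- dir j) - RtoC (Cmod z))%C <= Cmod z / 100 ->
  Cmod (Wsol d p u c j k z) <= K * exp (3 / 10 * s ^ 3) /\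
  Cmod (Wsol1 d p u c j k z) <= K * exp (3 / 10 * s ^ 3).
Proof.
  destruct (Fint_growth k) as [K1 [N1 [HK1 G]]].
  destruct (Fint_decay j) as [K2 [N2 [s2 [HK2 [Hs2 D]]]]].
  set (N := (N1 + N2)%nat).
  (* From here on s^2 <= s^3/50, and N |z| = (N/U) s^2 <= s^3/100, the latter controlling (1 +
     |z|)^N. *)
  exists (Cmod c * ((1 + U) * (K1 + K2))), (s2 + 50 + 100 * (INR N / U)).
  assert (N0 : 0 <= INR N / U).
  { apply Rmult_le_pos. apply pos_INR. left; now apply Rinv_0_lt_compat. }
  split. { apply Rmult_le_pos. apply Cmod_ge_0. apply Rmult_le_pos; lra. }
  split. lra.
  assert (F : forall m, (m <= 1)%nat -> forall z s, s2 + 50 + 100 * (INR N / U) <= s -> U * Cmod z = s ^ 2 ->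
    Cmod (z * cis (- dir j) - RtoC (Cmod z))%C <= Cmod z / 100 ->
    Cmod (c * (Aiu u m j z * Fint d p u k z - Aiu u m k z * Fint d p u j z))%C <=
      Cmod c * ((1 + U) * (K1 + K2)) * exp (3 / 10 * s ^ 3)).
  { intros m Hm z s Hs Hz Hd. assert (Hz0 := Cmod_ge_0 z).
    specialize (G z s ltac:(lra) ltac:(lra)). specialize (D z s ltac:(lra) Hz Hd).
    assert (A1 := Aiu_decay m j z s 0 Hm ltac:(lra) (Rle_refl 0) Hz Hd).
    assert (A2 := Aiu_growth m k z s Hm ltac:(lra) ltac:(lra)).
    replace (z + RtoC 0 * cis (dir j))%C with z in A1 by ring.
    replace (- (s ^ 3 / 2) - s * (U * 0)) with (- (s ^ 3 / 2)) in A1 by ring.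
    assert (Um : 0 <= U ^ m <= 1 + U).
    { destruct m as [|[|m]]; simpl; try lra. lia. }
    assert (sm : (1 + s) ^ m <= exp s).
    { destruct m as [|[|m]]; simpl. rewrite <- exp_0. apply exp_le; lra. generalize (exp_ineq1_le s); lra. lia. }
    set (E := exp (2 / 3 * (s + 2) ^ 3)) in *. set (E' := exp (- (s ^ 3 / 2))) in *.
    assert (PE : 0 < E) by apply exp_pos. assert (PE' : 0 < E') by apply exp_pos.
    assert (Pn : forall i, 1 <= (1 + Cmod z) ^ i) by (intros; apply pow_R1_Rle; lra).
    assert (PN1 : (1 + Cmod z) ^ N1 <= (1 + Cmod z) ^ N) by (apply Rle_pow; [lra | unfold N; lia]).
    assert (PN2 : (1 + Cmod z) ^ N2 <= (1 + Cmod z) ^ N) by (apply Rle_pow; [lra | unfold N; lia]).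
    assert (Es : 1 <= exp s) by (rewrite <- exp_0; apply exp_le; lra).
    assert (Q : (1 + Cmod z) ^ N * exp s * E * E' <= exp (3 / 10 * s ^ 3)).
    { apply Rle_trans with (exp (INR N * Cmod z) * exp s * E * E').
      - apply Rmult_le_compat_r. lra. apply Rmult_le_compat_r. lra. apply Rmult_le_compat_r. lra.
        apply Rle_trans with (exp (Cmod z) ^ N).
        + apply pow_incr. split. lra. apply exp_ineq1_le.
        + rewrite exp_pow. lra.
      - unfold E, E'. rewrite <- !exp_plus. apply exp_le.
        assert (INR N * Cmod z <= s ^ 3 / 100).
        { replace (Cmod z) with (s ^ 2 / U) by (rewrite <- Hz; field; lra).
          replace (INR N * (s ^ 2 / U)) with (INR N / U * s ^ 2) by (field; lra).
          replace (s ^ 3 / 100) with (s / 100 * s ^ 2) by field.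
          apply Rmult_le_compat_r. apply pow2_ge_0. lra. }
        assert (s <= s ^ 3 / 1000).
        { replace (s ^ 3 / 1000) with (s ^ 2 / 1000 * s) by field. rewrite <- (Rmult_1_l s) at 1.
          apply Rmult_le_compat_r. lra. nra. }
        assert (s ^ 2 <= s ^ 3 / 50).
        { replace (s ^ 3 / 50) with (s / 50 * s ^ 2) by field. rewrite <- (Rmult_1_l (s ^ 2)) at 1.
          apply Rmult_le_compat_r. apply pow2_ge_0. lra. }
        replace ((s + 2) ^ 3) with (s ^ 3 + 6 * s ^ 2 + 12 * s + 8) by ring. lra. }
    rewrite Cmod_mult, !Rmult_assoc. apply Rmult_le_compat_l. apply Cmod_ge_0.
    eapply Rle_trans. apply Cmod_minus_le. rewrite !Cmod_mult.
    assert (T1 : Cmod (Aiu u m j z) * Cmod (Fint d p u k z) <= (1 + U) * K1 * ((1 + Cmod z) ^ N * exp s * E * E')).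
    { replace ((1 + U) * K1 * ((1 + Cmod z) ^ N * exp s * E * E')) with
       (((1 + U) * (exp s * E')) * (K1 * (1 + Cmod z) ^ N * E)) by ring.
      apply Rmult_le_compat; try apply Cmod_ge_0.
      - eapply Rle_trans. apply A1. apply Rmult_le_compat; try lra. apply Rmult_le_pos; [apply pow_le|]; lra.
        apply Rmult_le_compat_r; lra.
      - eapply Rle_trans. apply G. apply Rmult_le_compat_r. lra. apply Rmult_le_compat_l; lra. }
    assert (T2 : Cmod (Aiu u m k z) * Cmod (Fint d p u j z) <= (1 + U) * K2 * ((1 + Cmod z) ^ N * exp s * E * E')).
    { replace ((1 + U) * K2 * ((1 + Cmod z) ^ N * exp s * E * E')) with
       (((1 + U) * (exp s * E)) * (K2 * (1 + Cmod z) ^ N * E')) by ring.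
      apply Rmult_le_compat; try apply Cmod_ge_0.
      - eapply Rle_trans. apply A2. apply Rmult_le_compat; try lra. nra.
      - eapply Rle_trans. apply D. apply Rmult_le_compat_r. lra. apply Rmult_le_compat_l; lra. }
    assert (0 <= (1 + U) * K1) by (apply Rmult_le_pos; lra).
    assert (0 <= (1 + U) * K2) by (apply Rmult_le_pos; lra).
    apply Rmult_le_compat_l with (r := (1 + U) * (K1 + K2)) in Q; [|nra]. nra. }
  intros z s Hs Hz Hd. split.
  - apply (F 0%nat); auto.
  - apply (F 1%nat); auto.
Qed.

End Growth.

(** * Fractional powers on a slit plane *)

(** The plane cut along the ray of argument mu + PI. *)
Definition slit (mu : R) (t : C) : Prop := 0 < Cmod t + Re (t * cis (- mu))%C.

Definition Clog (mu : R) (t : C) : C := (ln (Cmod t), mu + Carg (t * cis (- mu))%C).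

Lemma Cmod_rotate (t : C) (a : R) : Cmod (t * cis a)%C = Cmod t.
Proof. rewrite Cmod_mult, Cmod_cis. ring. Qed.

Lemma slit_neq_0 (mu : R) (t : C) : slit mu t -> t <> RtoC 0.
Proof. intros H ->. unfold slit in H. rewrite Cmult_0_l, Cmod_0 in H. simpl in H. lra. Qed.

Lemma Cmod_pos_off_ray (w : C) : 0 < Cmod w + Re w -> 0 < Cmod w.
Proof.
  intros H. destruct (Cmod_ge_0 w) as [L | L]; auto. rewrite <- L in H. symmetry in L.
  apply Cmod_eq_0 in L. subst w. simpl in H. lra.
Qed.

(** The formula tan (phi/2) = Im w / (|w| + Re w) describes the argument by one smooth expression
    off the negative axis, whereas [Carg] switches between acos and -acos on the positive axis. *)
Lemma half_angle (w : C) : 0 < Cmod w + Re w ->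
  let phi := 2 * atan (Im w / (Cmod w + Re w)) in
  cos phi = Re w / Cmod w /\ sin phi = Im w / Cmod w /\ - PI < phi < PI.
Proof.
  intros H phi.
  assert (E := Cmod2_alt w).
  assert (W := Cmod_pos_off_ray w H).
  set (r := Cmod w) in *. set (x := Re w) in *. set (y := Im w) in *.
  set (tau := y / (r + x)) in *.
  assert (C2 : cos (atan tau) * cos (atan tau) = (r + x) / (2 * r)).
  { assert (T : 0 < 1 + tau ^ 2) by (generalize (pow2_ge_0 tau); lra).
    rewrite cos_atan. unfold Rdiv at 1 2. rewrite !Rmult_1_l, <- Rinv_mult.
    rewrite sqrt_sqrt. 2: { unfold Rsqr. simpl in T. lra. }
    replace (1 + Rsqr tau) with (2 * r / (r + x)).
    - field. split; lra.
    - unfold Rsqr, tau. apply Rmult_eq_reg_r with ((r + x) * (r + x)). 2: nra. field_simplify; [|lra|lra]. nra. }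
  assert (S2 : sin (atan tau) = tau * cos (atan tau)).
  { assert (T := tan_atan tau). unfold tan in T. rewrite <- T at 2.
    assert (0 < cos (atan tau)) by (apply cos_gt_0; destruct (atan_bound tau); lra).
    field. lra. }
  split; [|split].
  - unfold phi. rewrite cos_2a_cos.
    replace (2 * cos (atan tau) * cos (atan tau) - 1) with (2 * (cos (atan tau) * cos (atan tau)) - 1) by ring.
    rewrite C2. field. lra.
  - unfold phi. rewrite sin_2a, S2.
    replace (2 * (tau * cos (atan tau)) * cos (atan tau)) with (2 * tau * (cos (atan tau) * cos (atan tau))) by ring.
    rewrite C2. unfold tau. field. split; lra.
  - unfold phi. destruct (atan_bound tau). lra.
Qed.

Lemma Carg_atan (w : C) : 0 < Cmod w + Re w -> Carg w = 2 * atan (Im w / (Cmod w + Re w)).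
Proof.
  intros H. assert (T := half_angle w H). cbv zeta in T.
  set (phi := 2 * atan (Im w / (Cmod w + Re w))) in *. destruct T as [T1 [T2 T3]].
  assert (W := Cmod_pos_off_ray w H).
  unfold Carg. rewrite <- T1. destruct (Rle_dec 0 (Im w)) as [Hy | Hy].
  - apply acos_cos. split; [|lra]. destruct (Rle_dec 0 phi); auto. exfalso.
    assert (sin phi < 0). { apply sin_lt_0_var; lra. }
    rewrite T2 in H0. assert (0 <= Im w / Cmod w). apply Rmult_le_pos; auto. left; now apply Rinv_0_lt_compat. lra.
  - assert (N : phi < 0). { destruct (Rlt_dec phi 0); auto. exfalso.
      assert (0 <= sin phi) by (apply sin_ge_0; lra). rewrite T2 in H0.
      apply Rmult_le_compat_r with (r := Cmod w) in H0; [|lra].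
      replace (Im w / Cmod w * Cmod w) with (Im w) in H0 by (field; lra). lra. }
    rewrite <- cos_neg, acos_cos by lra. ring.
Qed.

Lemma cis_Carg (w : C) : 0 < Cmod w + Re w -> (RtoC (Cmod w) * cis (Carg w))%C = w.
Proof.
  intros H. rewrite (Carg_atan w H). assert (T := half_angle w H). cbv zeta in T.
  destruct T as [T1 [T2 T3]]. rewrite cis_eq, T1, T2.
  assert (W := Cmod_pos_off_ray w H).
  destruct w as [x y]. set (r := Cmod (x, y)) in *. unfold Cmult, RtoC, Re, Im; simpl. f_equal; field; lra.
Qed.

Lemma Carg_cis (t : R) : - PI < t < PI -> Carg (cis t) = t.
Proof.
  intros H. unfold Carg. rewrite Cmod_cis, cis_eq. unfold Re, Im; simpl. unfold Rdiv. rewrite Rinv_1, Rmult_1_r.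
  destruct (Rle_dec 0 (sin t)) as [S | S].
  - destruct (Rle_dec 0 t). apply acos_cos; lra.
    assert (sin t < 0) by (apply sin_lt_0_var; lra). lra.
  - destruct (Rlt_dec t 0). rewrite <- cos_neg, acos_cos by lra. ring.
    assert (0 <= sin t) by (apply sin_ge_0; lra). lra.
Qed.

Lemma cpow_Clog (j k : Z) (a : R) (t : C) : cpow j k a t = Cexp (RtoC a * Clog (mid_dir j k) t)%C.
Proof.
  unfold cpow, Rpower, cis. rewrite <- Cexp_RtoC, <- Cexp_plus. f_equal.
  unfold Clog, Cplus, Cmult, RtoC, Ci; simpl. f_equal; ring.
Qed.

Lemma Cexp_Clog (mu : R) (t : C) : slit mu t -> Cexp (Clog mu t) = t.
Proof.
  intros H. assert (T := slit_neq_0 mu t H). apply Cmod_gt_0 in T.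
  replace (Clog mu t) with (RtoC (ln (Cmod t)) + Ci * RtoC (mu + Carg (t * cis (- mu))))%C
    by (unfold Clog, Cplus, Cmult, RtoC, Ci; simpl; f_equal; ring).
  rewrite Cexp_plus, Cexp_RtoC, exp_ln by auto. fold (cis (mu + Carg (t * cis (- mu)))).
  rewrite cis_plus.
  assert (E := cis_Carg (t * cis (- mu))). rewrite Cmod_rotate in E. specialize (E H).
  replace (RtoC (Cmod t) * (cis mu * cis (Carg (t * cis (- mu)))))%C with
    (cis mu * (RtoC (Cmod t) * cis (Carg (t * cis (- mu)))))%C by ring.
  rewrite E. replace (cis mu * (t * cis (- mu)))%C with (t * (cis mu * cis (- mu)))%C by ring.
  rewrite cis_opp_r. ring.
Qed.

Notation CRcont := (continuous (T := C_UniformSpace) (U := R_UniformSpace)).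

Lemma CRcont_lip (f : C -> R) (t : C) : (forall h, Rabs (f (t + h)%C - f t) <= Cmod h) -> CRcont f t.
Proof.
  intros H P [eps HP]. 
  assert (A : forall y : C, Cmod (y - t)%C < eps -> P (f y)).
  { intros y Hy. apply HP. change (Rabs (f y - f t) < eps). specialize (H (y - t)%C).
    replace (t + (y - t))%C with y in H by ring. lra. }
  destruct (locally_ball_norm (V := C_R_NormedModule) t eps) as [d Hd].
  exists d. intros y Hy. specialize (Hd y Hy). unfold ball_norm in Hd.
  rewrite norm_CR in Hd. exact (A y Hd).
Qed.

Lemma Cmod_lip (a h : C) : Rabs (Cmod (a + h)%C - Cmod a) <= Cmod h.
Proof.
  assert (H1 := Cmod_triangle a h). assert (H2 := Cmod_minus_le (a + h) h).
  replace (a + h - h)%C with a in H2 by ring. apply Rabs_le. lra.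
Qed.

Lemma CRcont_eps (f : C -> R) (t : C) (eps : R) : CRcont f t -> 0 < eps ->
  exists del, 0 < del /\ forall h, Cmod h < del -> Rabs (f (t + h)%C - f t) < eps.
Proof.
  intros H He. destruct (H _ (locally_ball (f t) (mkposreal eps He))) as [d Hd].
  exists d. split. apply cond_pos. intros h Hh. apply (Hd (t + h)%C).
  apply (norm_compat1 (V := C_R_NormedModule)). rewrite norm_CR.
  change (Cmod (t + h - t)%C < d). now replace (t + h - t)%C with h by ring.
Qed.

Lemma CRcont_comp (g : R -> R) (f : C -> R) (t : C) (l : R) :
  CRcont f t -> is_derive g (f t) l -> CRcont (fun t => g (f t)) t.
Proof.
  intros Hf Hg. apply (continuous_comp f g); auto. apply (ex_derive_continuous g). now exists l.
Qed.

Lemma slit_open (mu : R) (t : C) : slit mu t -> exists r, 0 < r /\ forall h, Cmod h < r -> slit mu (t + h)%C.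
Proof.
  intros H. unfold slit in *. set (s := Cmod t + Re (t * cis (- mu))%C) in *.
  exists (s / 2). split. lra. intros h Hh.
  assert (H1 := Cmod_lip t h). apply Rabs_le_between in H1.
  assert (H2 := re_le_Cmod (h * cis (- mu))%C). rewrite Cmod_rotate in H2. apply Rabs_le_between in H2.
  replace (Re ((t + h) * cis (- mu))%C) with (Re (t * cis (- mu))%C + Re (h * cis (- mu))%C).
  unfold s in *; lra.
  destruct t, h, (cis (- mu)). unfold Re; simpl. ring.
Qed.

Lemma CRcont_rot (F : C -> R) (mu : R) (t : C) : (forall a h, Rabs (F (a + h)%C - F a) <= Cmod h) ->
  CRcont (fun t => F (t * cis (- mu))%C) t.
Proof.
  intros H. apply CRcont_lip. intros h. rewrite Cmult_plus_distr_r, <- (Cmod_rotate h (- mu)). apply H.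
Qed.

Lemma Clog_cont (mu : R) (t : C) : slit mu t -> forall eps, 0 < eps ->
  exists del, 0 < del /\ forall h, Cmod h < del -> Cmod (Clog mu (t + h) - Clog mu t)%C < eps.
Proof.
  intros H eps He. assert (T := slit_neq_0 mu t H). apply Cmod_gt_0 in T.
  assert (C0 : CRcont Cmod t) by (apply CRcont_lip; apply Cmod_lip).
  assert (C1 : CRcont (fun t => ln (Cmod t)) t).
  { apply (CRcont_comp ln _ _ (/ Cmod t)); auto. apply is_derive_Reals, derivable_pt_lim_ln; auto. }
  assert (ReL : forall a h : C, Rabs (Re (a + h)%C - Re a) <= Cmod h).
  { intros a h. replace (Re (a + h)%C - Re a) with (Re h). apply re_le_Cmod. destruct a, h; unfold Re; simpl; ring. }
  assert (ImL : forall a h : C, Rabs (Im (a + h)%C - Im a) <= Cmod h).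
  { intros a h. replace (Im (a + h)%C - Im a) with (Im h). apply im_le_Cmod. destruct a, h; unfold Im; simpl; ring. }
  set (den := fun t => Cmod (t * cis (- mu))%C + Re (t * cis (- mu))%C).
  assert (Hden : den t <> 0). { unfold den. rewrite Cmod_rotate. unfold slit in H. lra. }
  assert (C2 : CRcont (fun t => 2 * atan (Im (t * cis (- mu))%C / den t)) t).
  { apply (CRcont_comp (fun x => 2 * atan x) (fun t => Im (t * cis (- mu))%C / den t) t
      (2 * / (1 + Rsqr (Im (t * cis (- mu))%C / den t)))).
    2: { apply is_derive_scal, is_derive_atan. }
    apply (continuous_mult (fun t => Im (t * cis (- mu))%C) (fun t => / den t)).
    - now apply CRcont_rot.
    - apply (CRcont_comp Rinv den t (- / (den t) ^ 2)).
      + apply (continuous_plus (V := R_NormedModule) (fun t => Cmod (t * cis (- mu))%C)).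
        apply (CRcont_rot Cmod). apply Cmod_lip. now apply CRcont_rot.
      + auto_derive; auto. field; auto. }
  destruct (CRcont_eps _ t (eps / 2) C1 ltac:(lra)) as [d1 [Hd1 D1]].
  destruct (CRcont_eps _ t (eps / 2) C2 ltac:(lra)) as [d2 [Hd2 D2]].
  destruct (slit_open mu t H) as [d3 [Hd3 D3]].
  exists (Rmin d1 (Rmin d2 d3)). split. { repeat apply Rmin_pos; auto. }
  intros h Hh.
  assert (h1 : Cmod h < d1) by (eapply Rlt_le_trans; [apply Hh | apply Rmin_l]).
  assert (h2 : Cmod h < d2) by (eapply Rlt_le_trans; [apply Hh|]; eapply Rle_trans; [apply Rmin_r | apply Rmin_l]).
  assert (h3 : Cmod h < d3) by (eapply Rlt_le_trans; [apply Hh|]; eapply Rle_trans; [apply Rmin_r | apply Rmin_r]).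
  specialize (D1 h h1). specialize (D2 h h2). specialize (D3 h h3).
  eapply Rle_lt_trans. apply Cmod_le_abs.
  assert (A : forall t, slit mu t -> Carg (t * cis (- mu))%C = 2 * atan (Im (t * cis (- mu))%C / den t)).
  { intros s Hs. apply Carg_atan. rewrite Cmod_rotate. exact Hs. }
  assert (ER : Re (Clog mu (t + h) - Clog mu t)%C = ln (Cmod (t + h)%C) - ln (Cmod t)) by reflexivity.
  assert (EI : Im (Clog mu (t + h) - Clog mu t)%C =
    mu + Carg ((t + h) * cis (- mu))%C + - (mu + Carg (t * cis (- mu))%C)) by reflexivity.
  rewrite ER, EI, (A t H), (A (t + h)%C D3).
  replace (mu + 2 * atan (Im ((t + h) * cis (- mu))%C / den (t + h)%C) + - (mu + 2 * atan (Im (t * cis (- mu))%C / den t)))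
   with (2 * atan (Im ((t + h) * cis (- mu))%C / den (t + h)%C) - 2 * atan (Im (t * cis (- mu))%C / den t)) by ring.
  lra.
Qed.

(* Inverse function rule for Cexp (Clog t) = t. *)
Lemma cderiv_Clog (mu : R) (t : C) : slit mu t -> cderiv (Clog mu) t (/ t)%C.
Proof.
  intros H. assert (T := slit_neq_0 mu t H). assert (T' := T). apply Cmod_gt_0 in T'.
  apply cderiv_eps. intros eps He.
  (* With |kk| <= 1/6 and e^|kk| <= 3, the Taylor remainder 3 |kk|^2 is at most |kk|/2, hence |kk|
     <= 2 |h/t|. The second bound then makes the remainder at most 3 (eps |t|/6) (2 |h|/|t|) = eps
     |h|. *)
  set (e := Rmin (1 / 6) (eps * Cmod t / 6)).
  assert (e0 : 0 < e) by (unfold e; apply Rmin_pos; nra).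
  destruct (Clog_cont mu t H e e0) as [d1 [Hd1 D1]].
  destruct (slit_open mu t H) as [d2 [Hd2 D2]].
  exists (Rmin d1 d2). split. { now apply Rmin_pos. }
  intros h Hh.
  specialize (D1 h (Rlt_le_trans _ _ _ Hh (Rmin_l _ _))). specialize (D2 h (Rlt_le_trans _ _ _ Hh (Rmin_r _ _))).
  set (kk := (Clog mu (t + h) - Clog mu t)%C) in *.
  assert (E1 : Cmod kk <= 1 / 6) by (unfold e in D1; generalize (Rmin_l (1 / 6) (eps * Cmod t / 6)); lra).
  assert (E2 : Cmod kk <= eps * Cmod t / 6) by (unfold e in D1; generalize (Rmin_r (1 / 6) (eps * Cmod t / 6)); lra).
  assert (K0 := Cmod_ge_0 kk).
  assert (X : (t + h)%C = (t * Cexp kk)%C).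
  { rewrite <- (Cexp_Clog mu _ D2). rewrite <- (Cexp_Clog mu t H) at 2. rewrite <- Cexp_plus. f_equal. unfold kk. ring. }
  assert (Tk := Cexp_taylor kk).
  assert (T3 : exp (Cmod kk) <= 3). { eapply Rle_trans; [apply (exp_le _ 1); lra | apply exp_le_3]. }
  assert (Y : Cmod (Cexp kk - 1 - kk)%C <= 3 * Cmod kk ^ 2).
  { eapply Rle_trans. apply Tk. apply Rmult_le_compat_r; auto. apply pow2_ge_0. }
  assert (hk : (h * / t)%C = (kk + (Cexp kk - 1 - kk))%C).
  { replace h with ((t + h) - t)%C by ring. rewrite X. field. auto. }
  assert (B : Cmod kk <= 2 * (Cmod h * / Cmod t)).
  { rewrite <- Cmod_inv, <- Cmod_mult, hk by auto.
    assert (Z := Cmod_minus_le (kk + (Cexp kk - 1 - kk))%C (Cexp kk - 1 - kk)%C).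
    replace (kk + (Cexp kk - 1 - kk) - (Cexp kk - 1 - kk))%C with kk in Z by ring. nra. }
  replace (kk - h * / t)%C with (- (Cexp kk - 1 - kk))%C by (rewrite hk; ring).
  rewrite Cmod_opp. eapply Rle_trans. apply Y.
  apply Rle_trans with (3 * (eps * Cmod t / 6) * (2 * (Cmod h * / Cmod t))).
  - replace (3 * Cmod kk ^ 2) with (3 * Cmod kk * Cmod kk) by ring.
    apply Rmult_le_compat; auto; lra.
  - right. field. lra.
Qed.

Section Cpow.

Variables (j k : Z).
Let mu := mid_dir j k.

Lemma cderiv_cpow (a : R) (t : C) : slit mu t -> cderiv (cpow j k a) t (RtoC a * cpow j k (a - 1) t)%C.
Proof.
  intros H. apply cderiv_ext with (fun t => Cexp (RtoC a * Clog mu t)%C). { intros; now rewrite cpow_Clog. }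
  replace (RtoC a * cpow j k (a - 1) t)%C with ((RtoC a * / t) * Cexp (RtoC a * Clog mu t))%C.
  - apply (cderiv_comp Cexp (fun t => RtoC a * Clog mu t)%C). apply cderiv_Cexp. now apply cderiv_scal, cderiv_Clog.
  - rewrite cpow_Clog. fold mu.
    replace (RtoC a * Clog mu t)%C with (Clog mu t + RtoC (a - 1) * Clog mu t)%C by (rewrite RtoC_minus; ring).
    rewrite Cexp_plus, (Cexp_Clog mu t H). field. now apply (slit_neq_0 mu).
Qed.

Lemma cpow_plus (a b : R) (t : C) : (cpow j k a t * cpow j k b t)%C = cpow j k (a + b) t.
Proof. rewrite !cpow_Clog, <- Cexp_plus, RtoC_plus. f_equal. ring. Qed.

Lemma cpow_1 (t : C) : slit mu t -> cpow j k 1 t = t.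
Proof. intros H. rewrite cpow_Clog, Cmult_1_l. now apply Cexp_Clog. Qed.

Lemma cpow_0 (t : C) : cpow j k 0 t = RtoC 1.
Proof. now rewrite cpow_Clog, Cmult_0_l, Cexp_0. Qed.

Lemma Cmod_cpow (a : R) (t : C) : Cmod (cpow j k a t) = Rpower (Cmod t) a.
Proof.
  unfold cpow. rewrite Cmod_mult, Cmod_cis, Cmod_R, Rmult_1_r. apply Rabs_right.
  left. apply exp_pos.
Qed.

Lemma cpow_neq_0 (a : R) (t : C) : cpow j k a t <> RtoC 0.
Proof. rewrite cpow_Clog. apply Cexp_neq_0. Qed.

(** Homogeneity reduces the behaviour of t^(3/2) at infinity to that of the direction t/|t|, where
    differentiability at a single point suffices. *)
Lemma cpow_scale (a r : R) (t : C) : 0 < r -> t <> RtoC 0 ->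
  cpow j k a (RtoC r * t)%C = (RtoC (Rpower r a) * cpow j k a t)%C.
Proof.
  intros Hr Ht. apply Cmod_gt_0 in Ht. unfold cpow.
  rewrite Cmod_mult, Cmod_R, Rabs_right by lra.
  replace (Rpower (r * Cmod t) a) with (Rpower r a * Rpower (Cmod t) a) by (now rewrite Rpower_mult_distr).
  replace (Carg (RtoC r * t * cis (- mid_dir j k))) with (Carg (t * cis (- mid_dir j k))).
  - rewrite RtoC_mult. ring.
  - unfold Carg. rewrite !Cmod_rotate, Cmod_mult, Cmod_R, Rabs_right by lra.
    assert (E : forall w : C, Re (RtoC r * w)%C = r * Re w /\ Im (RtoC r * w)%C = r * Im w).
    { intros [x y]. unfold Cmult, RtoC, Re, Im; simpl. split; ring. }
    rewrite <- Cmult_assoc. destruct (E (t * cis (- mid_dir j k))%C) as [-> ->].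
    set (w := (t * cis (- mid_dir j k))%C).
    replace (r * Re w / (r * Cmod t)) with (Re w / Cmod t) by (field; lra).
    destruct (Rle_dec 0 (Im w)), (Rle_dec 0 (r * Im w)); auto; exfalso; nra.
Qed.

End Cpow.

Lemma cos_ge_half (x : R) : - (2 * PI / 3) <= x <= 2 * PI / 3 -> - 1 / 2 <= cos x.
Proof.
  intros H. assert (P := PI_RGT_0).
  assert (E : cos (2 * (PI / 3)) = - 1 / 2) by apply cos_2PI3.
  replace (2 * (PI / 3)) with (2 * PI / 3) in E by field. rewrite <- E.
  destruct (Rle_dec 0 x).
  - apply cos_decr_1; lra.
  - rewrite <- (cos_neg x). apply cos_decr_1; lra.
Qed.

(** Up to a full turn, an argument in S_j or S_k lies within 2 PI/3 of the bisector, so |t| + Re (t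
    e^(-i mu)) >= |t|/2. The full turn occurs for the pair (-1, 1), where the bisector is placed at
    PI while [dir (-1)] is negative. *)
Lemma Sector_slit (j k : Z) (t : C) : (-1 <= j /\ j < k /\ k <= 1)%Z -> t <> RtoC 0 ->
  Sector j t \/ Sector k t -> slit (mid_dir j k) t.
Proof.
  intros Hjk Ht HS. apply Cmod_gt_0 in Ht. assert (P := PI_RGT_0).
  assert (A : forall l x, (exists th, - (1 / 3) * PI <= th <= 1 / 3 * PI /\ (t * cis (- dir l))%C = (RtoC (Cmod (t * cis (- dir l))%C) * cis th)%C) ->
    (forall th, - (1 / 3) * PI <= th <= 1 / 3 * PI -> - (2 * PI / 3) <= th + (dir l - x) <= 2 * PI / 3 \/
       - (2 * PI / 3) <= th + (dir l - x) + 2 * PI <= 2 * PI / 3) -> slit x t).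
  { intros l x [th [H1 H2]] H. rewrite Cmod_rotate in H2.
    assert (E : (t * cis (- x))%C = (RtoC (Cmod t) * cis (th + (dir l - x)))%C).
    { rewrite cis_plus, Cmult_assoc, <- H2. unfold Rminus. rewrite cis_plus.
      replace (t * cis (- dir l) * (cis (dir l) * cis (- x)))%C with (t * cis (- x) * (cis (dir l) * cis (- dir l)))%C by ring.
      rewrite cis_opp_r. ring. }
    unfold slit. rewrite E, cis_eq.
    assert (Q : - 1 / 2 <= cos (th + (dir l - x))).
    { destruct (H th H1) as [G | G]. now apply cos_ge_half. rewrite <- (cos_period _ 1). simpl INR.
      replace (th + (dir l - x) + 2 * 1 * PI) with (th + (dir l - x) + 2 * PI) by ring. now apply cos_ge_half. }
    unfold Cmult, RtoC, Re; simpl. nra. }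
  unfold Sector, arg_between in HS.
  assert (cases : ((j = -1 /\ k = 1) \/ (j = -1 /\ k = 0) \/ (j = 0 /\ k = 1))%Z) by lia.
  destruct cases as [[-> ->]|[[-> ->]|[-> ->]]]; destruct HS as [HS | HS]; apply (A _ _ HS); intros th Hth;
   unfold mid_dir, dir; simpl; lra.
Qed.

(* The exponentials exp(+- u (2/3) t^(3/2)) are recessive at opposite ends of the path. *)
Lemma cpow_ends (j k : Z) : (-1 <= j /\ j < k /\ k <= 1)%Z ->
  slit (mid_dir j k) (cis (dir j)) /\ slit (mid_dir j k) (cis (dir k)) /\
  exists s : R, (s = 1 \/ s = -1) /\ cpow j k (3 / 2) (cis (dir j)) = RtoC (- s) /\
    cpow j k (3 / 2) (cis (dir k)) = RtoC s.
Proof.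
  intros Hjk. assert (P := PI_RGT_0).
  assert (V : forall l x, - PI < x < PI -> (cis (dir l) * cis (- mid_dir j k))%C = cis x ->
    cpow j k (3 / 2) (cis (dir l)) = cis (3 / 2 * (mid_dir j k + x))).
  { intros l x Hx E. unfold cpow. rewrite E, Carg_cis, Cmod_cis by auto.
    unfold Rpower. rewrite ln_1, Rmult_0_r, exp_0. ring. }
  assert (S : forall l, Sector l (cis (dir l))).
  { intros l. exists 0. split. lra. rewrite cis_opp_r, cis_0, Cmod_1. ring. }
  split; [|split].
  - apply Sector_slit; auto. apply cis_neq_0.
  - apply Sector_slit; auto. apply cis_neq_0.
  - assert (c0 : cis 0 = RtoC 1) by apply cis_0.
    assert (cpi : cis PI = RtoC (-1)) by (rewrite cis_eq, cos_PI, sin_PI; reflexivity).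
    assert (cmpi : cis (- PI) = RtoC (-1)).
    { rewrite cis_eq, cos_neg, sin_neg, cos_PI, sin_PI. unfold RtoC. f_equal. ring. }
    assert (c2pi : cis (2 * PI) = RtoC 1) by (rewrite cis_eq, cos_2PI, sin_2PI; reflexivity).
    assert (cases : ((j = -1 /\ k = 1) \/ (j = -1 /\ k = 0) \/ (j = 0 /\ k = 1))%Z) by lia.
    destruct cases as [[-> ->]|[[-> ->]|[-> ->]]].
    (* The branch measures arguments around PI, so e^(-2 PI i/3) has argument 4 PI/3 and its power
       3/2 is e^(2 PI i) = 1. *)
    + exists (-1). split; auto. rewrite (V (-1)%Z (PI / 3)), (V 1%Z (- (PI / 3))); try lra.
      * unfold mid_dir; simpl. split.
        replace (3 / 2 * (PI + PI / 3)) with (2 * PI) by field. rewrite c2pi. f_equal; ring.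
        replace (3 / 2 * (PI + - (PI / 3))) with PI by field. auto.
      * rewrite <- cis_plus. f_equal. unfold mid_dir, dir; simpl. field.
      * rewrite <- cis_plus, <- (cis_2PI (_ + _)). f_equal. unfold mid_dir, dir; simpl. field.
    + exists 1. split; auto. rewrite (V (-1)%Z (- (PI / 3))), (V 0%Z (PI / 3)); try lra.
      * unfold mid_dir, dir; simpl. split.
        replace (3 / 2 * ((2 * PI * -1 / 3 + 2 * PI * 0 / 3) / 2 + - (PI / 3))) with (- PI) by field. rewrite cmpi. f_equal; ring.
        replace (3 / 2 * ((2 * PI * -1 / 3 + 2 * PI * 0 / 3) / 2 + PI / 3)) with 0 by field. auto.
      * rewrite <- cis_plus. f_equal. unfold mid_dir, dir; simpl. field.
      * rewrite <- cis_plus. f_equal. unfold mid_dir, dir; simpl. field.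
    + exists (-1). split; auto. rewrite (V 0%Z (- (PI / 3))), (V 1%Z (PI / 3)); try lra.
      * unfold mid_dir, dir; simpl. split.
        replace (3 / 2 * ((2 * PI * 0 / 3 + 2 * PI * 1 / 3) / 2 + - (PI / 3))) with 0 by field. rewrite c0. f_equal; ring.
        replace (3 / 2 * ((2 * PI * 0 / 3 + 2 * PI * 1 / 3) / 2 + PI / 3)) with PI by field. auto.
      * rewrite <- cis_plus. f_equal. unfold mid_dir, dir; simpl. field.
      * rewrite <- cis_plus. f_equal. unfold mid_dir, dir; simpl. field.
Qed.

(** * The coefficients and the truncated expansion *)

Lemma alg_C_derive (g : C -> C) : alg true g ->
  alg true (C_derive g) /\ forall z, z <> RtoC 0 -> cderiv g z (C_derive g z).
Proof.
  intros H. destruct (alg_derive _ _ H) as [g' [A D]].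
  assert (E : forall z, z <> RtoC 0 -> C_derive g z = g' z).
  { intros z Hz. apply is_C_derive_unique. now apply D. }
  split.
  - apply alg_ext with g'; auto. intros z Hz. symmetry. now apply E, Hz.
  - intros z Hz. rewrite E; auto.
Qed.

Lemma alg_Ghat (d : nat) (p : nat -> C) (s : nat) : alg true (Ghat d p s).
Proof.
  induction s.
  - apply alg_ext with (fun z => RtoC (-1) * sum_n (G := C_AbelianMonoid) (fun r => p r * (z ^ r / z)) d)%C.
    + constructor. constructor. apply (alg_sum true (fun r z => p r * (z ^ r / z))%C).
      intros r. repeat constructor. apply alg_pow.
    + intros z _. simpl. ring.
  - simpl. apply alg_mult. apply alg_C_derive, alg_C_derive, IHs. now apply alg_inv.
Qed.

Lemma cderiv_sum_n (F F1 : nat -> C -> C) (z : C) (m : nat) :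
  (forall s, cderiv (F s) z (F1 s z)) ->
  cderiv (fun z => sum_n (G := C_AbelianMonoid) (fun s => F s z) m) z (sum_n (G := C_AbelianMonoid) (fun s => F1 s z) m).
Proof.
  intros H. induction m.
  - rewrite sum_O. apply cderiv_ext with (F 0%nat); auto. intros; now rewrite sum_O.
  - rewrite sum_Sn. apply cderiv_ext with (fun z => sum_n (G := C_AbelianMonoid) (fun s => F s z) m + F (S m) z)%C.
    + intros; now rewrite sum_Sn.
    + now apply cderiv_plus.
Qed.

Lemma Ghat_0_eq (d : nat) (p : nat -> C) (z : C) : z <> RtoC 0 -> (- (z * Ghat d p 0 z))%C = poly_eval d p z.
Proof.
  intros Hz. simpl. unfold poly_eval. induction d.
  - rewrite !sum_O. field; auto.
  - rewrite !sum_Sn. rewrite <- IHd. unfold plus; simpl. field; auto.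
Qed.

Section Expansion.

Variables (d : nat) (p : nat -> C) (u : R) (n : nat).
Hypothesis hu : 0 < u.
Hypothesis hn : (1 <= n)%nat.

Definition expansion1 (z : C) : C := 
  (RtoC (/ u ^ 2) * sum_n (G := C_AbelianMonoid) (fun s => C_derive (Ghat d p s) z / RtoC (u ^ (2 * s))) (n - 1))%C.

Lemma alg_expansion : alg true (expansion d p u n).
Proof.
  unfold expansion. constructor. constructor.
  apply (alg_sum true (fun s z => Ghat d p s z / RtoC (u ^ (2 * s)))%C). intros s.
  apply (alg_mult true (Ghat d p s) (fun _ => / RtoC (u ^ (2 * s)))%C). apply alg_Ghat. constructor.
Qed.

Lemma alg_expansion1 : alg true expansion1.
Proof.
  unfold expansion1. constructor. constructor.
  apply (alg_sum true (fun s z => C_derive (Ghat d p s) z / RtoC (u ^ (2 * s)))%C). intros s.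
  apply (alg_mult true (C_derive (Ghat d p s)) (fun _ => / RtoC (u ^ (2 * s)))%C).
  apply alg_C_derive, alg_Ghat. constructor.
Qed.

Lemma cderiv_expansion (z : C) : z <> RtoC 0 -> cderiv (expansion d p u n) z (expansion1 z).
Proof.
  intros Hz. unfold expansion, expansion1. apply cderiv_scal.
  apply (cderiv_sum_n (fun s z => Ghat d p s z / RtoC (u ^ (2 * s)))%C (fun s z => C_derive (Ghat d p s) z / RtoC (u ^ (2 * s)))%C).
  intros s. apply cderiv_mult_r. now apply (proj2 (alg_C_derive _ (alg_Ghat d p s))).
Qed.

(** Each Ghat_s'' is z Ghat_(s+1), so differentiating twice shifts the index by one. Compared with
    u^2 z times the expansion, the shifted sum lacks the term s = 0, which is -p, and has the
    additional term s = n. *)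
Lemma cderiv_expansion1 (z : C) : z <> RtoC 0 -> cderiv expansion1 z
  (RtoC (u ^ 2) * z * expansion d p u n z + RtoC (/ u ^ (2 * n)) * z * Ghat d p n z + poly_eval d p z)%C.
Proof.
  intros Hz.
  assert (Hu : forall m, RtoC (u ^ m) <> RtoC 0).
  { intros m E. apply RtoC_inj in E. assert (0 < u ^ m) by now apply pow_lt. lra. }
  replace (RtoC (u ^ 2) * z * expansion d p u n z + RtoC (/ u ^ (2 * n)) * z * Ghat d p n z + poly_eval d p z)%C
   with (RtoC (/ u ^ 2) * sum_n (G := C_AbelianMonoid) (fun s => C_derive (C_derive (Ghat d p s)) z / RtoC (u ^ (2 * s))) (n - 1))%C.
  - unfold expansion1. apply cderiv_scal.
    apply (cderiv_sum_n (fun s z => C_derive (Ghat d p s) z / RtoC (u ^ (2 * s)))%C (fun s z => C_derive (C_derive (Ghat d p s)) z / RtoC (u ^ (2 * s)))%C).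
    intros s. apply cderiv_mult_r. apply (proj2 (alg_C_derive _ (proj1 (alg_C_derive _ (alg_Ghat d p s))))). auto.
  - rewrite <- Ghat_0_eq by auto. unfold expansion.
    destruct n as [|m]; [lia|]. replace (S m - 1)%nat with m by lia.
    assert (E : forall s, C_derive (C_derive (Ghat d p s)) z = (z * Ghat d p (S s) z)%C).
    { intros s. change (Ghat d p (S s) z) with (C_derive (C_derive (Ghat d p s)) z / z)%C. field. auto. }
    rewrite RtoC_inv by (apply pow_nonzero; lra).
    rewrite RtoC_inv by (apply pow_nonzero; lra).
    clear hn. induction m.
    + rewrite !sum_O, E. change (2 * 0)%nat with 0%nat. change (2 * 1)%nat with 2%nat.
      change (u ^ 0) with 1. set (u2 := RtoC (u ^ 2)) in *. field. repeat split; auto. apply Hu.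
    + rewrite !sum_Sn, E. change (@plus C_AbelianMonoid) with Cplus.
      rewrite Cmult_plus_distr_l, IHm.
      replace (2 * S (S m))%nat with (2 * S m + 2)%nat by lia. rewrite pow_add, RtoC_mult.
      set (u2 := RtoC (u ^ 2)) in *.
      field. repeat split; auto. apply Hu.
Qed.

End Expansion.

(** * Variation along a path *)

Lemma rderiv_re_im (f : R -> C) (x : R) (l : C) : rderiv f x l ->
  is_derive (fun y => Re (f y)) x (Re l) /\ is_derive (fun y => Im (f y)) x (Im l).
Proof.
  intros H. rewrite rderiv_eps in H.
  assert (A : forall F : C -> R, (forall a, Rabs (F a) <= Cmod a) ->
    (forall a b c h, F (a - b - RtoC h * c)%C = F a - F b - h * F c) -> is_derive (fun y => F (f y)) x (F l)).
  { intros F HF HL. apply is_derive_Reals. intros eps He.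
    destruct (H (eps / 2)) as [del [Hd1 Hd]]. lra.
    exists (mkposreal del Hd1). intros h Hh1 Hh2. simpl in Hh2. specialize (Hd h Hh2).
    assert (E := Rle_trans _ _ _ (HF _) Hd). rewrite HL in E.
    replace ((F (f (x + h)) - F (f x)) / h - F l) with ((F (f (x + h)) - F (f x) - h * F l) * / h) by (field; auto).
    rewrite Rabs_mult, Rabs_inv.
    apply Rle_lt_trans with (eps / 2 * Rabs h * / Rabs h).
    - apply Rmult_le_compat_r; auto. left. now apply Rinv_0_lt_compat, Rabs_pos_lt.
    - rewrite Rmult_assoc, Rinv_r by (now apply Rabs_no_R0). lra. }
  split; apply A.
  - apply re_le_Cmod.
  - intros [a1 a2] [b1 b2] [c1 c2] h. unfold Re; simpl. ring.
  - apply im_le_Cmod.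
  - intros [a1 a2] [b1 b2] [c1 c2] h. unfold Im; simpl. ring.
Qed.

(** Strictly inside an arc, [gamma] agrees with its C^2 extension on a neighbourhood. At a break
    point the one-sided derivatives may differ, whence the open interval. *)
Lemma speed_arc (gamma g g1 : R -> C) (x y s : R) :
  (forall r, rderiv g r (g1 r)) -> (forall r, x <= r <= y -> gamma r = g r) -> x < s < y ->
  speed gamma s = Cmod (g1 s).
Proof.
  intros D E Hs. destruct (rderiv_re_im g s (g1 s) (D s)) as [D1 D2].
  assert (L : locally s (fun r => x <= r <= y)).
  { exists (mkposreal (Rmin (s - x) (y - s)) ltac:(apply Rmin_pos; lra)). intros r Hr.
    change (Rabs (r - s) < Rmin (s - x) (y - s)) in Hr.
    assert (A1 := Rmin_l (s - x) (y - s)). assert (A2 := Rmin_r (s - x) (y - s)).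
    apply Rabs_lt_between in Hr. lra. }
  unfold speed.
  replace (Derive (fun y => Re (gamma y)) s) with (Re (g1 s)).
  replace (Derive (fun y => Im (gamma y)) s) with (Im (g1 s)).
  - now destruct (g1 s).
  - symmetry. apply is_derive_unique. apply (is_derive_ext_loc (fun r => Im (g r))); auto.
    apply (filter_imp (fun r => x <= r <= y)); auto. intros r Hr. now rewrite E.
  - symmetry. apply is_derive_unique. apply (is_derive_ext_loc (fun r => Re (g r))); auto.
    apply (filter_imp (fun r => x <= r <= y)); auto. intros r Hr. now rewrite E.
Qed.

Lemma R2_arc_on (gamma g g1 : R -> C) (a b : Rbar) (x y : R) :
  (forall s : R, Rbar_le a s -> Rbar_le s b -> gamma s = g s /\ g1 s <> RtoC 0) ->
  Rbar_le a x -> Rbar_le y b -> forall s, x <= s <= y -> gamma s = g s /\ g1 s <> RtoC 0.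
Proof.
  intros G Ha Hb s Hs. apply G.
  - apply (Rbar_le_trans _ x); auto. simpl; lra.
  - apply (Rbar_le_trans _ y); auto. simpl; lra.
Qed.

Section Variation.

Variables (Dom : C -> Prop) (V V1 V2 : C -> C) (gamma : R -> C) (q1 q2 : C -> C).
Hypothesis DV : forall t, Dom t -> cderiv V t (V1 t).
Hypothesis DV1 : forall t, Dom t -> cderiv V1 t (V2 t).
Hypothesis Hdom : forall x, Dom (gamma x).
Hypothesis E1 : forall x y, x <= y -> ex_RInt (abs_integrand gamma q1) x y.
Hypothesis E2 : forall x y, x <= y -> ex_RInt (abs_integrand gamma q2) x y.

(** The fundamental theorem is applied to the extension g instead of [gamma]; V2 enters through the
    continuity of V1 along g. The integrals of q1 and q2 change only at the two end points. *)
Lemma arc_variation (a b : Rbar) (x y K1 K2 : R) : R2_arc gamma a b -> Rbar_le a x -> Rbar_le y b -> x <= y ->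
  (forall s, x <= s <= y -> Cmod (V1 (gamma s)) <= K1 * Cmod (q1 (gamma s)) + K2 * Cmod (q2 (gamma s))) ->
  Cmod (V (gamma y) - V (gamma x))%C <=
    K1 * RInt (abs_integrand gamma q1) x y + K2 * RInt (abs_integrand gamma q2) x y.
Proof.
  intros [g [g1 [g2 [D1 [D2 [_ G]]]]]] Ha Hb Hxy HK.
  assert (E := fun s Hs => proj1 (R2_arc_on gamma g g1 a b x y G Ha Hb s Hs)).
  assert (Dg : forall s, x <= s <= y -> Dom (g s)) by (intros s Hs; rewrite <- E; auto).
  rewrite (E x), (E y) by lra.
  assert (I : is_CRInt (fun s => g1 s * V1 (g s))%C x y (V (g y) - V (g x))%C).
  { apply (is_RInt_derive (V := C_R_CompleteNormedModule) (fun s => V (g s)) (fun s => g1 s * V1 (g s))%C);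
    rewrite Rmin_left, Rmax_right by auto; intros s Hs.
    - apply (rderiv_comp V g); auto.
    - eapply rderiv_continuous. apply rderiv_mult. apply D2.
      apply (rderiv_comp V1 g); auto. }
  rewrite <- norm_CR.
  apply (norm_RInt_le (V := C_R_NormedModule) (fun s => g1 s * V1 (g s))%C
    (fun s => K1 * (Cmod (q1 (g s)) * Cmod (g1 s)) + K2 * (Cmod (q2 (g s)) * Cmod (g1 s))) x y); auto.
  - intros s Hs. rewrite norm_CR, Cmod_mult. specialize (HK s Hs). rewrite (E s Hs) in HK.
    assert (P := Cmod_ge_0 (g1 s)). nra.
  - apply (is_RInt_ext (fun s => plus (scal K1 (abs_integrand gamma q1 s)) (scal K2 (abs_integrand gamma q2 s)))).
    + rewrite Rmin_left, Rmax_right by auto. intros s Hs. unfold abs_integrand.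
      rewrite (speed_arc gamma g g1 x y s D1 E Hs), E by lra. reflexivity.
    + apply (is_RInt_plus (V := R_NormedModule)); apply (is_RInt_scal (V := R_NormedModule));
      apply (RInt_correct (V := R_CompleteNormedModule)); auto.
Qed.

Lemma path_variation (l : list R) : forall (a : Rbar) (x y K1 K2 : R), R2_chain gamma a l -> Rbar_le a x -> x <= y ->
  (forall s, x <= s <= y -> Cmod (V1 (gamma s)) <= K1 * Cmod (q1 (gamma s)) + K2 * Cmod (q2 (gamma s))) ->
  Cmod (V (gamma y) - V (gamma x))%C <=
    K1 * RInt (abs_integrand gamma q1) x y + K2 * RInt (abs_integrand gamma q2) x y.
Proof.
  induction l as [|b l IH]; simpl; intros a x y K1 K2 H Ha Hxy HK.
  - apply (arc_variation a p_infty); simpl; auto.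
  - destruct H as [_ [H1 H2]].
    destruct (Rle_dec y b) as [Hy | Hy].
    { now apply (arc_variation a b). }
    destruct (Rle_dec b x) as [Hx | Hx].
    { apply (IH b); auto. }
    assert (T1 := arc_variation a b x b K1 K2 H1 Ha (Rbar_le_refl b) ltac:(lra) ltac:(intros; apply HK; lra)).
    assert (T2 := IH b b y K1 K2 H2 (Rbar_le_refl b) ltac:(lra) ltac:(intros; apply HK; lra)).
    rewrite <- (RInt_Chasles (V := R_CompleteNormedModule) (abs_integrand gamma q1) x b y) by (apply E1; lra).
    rewrite <- (RInt_Chasles (V := R_CompleteNormedModule) (abs_integrand gamma q2) x b y) by (apply E2; lra).
    replace (V (gamma y) - V (gamma x))%C with ((V (gamma y) - V (gamma b)) + (V (gamma b) - V (gamma x)))%C by ring.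
    eapply Rle_trans. apply Cmod_triangle. unfold plus; simpl. lra.
Qed.

Lemma path_bounded (l : list R) : forall (a : Rbar) (x y : R), R2_chain gamma a l -> Rbar_le a x -> x <= y ->
  exists K, forall s, x <= s <= y -> Cmod (V (gamma s)) <= K.
Proof.
  assert (A : forall a b (x y : R), R2_arc gamma a b -> Rbar_le a x -> Rbar_le y b -> x <= y ->
    exists K, forall s, x <= s <= y -> Cmod (V (gamma s)) <= K).
  { intros a b x y [g [g1 [g2 [D1 [D2 [_ G]]]]]] Ha Hb Hxy.
    assert (E := fun s Hs => proj1 (R2_arc_on gamma g g1 a b x y G Ha Hb s Hs)).
    destruct (continuity_ab_maj (fun s => Cmod (V (g s))) x y Hxy) as [M [HM _]].
    - intros s Hs. apply continuity_pt_filterlim.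
      assert (C : Ccont (fun s => V (g s)) s).
      { eapply rderiv_continuous. apply (rderiv_comp V g); [apply DV; rewrite <- E; auto | apply D1]. }
      intros P [eps HP]. rewrite Ccont_eps in C. destruct (C eps (cond_pos eps)) as [del [Hd1 Hd]].
      exists (mkposreal del Hd1). intros r Hr. apply HP. specialize (Hd r Hr).
      change (Rabs (Cmod (V (g r)) - Cmod (V (g s))) < eps).
      assert (L := Cmod_lip (V (g s)) (V (g r) - V (g s))).
      replace (V (g s) + (V (g r) - V (g s)))%C with (V (g r)) in L by ring. lra.
    - exists (Cmod (V (g M))). intros s Hs. rewrite E by auto. now apply HM. }
  induction l as [|b l IH]; simpl; intros a x y H Ha Hxy.
  - apply (A a p_infty); simpl; auto.
  - destruct H as [_ [H1 H2]].
    destruct (Rle_dec y b) as [Hy | Hy]. { now apply (A a b). }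
    destruct (Rle_dec b x) as [Hx | Hx]. { apply (IH b); auto. }
    destruct (A a b x b H1 Ha (Rbar_le_refl b)) as [K1 HK1]. lra.
    destruct (IH b b y H2 (Rbar_le_refl b)) as [K2 HK2]. lra.
    exists (Rmax K1 K2). intros s Hs. destruct (Rle_dec s b).
    + eapply Rle_trans; [apply HK1; lra | apply Rmax_l].
    + eapply Rle_trans; [apply HK2; lra | apply Rmax_r].
Qed.

End Variation.

(** * Integrals over the whole path and the supremum estimate *)

Lemma abs_integrand_ge_0 (gamma : R -> C) (q : C -> C) (x : R) : 0 <= abs_integrand gamma q x.
Proof. apply Rmult_le_pos; apply Cmod_ge_0. Qed.

(** The improper integral only speaks of large intervals: integrability on [x, y] is inherited from
    one containing it, and the bound holds because the discarded pieces are nonnegative. *)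
Lemma abs_int_partial (gamma : R -> C) (q : C -> C) : abs_int_exists gamma q ->
  forall x y, x <= y -> ex_RInt (abs_integrand gamma q) x y /\
    0 <= RInt (abs_integrand gamma q) x y <= abs_int gamma q.
Proof.
  intros H x y Hxy.
  assert (L := RInt_gen_correct (V := R_CompleteNormedModule) (Fa := Rbar_locally m_infty) (Fb := Rbar_locally p_infty) _ H).
  fold (abs_int gamma q) in L. set (f := abs_integrand gamma q) in *.
  assert (A : forall eps, 0 < eps -> exists a b v, a <= x /\ y <= b /\ is_RInt f a b v /\ v < abs_int gamma q + eps).
  { intros eps He.
    destruct (L _ (locally_ball (abs_int gamma q) (mkposreal eps He))) as [Q S [M1 HQ] [M2 HS] HQS].
    destruct (HQS (Rmin x (M1 - 1)) (Rmax y (M2 + 1))) as [v [Hv1 Hv2]].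
    - apply HQ. generalize (Rmin_r x (M1 - 1)); lra.
    - apply HS. generalize (Rmax_r y (M2 + 1)); lra.
    - exists (Rmin x (M1 - 1)), (Rmax y (M2 + 1)), v. repeat split; auto.
      apply Rmin_l. apply Rmax_l.
      change (Rabs (v - abs_int gamma q) < eps) in Hv2. apply Rabs_lt_between in Hv2. lra. }
  assert (S : forall a b v, a <= x -> y <= b -> is_RInt f a b v -> ex_RInt f a x /\ ex_RInt f x y /\ ex_RInt f y b).
  { intros a b v Ha Hb Hv. assert (X : ex_RInt f a b) by (now exists v).
    assert (X1 : ex_RInt f a y) by (apply (ex_RInt_Chasles_1 f a y b); auto; lra).
    split; [|split].
    - apply (ex_RInt_Chasles_1 f a x y); auto; lra.
    - apply (ex_RInt_Chasles_2 f a x y); auto; lra.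
    - apply (ex_RInt_Chasles_2 f a y b); auto; lra. }
  assert (P : forall a b, a <= b -> ex_RInt f a b -> 0 <= RInt f a b).
  { intros a b Hab Hf. apply RInt_ge_0; auto. intros; apply abs_integrand_ge_0. }
  destruct (A 1 Rlt_0_1) as [a [b [v [Ha [Hb [Hv _]]]]]]. destruct (S a b v Ha Hb Hv) as [_ [X _]].
  split; auto. split. now apply P.
  apply le_epsilon. intros eps He. destruct (A eps He) as [a' [b' [v' [Ha' [Hb' [Hv' Lv]]]]]].
  destruct (S a' b' v' Ha' Hb' Hv') as [X1 [X2 X3]].
  assert (Ev : v' = RInt f a' x + (RInt f x y + RInt f y b')).
  { rewrite <- (is_RInt_unique _ _ _ _ Hv').
    rewrite <- (RInt_Chasles (V := R_CompleteNormedModule) f a' x b'); auto.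
    - rewrite <- (RInt_Chasles (V := R_CompleteNormedModule) f x y b'); auto.
    - apply (ex_RInt_Chasles (V := R_NormedModule)) with y; auto. }
  assert (P1 := P _ _ Ha' X1). assert (P3 := P _ _ Hb' X3). lra.
Qed.

(* The weight exp(- u phi), with phi constant near x0 and 1-Lipschitz in m, makes the supremum of H
   finite without changing the estimate at x0. *)
Lemma weighted_sup_estimate (u al be : R) (H m g0 : R -> R) (A B : R -> C) (I1 I2 : R -> R -> R) (T1 T2 Gam C0 x0 : R) :
  0 < u -> 0 <= al -> 0 <= be ->
  (forall x, 0 <= H x) -> (forall x y, x <= y -> m x <= m y) ->
  (forall x y, x <= y -> 0 <= I1 x y) -> (forall x y, x <= y -> 0 <= I2 x y) ->
  (forall x y z, x <= y -> y <= z -> I1 x y + I1 y z <= T1) ->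
  (forall x y z, x <= y -> y <= z -> I2 x y + I2 y z <= T2) ->
  (forall x y K1 K2, x <= y -> (forall s, x <= s <= y -> exp (- (u * m s)) * (al * H s) <= K1) ->
     (forall s, x <= s <= y -> exp (- (u * m s)) * be <= K2) ->
     Cmod (A y - A x)%C <= K1 * I1 x y + K2 * I2 x y) ->
  (forall x y K1 K2, x <= y -> (forall s, x <= s <= y -> exp (u * m s) * (al * H s) <= K1) ->
     (forall s, x <= s <= y -> exp (u * m s) * be <= K2) ->
     Cmod (B y - B x)%C <= K1 * I1 x y + K2 * I2 x y) ->
  (forall eps, 0 < eps -> exists M, forall y, M <= y -> Cmod (A y) <= eps) ->
  (forall eps, 0 < eps -> exists M, forall y, y <= M -> Cmod (B y) <= eps) ->
  (forall x, H x <= g0 x + 1 / (2 * u) * (exp (u * m x) * Cmod (A x) + exp (- (u * m x)) * Cmod (B x))) ->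
  (forall x, 0 <= g0 x <= Gam) -> (forall x, H x <= C0 * exp (u * Rabs (m x))) ->
  al / (2 * u) * T1 < 1 ->
  H x0 <= g0 x0 + be / (2 * u) * T2 +
    al / (2 * u) * T1 * ((Gam + be / (2 * u) * T2) / (1 - al / (2 * u) * T1)).
Proof.
  intros hu hal hbe H0 Hm P1 P2 S1 S2 VA VB LA LB HH HG HC Hk.
  (* As |m| <= phi + T, the a priori bound on H gives H e^(-u phi) <= |C0| e^(u T), whence a finite
     supremum. *)
  set (T := Rabs (m x0)). set (phi := fun x => Rmax 0 (Rabs (m x) - T)).
  set (kap := al / (2 * u) * T1) in *. set (Q := be / (2 * u) * T2).
  assert (phi0 : forall x, 0 <= phi x) by (intros; apply Rmax_l).
  assert (iu : 0 < / (2 * u)) by (apply Rinv_0_lt_compat; lra).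
  (* Hence e^(u (phi - m)) decreases and e^(u (phi + m)) increases: to the right of x for A, and to
     the left of x for B, the weighted integrand is largest at x itself. *)
  assert (Lip : forall x y, x <= y -> phi y - m y <= phi x - m x /\ phi x + m x <= phi y + m y).
  { intros x y Hxy. specialize (Hm x y Hxy). unfold phi, Rmax, Rabs.
    repeat destruct Rle_dec; repeat destruct Rcase_abs; lra. }
  set (S := fun v => exists x, v = H x * exp (- (u * phi x))).
  assert (bS : bound S).
  { exists (Rabs C0 * exp (u * T)). intros v [x ->].
    apply Rle_trans with (C0 * exp (u * Rabs (m x)) * exp (- (u * phi x))).
    - apply Rmult_le_compat_r. left; apply exp_pos. auto.
    - rewrite Rmult_assoc, <- exp_plus.
      apply Rle_trans with (Rabs C0 * exp (u * Rabs (m x) + - (u * phi x))).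
      + apply Rmult_le_compat_r. left; apply exp_pos. apply Rle_abs.
      + apply Rmult_le_compat_l. apply Rabs_pos. apply exp_le.
        assert (Rabs (m x) <= phi x + T) by (unfold phi; generalize (Rmax_r 0 (Rabs (m x) - T)); lra). nra. }
  destruct (completeness S bS) as [M [HM1 HM2]]. { now exists (H x0 * exp (- (u * phi x0))), x0. }
  assert (HM : forall x, H x <= M * exp (u * phi x)).
  { intros x. assert (E : H x * exp (- (u * phi x)) <= M) by (apply HM1; now exists x).
    apply Rmult_le_compat_r with (r := exp (u * phi x)) in E; [|left; apply exp_pos].
    rewrite Rmult_assoc, <- exp_plus in E. replace (- (u * phi x) + u * phi x) with 0 in E by ring.
    rewrite exp_0, Rmult_1_r in E. auto. }
  assert (M0 : 0 <= M).
  { assert (E := HM x0). specialize (H0 x0). assert (X := exp_pos (u * phi x0)). nra. }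
  assert (Main : forall x, H x <= g0 x + Q + kap * M * exp (u * phi x)).
  { intros x. apply le_epsilon. intros eps He.
    set (em := exp (u * m x)). set (en := exp (- (u * m x))). set (ep := exp (u * phi x)).
    assert (em0 : 0 < em) by apply exp_pos. assert (en0 : 0 < en) by apply exp_pos. assert (ep0 : 0 < ep) by apply exp_pos.
    assert (emn : em * en = 1).
    { unfold em, en. rewrite <- exp_plus. replace (u * m x + - (u * m x)) with 0 by ring. apply exp_0. }
    (* After multiplication by [em] and [en] the two end values contribute eps u each, and division
       by 2 u turns their sum into eps. *)
    destruct (LA (eps * u * en)) as [Ma HMa]. { repeat apply Rmult_lt_0_compat; lra. }
    destruct (LB (eps * u * em)) as [Mb HMb]. { repeat apply Rmult_lt_0_compat; lra. }
    set (y := Rmax x Ma). set (z := Rmin x Mb).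
    assert (xy : x <= y) by apply Rmax_l. assert (zx : z <= x) by apply Rmin_l.
    specialize (HMa y (Rmax_r _ _)). specialize (HMb z (Rmin_r _ _)).
    assert (XA := VA x y (al * M * ep * en) (en * be) xy). assert (XB := VB z x (al * M * ep * em) (em * be) zx).
    assert (YA : Cmod (A y - A x)%C <= al * M * ep * en * I1 x y + en * be * I2 x y).
    { apply XA.
      - intros s Hs. destruct (Lip x s ltac:(lra)) as [L1 _].
        apply Rle_trans with (exp (- (u * m s)) * (al * (M * exp (u * phi s)))).
        + apply Rmult_le_compat_l. left; apply exp_pos. now apply Rmult_le_compat_l.
        + replace (exp (- (u * m s)) * (al * (M * exp (u * phi s)))) with (al * M * (exp (u * phi s) * exp (- (u * m s)))) by ring.
          replace (al * M * ep * en) with (al * M * (ep * en)) by ring.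
          apply Rmult_le_compat_l. now apply Rmult_le_pos. unfold ep, en. rewrite <- !exp_plus. apply exp_le. nra.
      - intros s Hs. apply Rmult_le_compat_r; auto. apply exp_le. specialize (Hm x s ltac:(lra)). nra. }
    assert (YB : Cmod (B x - B z)%C <= al * M * ep * em * I1 z x + em * be * I2 z x).
    { apply XB.
      - intros s Hs. destruct (Lip s x ltac:(lra)) as [_ L1].
        apply Rle_trans with (exp (u * m s) * (al * (M * exp (u * phi s)))).
        + apply Rmult_le_compat_l. left; apply exp_pos. now apply Rmult_le_compat_l.
        + replace (exp (u * m s) * (al * (M * exp (u * phi s)))) with (al * M * (exp (u * phi s) * exp (u * m s))) by ring.
          replace (al * M * ep * em) with (al * M * (ep * em)) by ring.
          apply Rmult_le_compat_l. now apply Rmult_le_pos. unfold ep, em. rewrite <- !exp_plus. apply exp_le. nra.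
      - intros s Hs. apply Rmult_le_compat_r; auto. apply exp_le. specialize (Hm s x ltac:(lra)). nra. }
    assert (ZA : em * Cmod (A x) <= eps * u + al * M * ep * I1 x y + be * I2 x y).
    { assert (Z : Cmod (A x) <= Cmod (A y) + Cmod (A y - A x)%C).
      { replace (A x) with (A y - (A y - A x))%C at 1 by ring. apply Cmod_minus_le. }
      apply Rle_trans with (em * (eps * u * en + (al * M * ep * en * I1 x y + en * be * I2 x y))).
      - apply Rmult_le_compat_l; lra.
      - right. transitivity (em * en * (eps * u + al * M * ep * I1 x y + be * I2 x y)). ring. rewrite emn. ring. }
    assert (ZB : en * Cmod (B x) <= eps * u + al * M * ep * I1 z x + be * I2 z x).
    { assert (Z : Cmod (B x) <= Cmod (B z) + Cmod (B x - B z)%C).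
      { replace (B x) with (B z + (B x - B z))%C at 1 by ring. apply Cmod_triangle. }
      apply Rle_trans with (en * (eps * u * em + (al * M * ep * em * I1 z x + em * be * I2 z x))).
      - apply Rmult_le_compat_l; lra.
      - right. transitivity (em * en * (eps * u + al * M * ep * I1 z x + be * I2 z x)). ring. rewrite emn. ring. }
    specialize (HH x). fold em en in HH. specialize (S1 z x y zx xy). specialize (S2 z x y zx xy).
    assert (W1 : al * M * ep * (I1 z x + I1 x y) <= al * M * ep * T1).
    { apply Rmult_le_compat_l; auto. apply Rmult_le_pos; [now apply Rmult_le_pos | lra]. }
    assert (W2 : be * (I2 z x + I2 x y) <= be * T2) by now apply Rmult_le_compat_l.
    assert (W3 : em * Cmod (A x) + en * Cmod (B x) <= 2 * u * eps + al * M * ep * T1 + be * T2) by lra.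
    apply Rmult_le_compat_l with (r := 1 / (2 * u)) in W3; [|unfold Rdiv; lra].
    replace (1 / (2 * u) * (2 * u * eps + al * M * ep * T1 + be * T2)) with
      (eps + kap * M * ep + Q) in W3 by (unfold kap, Q; field; lra). lra. }
  assert (kap0 : 0 <= kap).
  { unfold kap. apply Rmult_le_pos. apply Rmult_le_pos; lra.
    specialize (S1 0 0 0 (Rle_refl 0) (Rle_refl 0)). specialize (P1 0 0 (Rle_refl 0)). lra. }
  assert (Q0 : 0 <= Q).
  { unfold Q. apply Rmult_le_pos. apply Rmult_le_pos; lra.
    specialize (S2 0 0 0 (Rle_refl 0) (Rle_refl 0)). specialize (P2 0 0 (Rle_refl 0)). lra. }
  (* [Main] times e^(-u phi), which is at most 1, bounds every element of S. As kap < 1, this can be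
     solved for M. *)
  assert (MB : M <= (Gam + Q) + kap * M).
  { apply HM2. intros v [x ->]. specialize (Main x). specialize (HG x).
    set (ep := exp (u * phi x)) in *. set (en := exp (- (u * phi x))).
    assert (epn : ep * en = 1).
    { unfold ep, en. rewrite <- exp_plus. replace (u * phi x + - (u * phi x)) with 0 by ring. apply exp_0. }
    assert (en1 : 0 < en <= 1).
    { unfold en. split. apply exp_pos. rewrite <- exp_0. apply exp_le. specialize (phi0 x). nra. }
    apply Rle_trans with ((g0 x + Q + kap * M * ep) * en).
    - apply Rmult_le_compat_r; lra.
    - replace ((g0 x + Q + kap * M * ep) * en) with ((g0 x + Q) * en + kap * M * (ep * en)) by ring.
      rewrite epn, Rmult_1_r. apply Rplus_le_compat_r. nra. }
  assert (MB' : M <= (Gam + Q) / (1 - kap)).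
  { apply Rmult_le_reg_r with (1 - kap). lra. unfold Rdiv. rewrite Rmult_assoc, Rinv_l by lra. lra. }
  (* A second use of [Main], at x0, keeps g0 x0 in the leading term: the supremum Gam appears only
     multiplied by kap. *)
  specialize (Main x0). assert (Z : phi x0 = 0).
  { unfold phi, T, Rmax. destruct Rle_dec; lra. }
  rewrite Z, Rmult_0_r, exp_0, Rmult_1_r in Main.
  assert (kap * M <= kap * ((Gam + Q) / (1 - kap))) by now apply Rmult_le_compat_l.
  lra.
Qed.

(** * The error term *)

Lemma cpow_quarter (j k : Z) (m : nat) (t : C) : cpow j k (INR m / 4) t = (cpow j k (1 / 4) t ^ m)%C.
Proof.
  induction m.
  - simpl INR. replace (0 / 4) with 0 by field. now rewrite cpow_0.
  - rewrite Cpow_S, <- IHm, cpow_plus. f_equal. rewrite S_INR. field.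
Qed.

Lemma cpow_opp (j k : Z) (a : R) (t : C) : cpow j k (- a) t = (/ cpow j k a t)%C.
Proof.
  assert (E := cpow_plus j k a (- a) t). rewrite Rplus_opp_r, cpow_0 in E.
  assert (N := cpow_neq_0 j k a t).
  replace (cpow j k (- a) t) with (/ cpow j k a t * (cpow j k a t * cpow j k (- a) t))%C by (field; auto).
  rewrite E. ring.
Qed.

Section Error.

Variables (d : nat) (p : nat -> C) (u : R) (j k : Z) (n : nat) (W W1 : C -> C).
Hypothesis hu : 0 < u.
Hypothesis hn : (1 <= n)%nat.
Hypothesis DW : forall t, cderiv W t (W1 t).
Hypothesis DW1 : forall t, cderiv W1 t (RtoC (u ^ 2) * t * W t + poly_eval d p t)%C.

Let mu := mid_dir j k.
Let cp := cpow j k.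
Let be := / u ^ (2 * n + 1).

Definition err (t : C) : C := (W t - expansion d p u n t)%C.
Definition err1 (t : C) : C := (W1 t - expansion1 d p u n t)%C.

(** Liouville variables: [eta] = t^(1/4) err and [theta] = d eta / d xi with xi = (2/3) t^(3/2). *)
Definition eta (t : C) : C := (cp (1 / 4) t * err t)%C.
Definition theta (t : C) : C := (/ 4 * cp (- (5 / 4)) t * err t + cp (- (1 / 4)) t * err1 t)%C.

(** The case s = 1 is the factor of P and s = -1 that of Q. Since u be = u^(-2n), the exponential's
    derivative times the last term cancels the inhomogeneity u^(-2n) t^(1/2) g in theta'. *)
Definition bracket (s : R) (t : C) : C :=
  (theta t + RtoC (s * u) * eta t - RtoC (s * be) * qG d p j k n t)%C.
Definition Ppm (s : R) (t : C) : C := (Cexp (RtoC (- (s * u * (2 / 3))) * cp (3 / 2) t) * bracket s t)%C.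
Definition Ppm1 (s : R) (t : C) : C :=
  (Cexp (RtoC (- (s * u * (2 / 3))) * cp (3 / 2) t) *
    (RtoC (- (5 / 16)) * (cp (- (5 / 2)) t * eta t) - RtoC (s * be) * C_derive (qG d p j k n) t))%C.

Lemma cderiv_err (t : C) : t <> RtoC 0 -> cderiv err t (err1 t).
Proof. intros Ht. apply cderiv_minus; auto. now apply cderiv_expansion. Qed.

Lemma cderiv_err1 (t : C) : t <> RtoC 0 ->
  cderiv err1 t (RtoC (u ^ 2) * t * err t - RtoC (/ u ^ (2 * n)) * t * Ghat d p n t)%C.
Proof.
  intros Ht.
  replace (RtoC (u ^ 2) * t * err t - RtoC (/ u ^ (2 * n)) * t * Ghat d p n t)%C with
   ((RtoC (u ^ 2) * t * W t + poly_eval d p t) - (RtoC (u ^ 2) * t * expansion d p u n t +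
      RtoC (/ u ^ (2 * n)) * t * Ghat d p n t + poly_eval d p t))%C by (unfold err; ring).
  apply cderiv_minus; auto. now apply cderiv_expansion1.
Qed.

Lemma cderiv_qG (t : C) : slit mu t ->
  cderiv (qG d p j k n) t (RtoC (1 / 4) * cp (1 / 4 - 1) t * Ghat d p n t + cp (1 / 4) t * C_derive (Ghat d p n) t)%C.
Proof.
  intros Ht. apply cderiv_mult. now apply cderiv_cpow.
  apply (proj2 (alg_C_derive _ (alg_Ghat d p n))). now apply (slit_neq_0 mu).
Qed.

Lemma C_derive_qG (t : C) : slit mu t ->
  C_derive (qG d p j k n) t = (RtoC (1 / 4) * cp (1 / 4 - 1) t * Ghat d p n t + cp (1 / 4) t * C_derive (Ghat d p n) t)%C.
Proof. intros Ht. apply is_C_derive_unique. now apply cderiv_qG. Qed.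

(** The coefficient 5/16 is (1/4) (5/4), from differentiating (1/4) t^(-5/4) in theta; the two terms
    t^(-5/4) err' cancel. All powers of t are integral powers of r = t^(1/4), so the claim becomes a
    rational identity in r, once s^2 = 1 is used by splitting the sign. *)
Lemma cderiv_Ppm (s : R) (t : C) : s = 1 \/ s = -1 -> slit mu t -> cderiv (Ppm s) t (Ppm1 s t).
Proof.
  intros Hs Ht. assert (t0 := slit_neq_0 mu t Ht).
  set (r := cp (1 / 4) t). assert (r0 : r <> RtoC 0) by apply cpow_neq_0.
  assert (Q : forall a m, a = INR m / 4 -> cp a t = (r ^ m)%C) by (intros a m ->; apply cpow_quarter).
  assert (Qn : forall a m, a = - (INR m / 4) -> cp a t = (/ r ^ m)%C).
  { intros a m ->. unfold cp. rewrite cpow_opp. f_equal. apply cpow_quarter. }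
  assert (tr : t = (r ^ 4)%C).
  { rewrite <- (Q 1 4%nat) by (simpl; field). symmetry. now apply cpow_1. }
  assert (un : RtoC u <> RtoC 0) by (intros X; apply RtoC_inj in X; lra).
  assert (bn : RtoC (/ u ^ (2 * n)) = (RtoC u * RtoC be)%C).
  { unfold be. rewrite <- RtoC_mult. f_equal. rewrite pow_add. field. split; [lra | apply pow_nonzero; lra]. }
  assert (Db : cderiv (bracket s) t
    ((/ 4 * (RtoC (- (5 / 4)) * cp (- (5 / 4) - 1) t) * err t + / 4 * cp (- (5 / 4)) t * err1 t) +
     (RtoC (- (1 / 4)) * cp (- (1 / 4) - 1) t * err1 t +
      cp (- (1 / 4)) t * (RtoC (u ^ 2) * t * err t - RtoC (/ u ^ (2 * n)) * t * Ghat d p n t)) +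
     RtoC (s * u) * (RtoC (1 / 4) * cp (1 / 4 - 1) t * err t + cp (1 / 4) t * err1 t) -
     RtoC (s * be) * (RtoC (1 / 4) * cp (1 / 4 - 1) t * Ghat d p n t + cp (1 / 4) t * C_derive (Ghat d p n) t))%C).
  { unfold bracket. apply cderiv_minus; [apply cderiv_plus; [apply cderiv_plus|]|].
    - apply (cderiv_mult (fun t => / 4 * cp (- (5 / 4)) t)%C).
      + apply cderiv_scal. now apply cderiv_cpow.
      + now apply cderiv_err.
    - apply cderiv_mult. now apply cderiv_cpow. now apply cderiv_err1.
    - apply cderiv_scal, cderiv_mult. now apply cderiv_cpow. now apply cderiv_err.
    - apply cderiv_scal. now apply cderiv_qG. }
  set (E := Cexp (RtoC (- (s * u * (2 / 3))) * cp (3 / 2) t)).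
  assert (DE : cderiv (fun t => Cexp (RtoC (- (s * u * (2 / 3))) * cp (3 / 2) t)%C) t
    (RtoC (- (s * u * (2 / 3))) * (RtoC (3 / 2) * cp (3 / 2 - 1) t) * E)%C).
  { apply (cderiv_comp Cexp (fun t => RtoC (- (s * u * (2 / 3))) * cp (3 / 2) t)%C).
    apply cderiv_Cexp. apply cderiv_scal. now apply cderiv_cpow. }
  assert (D := cderiv_mult _ _ _ _ _ DE Db). cbv beta in D. fold E in D.
  match type of D with is_derive _ _ ?X => replace (Ppm1 s t) with X end; [exact D|].
  unfold Ppm1. fold E. rewrite (C_derive_qG t Ht). unfold bracket, theta, eta, qG. fold cp.
  rewrite bn.
  rewrite (Qn (- (5 / 4) - 1) 9%nat), (Qn (- (5 / 4)) 5%nat), (Qn (- (1 / 4) - 1) 5%nat), (Qn (- (1 / 4)) 1%nat),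
    (Qn (1 / 4 - 1) 3%nat), (Qn (- (5 / 2)) 10%nat), (Q (3 / 2 - 1) 2%nat) by (simpl; field).
  fold r. 
  replace (RtoC (u ^ 2)) with (RtoC u * RtoC u)%C by (rewrite <- RtoC_mult; f_equal; ring).
  set (e0 := err t). set (e1 := err1 t). set (G := Ghat d p n t). set (G' := C_derive (Ghat d p n) t).
  rewrite tr.
  assert (s2 : RtoC s = RtoC 1 \/ RtoC s = (- (1))%C).
  { destruct Hs as [-> | ->]; [left | right]; auto. unfold RtoC, Copp; simpl. f_equal; ring. }
  rewrite !RtoC_opp, !RtoC_mult, !RtoC_div by lra.
  assert (c4 : RtoC 4 <> RtoC 0) by (intros X; apply RtoC_inj in X; lra).
  assert (c16 : RtoC 16 <> RtoC 0) by (intros X; apply RtoC_inj in X; lra).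
  assert (c2 : RtoC 2 <> RtoC 0) by (intros X; apply RtoC_inj in X; lra).
  assert (c3 : RtoC 3 <> RtoC 0) by (intros X; apply RtoC_inj in X; lra).
  destruct s2 as [-> | ->]; field; repeat split; auto.
Qed.

(** Supplies the continuity of the derivative along the arcs. Near t the operator [C_derive] is
    replaced by the explicit derivative of t^(1/4) Ghat_n, which can be differentiated again. *)
Lemma cderiv_Ppm1 (s : R) : exists l : C -> C, forall t, slit mu t -> cderiv (Ppm1 s) t (l t).
Proof.
  destruct (alg_C_derive _ (alg_Ghat d p n)) as [A1 D1]. destruct (alg_C_derive _ A1) as [_ D2].
  eexists. intros t Ht. assert (t0 := slit_neq_0 mu t Ht).
  destruct (slit_open mu t Ht) as [r [Hr Or]].
  apply (cderiv_ext_loc (fun t => Cexp (RtoC (- (s * u * (2 / 3))) * cp (3 / 2) t) *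
    (RtoC (- (5 / 16)) * (cp (- (5 / 2)) t * eta t) - RtoC (s * be) *
     (RtoC (1 / 4) * cp (1 / 4 - 1) t * Ghat d p n t + cp (1 / 4) t * C_derive (Ghat d p n) t)))%C _ t _ r Hr).
  { intros h Hh. unfold Ppm1. rewrite C_derive_qG; auto. }
  apply cderiv_mult.
  - apply (cderiv_comp Cexp (fun t => RtoC (- (s * u * (2 / 3))) * cp (3 / 2) t)%C).
    apply cderiv_Cexp. apply cderiv_scal. now apply cderiv_cpow.
  - apply cderiv_minus.
    + apply cderiv_scal, cderiv_mult. now apply cderiv_cpow.
      apply cderiv_mult. now apply cderiv_cpow. now apply cderiv_err.
    + apply cderiv_scal, cderiv_plus.
      * apply (cderiv_mult (fun t => RtoC (1 / 4) * cp (1 / 4 - 1) t)%C). apply cderiv_scal. now apply cderiv_cpow. now apply D1.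
      * apply cderiv_mult. now apply cderiv_cpow. now apply D2.
Qed.

Lemma cderiv_eta (t : C) : slit mu t ->
  cderiv eta t (RtoC (1 / 4) * cp (1 / 4 - 1) t * err t + cp (1 / 4) t * err1 t)%C.
Proof.
  intros Ht. apply cderiv_mult. now apply cderiv_cpow. apply cderiv_err. now apply (slit_neq_0 mu).
Qed.

Lemma Re_RtoC_mult (a : R) (z : C) : Re (RtoC a * z)%C = a * Re z.
Proof. destruct z. unfold Re; simpl. ring. Qed.

Lemma Cmod_Ppm_exp (s : R) (t : C) :
  Cmod (Ppm s t) = exp (- (u * (s * (2 / 3) * Re (cp (3 / 2) t)))) * Cmod (bracket s t).
Proof. unfold Ppm. rewrite Cmod_mult, Cmod_Cexp, Re_RtoC_mult. f_equal. f_equal. ring. Qed.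

Lemma be_pos : 0 < be.
Proof. apply Rinv_0_lt_compat, pow_lt, hu. Qed.

Lemma Cmod_Ppm1_le (s : R) (t : C) : s = 1 \/ s = -1 -> slit mu t ->
  Cmod (Ppm1 s t) <= exp (- (u * (s * (2 / 3) * Re (cp (3 / 2) t)))) *
    (5 / 16 * Cmod (eta t)) * Cmod (qI j k t) +
    exp (- (u * (s * (2 / 3) * Re (cp (3 / 2) t)))) * be * Cmod (C_derive (qG d p j k n) t).
Proof.
  intros Hs Ht. unfold Ppm1. rewrite Cmod_mult, Cmod_Cexp, Re_RtoC_mult.
  replace (- (s * u * (2 / 3)) * Re (cp (3 / 2) t)) with (- (u * (s * (2 / 3) * Re (cp (3 / 2) t)))) by ring.
  rewrite !Rmult_assoc, <- Rmult_plus_distr_l. apply Rmult_le_compat_l. left; apply exp_pos.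
  eapply Rle_trans. apply Cmod_minus_le. rewrite !Cmod_mult, !Cmod_R.
  assert (E : qI j k t = cp (- (5 / 2)) t).
  { unfold qI, cp. rewrite cpow_opp. unfold Cdiv. ring. }
  rewrite E. assert (P := be_pos).
  replace (Rabs (- (5 / 16))) with (5 / 16) by (rewrite Rabs_Ropp, Rabs_right; lra).
  replace (Rabs (s * be)) with be. lra.
  rewrite Rabs_mult, (Rabs_right be) by lra.
  destruct Hs as [-> | ->]; unfold Rabs; destruct Rcase_abs; lra.
Qed.

(** In the difference of the two brackets theta drops out, leaving 2 s u eta - 2 s u^(-2n-1) g,
    which is solved for eta. *)
Lemma eta_le (s : R) (t : C) : s = 1 \/ s = -1 -> 
  Cmod (eta t) <= / u ^ (2 * n + 2) * Cmod (qG d p j k n t) + 1 / (2 * u) *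
    (exp (u * (s * (2 / 3) * Re (cp (3 / 2) t))) * Cmod (Ppm s t) +
     exp (- (u * (s * (2 / 3) * Re (cp (3 / 2) t)))) * Cmod (Ppm (- s) t)).
Proof.
  intros Hs. rewrite !Cmod_Ppm_exp. set (x := u * (s * (2 / 3) * Re (cp (3 / 2) t))).
  replace (u * (- s * (2 / 3) * Re (cp (3 / 2) t))) with (- x) by (unfold x; ring).
  rewrite <- !Rmult_assoc, <- !exp_plus.
  replace (x + - x) with 0 by ring. replace (- x + - - x) with 0 by ring. rewrite exp_0, !Rmult_1_l.
  assert (E : eta t = (RtoC (/ u ^ (2 * n + 2)) * qG d p j k n t + RtoC (s / (2 * u)) * (bracket s t - bracket (- s) t))%C).
  { unfold bracket. set (G := qG d p j k n t).
    replace (theta t + RtoC (s * u) * eta t - RtoC (s * be) * G - (theta t + RtoC (- s * u) * eta t - RtoC (- s * be) * G))%C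
     with (RtoC (2 * s * u) * eta t - RtoC (2 * s * be) * G)%C.
    2: { rewrite !RtoC_mult, RtoC_opp. ring. }
    replace (RtoC (s / (2 * u)) * (RtoC (2 * s * u) * eta t - RtoC (2 * s * be) * G))%C with
     (RtoC (s / (2 * u) * (2 * s * u)) * eta t - RtoC (s / (2 * u) * (2 * s * be)) * G)%C by (rewrite !(RtoC_mult (s / (2 * u))); ring).
    assert (ss : s * s = 1) by (destruct Hs as [-> | ->]; ring).
    replace (s / (2 * u) * (2 * s * u)) with 1.
    2: { transitivity (s * s). auto. field. lra. }
    replace (s / (2 * u) * (2 * s * be)) with (/ u ^ (2 * n + 2)).
    2: { transitivity (s * s * (be / u)). 2: { field. lra. } rewrite ss. unfold be.
         replace (2 * n + 2)%nat with (2 * n + 1 + 1)%nat by lia. rewrite (pow_add u (2 * n + 1) 1). field. split; [apply pow_nonzero; lra | lra]. }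
    ring. }
  rewrite E at 1. eapply Rle_trans. apply Cmod_triangle. rewrite !Cmod_mult, !Cmod_R.
  rewrite (Rabs_right (/ u ^ (2 * n + 2))) by (apply Rle_ge; left; apply Rinv_0_lt_compat, pow_lt, hu).
  replace (Rabs (s / (2 * u))) with (1 / (2 * u)).
  2: { unfold Rdiv. rewrite Rabs_mult, (Rabs_right (/ (2 * u))) by (apply Rle_ge; left; apply Rinv_0_lt_compat; lra).
       assert (As : Rabs s = 1) by now apply Rabs_sign.
       now rewrite As. }
  apply Rplus_le_compat_l, Rmult_le_compat_l.
  - left. unfold Rdiv. rewrite Rmult_1_l. apply Rinv_0_lt_compat. lra.
  - apply Cmod_minus_le.
Qed.

End Error.

(** * Behaviour at the ends of the path *)

Lemma to_infty_dir_spec (theta : R) (F : (R -> Prop) -> Prop) (gamma : R -> C) : Filter F ->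
  to_infty_dir theta F gamma -> forall R0 del, 0 < del ->
  F (fun x => R0 <= Cmod (gamma x) /\ Cmod (gamma x / RtoC (Cmod (gamma x)) - cis theta)%C < del).
Proof.
  intros FF [H1 H2] R0 del Hd. apply filter_and.
  - apply H1. exists R0. intros x Hx. lra.
  - assert (L := H2 _ (locally_ball_norm (V := C_R_NormedModule) (cis theta) (mkposreal del Hd))).
    unfold filtermap in L. eapply filter_imp; [|exact L]. intros x Hx.
    unfold ball_norm in Hx. rewrite norm_CR in Hx. exact Hx.
Qed.

Lemma exp_opp_small_const (K c eps : R) : 0 <= K -> 0 < c -> 0 < eps ->
  exists M, forall y, M <= y -> K * exp (- (c * y)) <= eps.
Proof.
  intros HK Hc He. destruct (exp_opp_small K eps HK He) as [M [_ HM]].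
  exists (M / c). intros y Hy. apply HM.
  apply Rmult_le_compat_l with (r := c) in Hy; [|lra].
  replace (c * (M / c)) with M in Hy by (field; lra). lra.
Qed.

Section End.

Variables (d : nat) (p : nat -> C) (u : R) (j k : Z) (n : nat) (W W1 : C -> C).
Hypothesis hu : 0 < u.

Let U := Rpower u (2 / 3).
Let mu := mid_dir j k.

(** The point is 4/10 < 6/10. The 3/10 from the solution grows to 4/10 by absorbing powers of t, and
    the limit 2/3 of sg Re xi / |t|^(3/2) drops to 6/10 = (9/10) (2/3) when the direction of t
    deviates slightly from that of z^(l). *)
Lemma end_growth (l : Z) (sg K0 s0 : R) :
  (sg = 1 \/ sg = -1) -> cpow j k (3 / 2) (cis (dir l)) = RtoC sg -> slit mu (cis (dir l)) ->
  0 <= K0 -> 0 <= s0 ->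
  (forall z s, s0 <= s -> U * Cmod z = s ^ 2 ->
    Cmod (z * cis (- dir l) - RtoC (Cmod z))%C <= Cmod z / 100 ->
    Cmod (W z) <= K0 * exp (3 / 10 * s ^ 3) /\ Cmod (W1 z) <= K0 * exp (3 / 10 * s ^ 3)) ->
  exists K R0 del, 0 <= K /\ 1 <= R0 /\ 0 < del /\ forall t, R0 <= Cmod t ->
    Cmod (t / RtoC (Cmod t) - cis (dir l))%C < del ->
    let y := Rpower (Cmod t) (3 / 2) in
    Cmod t <= y /\
    Cmod (eta d p u j k n W t) <= K * exp (4 / 10 * u * y) /\
    (forall s, s = 1 \/ s = -1 -> Cmod (bracket d p u j k n W W1 s t) <= K * exp (4 / 10 * u * y)) /\
    6 / 10 * y <= sg * (2 / 3) * Re (cpow j k (3 / 2) t).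
Proof.
  intros Hsg Hcp Hsl HK0 Hs0 HW.
  assert (UP : 0 < U) by apply U_pos.
  destruct (alg_growth _ _ (alg_expansion d p u n)) as [KA [NA [HA BA]]].
  destruct (alg_growth _ _ (alg_expansion1 d p u n)) as [KB [NB [HB BB]]].
  destruct (alg_growth _ _ (alg_Ghat d p n)) as [KC [NC [HC BC]]].
  destruct (cderiv_lip _ _ _ (cderiv_cpow j k (3 / 2) _ Hsl)) as [d1 [Hd1 L1]].
  set (L := Cmod (RtoC (3 / 2) * cpow j k (3 / 2 - 1) (cis (dir l)))%C + 1) in *.
  assert (HL : 0 < L) by (unfold L; generalize (Cmod_ge_0 (RtoC (3 / 2) * cpow j k (3 / 2 - 1) (cis (dir l)))%C); lra).
  set (N := (NA + NB + NC)%nat). set (be := / u ^ (2 * n + 1)).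
  assert (hbe : 0 < be) by (apply Rinv_0_lt_compat, pow_lt, hu).
  set (s1 := s0 + 10 * (INR (S N) / U)).
  assert (Hs1 : 0 <= INR (S N) / U). { apply Rmult_le_pos. apply pos_INR. left; now apply Rinv_0_lt_compat. }
  set (KK := (2 + u) * (2 * K0 + KA + KB) + be * KC).
  assert (HKK : 0 <= KK).
  { unfold KK. apply Rplus_le_le_0_compat; apply Rmult_le_pos; lra. }
  (* The radius ensures |t| >= 1, away from the pole at 0, and s >= s1, so that (N + 1) |t| <=
     s^3/10. The three tolerances serve the cone of the growth hypothesis, the Lipschitz estimate of
     t^(3/2), and its deviation by at most 1/10. *)
  exists KK, (1 + s1 ^ 2 / U), (Rmin (1 / 100) (Rmin d1 (1 / (10 * L)))).
  assert (S1 : 0 <= s1 ^ 2 / U). { apply Rmult_le_pos. apply pow2_ge_0. left; now apply Rinv_0_lt_compat. }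
  split; auto. split. lra. split.
  { repeat apply Rmin_pos; try lra. apply Rdiv_lt_0_compat; lra. }
  intros t Ht Hdir y.
  assert (t1 : 1 <= Cmod t) by lra.
  assert (Ht0 : t <> RtoC 0) by (apply Cmod_gt_0; lra).
  set (tau := (t / RtoC (Cmod t))%C) in *.
  assert (ttau : t = (RtoC (Cmod t) * tau)%C).
  { unfold tau. field. intros X; apply RtoC_inj in X; lra. }
  assert (dir1 : Cmod (tau - cis (dir l))%C < 1 / 100) by (eapply Rlt_le_trans; [apply Hdir | apply Rmin_l]).
  assert (dir2 : Cmod (tau - cis (dir l))%C < d1).
  { eapply Rlt_le_trans; [apply Hdir|]. eapply Rle_trans; [apply Rmin_r | apply Rmin_l]. }
  assert (dir3 : Cmod (tau - cis (dir l))%C < 1 / (10 * L)).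
  { eapply Rlt_le_trans; [apply Hdir|]. eapply Rle_trans; [apply Rmin_r | apply Rmin_r]. }
  assert (y0 : 0 < y) by apply exp_pos.
  assert (ty : Cmod t <= y).
  { unfold y. rewrite <- (Rpower_1 (Cmod t)) at 1 by lra. apply Rle_Rpower; lra. }
  assert (yy : y * y = Cmod t ^ 3).
  { unfold y. rewrite <- Rpower_plus, <- Rpower_pow by lra. f_equal. simpl. field. }
  set (s := sqrt (U * Cmod t)).
  assert (Hs : s ^ 2 = U * Cmod t). { unfold s. rewrite <- Rsqr_pow2. apply Rsqr_sqrt. apply Rmult_le_pos; lra. }
  assert (s0' : 0 <= s) by apply sqrt_pos.
  assert (sy : s ^ 3 = u * y).
  { apply Rsqr_inj. now apply pow_le. apply Rmult_le_pos; lra. unfold Rsqr.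
    replace (s ^ 3 * s ^ 3) with ((s ^ 2) ^ 3) by ring. rewrite Hs, Rpow_mult_distr, <- yy.
    assert (UC : U ^ 3 = u ^ 2) by now apply U_cube. rewrite UC. ring. }
  assert (ss1 : s1 <= s).
  { apply Rsqr_incr_0_var; auto. rewrite !Rsqr_pow2, Hs.
    assert (s1 ^ 2 / U * U <= Cmod t * U) by (apply Rmult_le_compat_r; lra).
    replace (s1 ^ 2 / U * U) with (s1 ^ 2) in * by (field; lra). lra. }
  destruct (HW t s) as [W0 W1']. { unfold s1 in ss1; lra. } { auto. }
  { rewrite ttau at 1. replace (RtoC (Cmod t) * tau * cis (- dir l) - RtoC (Cmod t))%C with
      (RtoC (Cmod t) * ((tau - cis (dir l)) * cis (- dir l) + (cis (dir l) * cis (- dir l) - 1)))%C by ring.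
    rewrite cis_opp_r. rewrite Cmod_mult, Cmod_R, Rabs_right by lra.
    replace ((tau - cis (dir l)) * cis (- dir l) + (1 - 1))%C with ((tau - cis (dir l)) * cis (- dir l))%C by ring.
    rewrite Cmod_rotate. nra. }
  set (E := exp (3 / 10 * s ^ 3)) in *.
  assert (E1 : 1 <= E).
  { unfold E. rewrite <- exp_0. apply exp_le. assert (0 <= s ^ 3) by now apply pow_le. lra. }
  set (X := 1 + Cmod t). 
  assert (Pw : forall m, (m <= N)%nat -> X ^ m <= X ^ N) by (intros; apply Rle_pow; [unfold X; lra | auto]).
  assert (P1 : 1 <= X ^ N) by (apply pow_R1_Rle; unfold X; lra).
  assert (BA' : Cmod (expansion d p u n t) <= KA * X ^ N).
  { eapply Rle_trans. apply BA; auto. apply Rmult_le_compat_l; auto. apply Pw. unfold N; lia. }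
  assert (BB' : Cmod (expansion1 d p u n t) <= KB * X ^ N).
  { eapply Rle_trans. apply BB; auto. apply Rmult_le_compat_l; auto. apply Pw. unfold N; lia. }
  assert (BC' : Cmod (Ghat d p n t) <= KC * X ^ N).
  { eapply Rle_trans. apply BC; auto. apply Rmult_le_compat_l; auto. apply Pw. unfold N; lia. }
  assert (XE : forall K, 0 <= K -> K * X ^ N <= K * (X ^ N * E)).
  { intros K HK. apply Rmult_le_compat_l; auto. nra. }
  assert (XE' : K0 * E <= K0 * (X ^ N * E)) by (apply Rmult_le_compat_l; auto; nra).
  assert (e0 : Cmod (err d p u n W t) <= (K0 + KA) * (X ^ N * E)).
  { unfold err. eapply Rle_trans. apply Cmod_minus_le. specialize (XE KA HA). lra. }
  assert (e1 : Cmod (err1 d p u n W1 t) <= (K0 + KB) * (X ^ N * E)).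
  { unfold err1. eapply Rle_trans. apply Cmod_minus_le. specialize (XE KB HB). lra. }
  assert (g0 : Cmod (Ghat d p n t) <= KC * (X ^ N * E)) by (specialize (XE KC HC); lra).
  assert (Cp : forall a, a <= 1 -> Cmod (cpow j k a t) <= X).
  { intros a Ha. rewrite Cmod_cpow. unfold X.
    apply Rle_trans with (Rpower (Cmod t) 1). apply Rle_Rpower; lra. rewrite Rpower_1; lra. }
  assert (Fin : X * (X ^ N * E) <= exp (4 / 10 * u * y)).
  { replace (X * (X ^ N * E)) with (X ^ S N * E) by (simpl; ring).
    apply Rle_trans with (exp (INR (S N) * Cmod t) * E).
    - apply Rmult_le_compat_r. lra. rewrite <- exp_pow. apply pow_incr. unfold X. split. lra. apply exp_ineq1_le.
    - unfold E. rewrite <- exp_plus. apply exp_le. replace (4 / 10 * u * y) with (4 / 10 * s ^ 3) by (rewrite sy; ring).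
      assert (INR (S N) * Cmod t <= 1 / 10 * s ^ 3).
      { replace (Cmod t) with (s ^ 2 / U) by (rewrite Hs; field; lra).
        replace (INR (S N) * (s ^ 2 / U)) with (INR (S N) / U * s ^ 2) by (field; lra).
        replace (1 / 10 * s ^ 3) with (s / 10 * s ^ 2) by field.
        apply Rmult_le_compat_r. apply pow2_ge_0. unfold s1 in ss1. lra. }
      lra. }
  set (Y := X ^ N * E) in *. assert (Y0 : 0 <= Y) by (unfold Y; nra). assert (X0 : 0 <= X) by (unfold X; lra).
  assert (Heta : Cmod (eta d p u j k n W t) <= (K0 + KA) * (X * Y)).
  { unfold eta. rewrite Cmod_mult. replace ((K0 + KA) * (X * Y)) with (X * ((K0 + KA) * Y)) by ring.
    apply Rmult_le_compat; try apply Cmod_ge_0; auto. apply Cp; lra. }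
  assert (Htheta : Cmod (theta d p u j k n W W1 t) <= (2 * K0 + KA + KB) * (X * Y)).
  { unfold theta. eapply Rle_trans. apply Cmod_triangle. rewrite !Cmod_mult.
    assert (A1 : Cmod (/ 4)%C <= 1).
    { rewrite Cmod_inv, Cmod_R, Rabs_right by (try lra; intros Z; apply RtoC_inj in Z; lra). lra. }
    assert (A2 := Cp (- (5 / 4)) ltac:(lra)). assert (A3 := Cp (- (1 / 4)) ltac:(lra)).
    assert (A4 : Cmod (/ 4)%C * Cmod (cpow j k (- (5 / 4)) t) * Cmod (err d p u n W t) <= 1 * X * ((K0 + KA) * Y)).
    { apply Rmult_le_compat; auto. apply Rmult_le_pos; apply Cmod_ge_0. apply Cmod_ge_0.
      apply Rmult_le_compat; auto; apply Cmod_ge_0. }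
    assert (A5 : Cmod (cpow j k (- (1 / 4)) t) * Cmod (err1 d p u n W1 t) <= X * ((K0 + KB) * Y)).
    { apply Rmult_le_compat; auto; apply Cmod_ge_0. }
    lra. }
  assert (Hg : Cmod (qG d p j k n t) <= KC * (X * Y)).
  { unfold qG. rewrite Cmod_mult. replace (KC * (X * Y)) with (X * (KC * Y)) by ring.
    apply Rmult_le_compat; try apply Cmod_ge_0; auto. apply Cp; lra. }
  assert (XY : 0 <= X * Y) by now apply Rmult_le_pos.
  split; [exact ty | split; [|split]].
  - eapply Rle_trans. apply Heta. apply Rmult_le_compat; auto; try lra.
    unfold KK. assert (0 <= be * KC) by (apply Rmult_le_pos; lra). nra.
  - intros sg' Hsg'. unfold bracket. fold be.
    assert (As : Rabs sg' = 1) by now apply Rabs_sign.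
    apply Rle_trans with (KK * (X * Y)); [|now apply Rmult_le_compat_l].
    eapply Rle_trans. apply Cmod_minus_le.
    eapply Rle_trans. apply Rplus_le_compat_r, Cmod_triangle.
    rewrite !Cmod_mult, !Cmod_R, !Rabs_mult, As, (Rabs_right u), (Rabs_right be) by lra.
    assert (u * Cmod (eta d p u j k n W t) <= u * ((K0 + KA) * (X * Y))) by (apply Rmult_le_compat_l; lra).
    assert (be * Cmod (qG d p j k n t) <= be * (KC * (X * Y))) by (apply Rmult_le_compat_l; lra).
    assert (0 <= u * ((K0 + KB) * (X * Y))) by (apply Rmult_le_pos; [lra | apply Rmult_le_pos; lra]).
    assert (0 <= (2 * K0 + KA + KB) * (X * Y)) by (apply Rmult_le_pos; lra).
    unfold KK. lra.
  - rewrite ttau, cpow_scale.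
    2: { lra. }
    2: { intros Z. rewrite Z, Cmult_0_r in ttau. auto. }
    rewrite Re_RtoC_mult. fold y.
    assert (Q := L1 (tau - cis (dir l))%C dir2).
    replace (cis (dir l) + (tau - cis (dir l)))%C with tau in Q by ring. rewrite Hcp in Q.
    assert (Q2 : L * Cmod (tau - cis (dir l))%C <= 1 / 10).
    { apply Rmult_lt_compat_l with (r := L) in dir3; auto.
      replace (L * (1 / (10 * L))) with (1 / 10) in dir3 by (field; lra). lra. }
    assert (Q3 := re_le_Cmod (cpow j k (3 / 2) tau - RtoC sg)%C).
    assert (Q4 : Re (cpow j k (3 / 2) tau - RtoC sg)%C = Re (cpow j k (3 / 2) tau) - sg).
    { unfold Cminus, Cplus, Copp, RtoC, Re; simpl. ring. }
    rewrite Q4 in Q3.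
    assert (Q5 : - (1 / 10) <= Re (cpow j k (3 / 2) tau) - sg <= 1 / 10) by (apply Rabs_le_between; lra).
    assert (9 / 10 <= sg * Re (cpow j k (3 / 2) tau)) by (destruct Hsg as [-> | ->]; lra).
    nra.
Qed.

End End.

(** * The estimate along the path *)

(** [real] sends infinite values to 0, so boundedness is what makes it the actual supremum. *)
Lemma Lub_Rbar_ub (E : R -> Prop) (x : R) : bound E -> E x -> x <= real (Lub_Rbar E).
Proof.
  intros [M HM] Ex. destruct (Lub_Rbar_correct E) as [H1 H2].
  assert (L2 := H2 (Finite M)). assert (L1 := H1 x Ex).
  destruct (Lub_Rbar E); simpl in *; auto.
  - exfalso. apply L2. intros y Hy. now apply HM.
  - contradiction.
Qed.

Lemma w_is_solution (d : nat) (p : nat -> C) (u : R) (j k : Z) : 0 < u -> (-1 <= j /\ j < k /\ k <= 1)%Z ->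
  is_solution d p u (w d p u j k).
Proof.
  intros hu hjk. destruct (w_Wsol d p u j k hjk) as [c [Hc Hw]].
  exists (Wsol1 d p u c j k), (fun z => RtoC (u ^ 2) * z * Wsol d p u c j k z + poly_eval d p z)%C.
  split; [|split].
  - intros z. apply (cderiv_ext (Wsol d p u c j k)). { intros t. now rewrite Hw. } now apply cderiv_Wsol.
  - intros z. now apply cderiv_Wsol1.
  - intros z. rewrite Hw. ring.
Qed.

Lemma eta_path_bound (d : nat) (p : nat -> C) (u : R) (j k : Z) (n : nat) (gamma : R -> C) (x0 : R) :
  0 < u -> (-1 <= j /\ j < k /\ k <= 1)%Z -> (1 <= n)%nat -> is_path u j k (gamma x0) gamma ->
  abs_int_exists gamma (C_derive (qG d p j k n)) -> abs_int_exists gamma (qI j k) ->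
  bound (qG_values d p j k n gamma) -> 5 / (32 * u) * abs_int gamma (qI j k) < 1 ->
  Rpower (Cmod (gamma x0)) (1 / 4) * Cmod (w d p u j k (gamma x0) - expansion d p u n (gamma x0))%C <=
   / u ^ (2 * n + 2) * Cmod (qG d p j k n (gamma x0)) +
   / u ^ (2 * n + 1) / (2 * u) * abs_int gamma (C_derive (qG d p j k n)) +
   5 / (32 * u) * abs_int gamma (qI j k) *
   ((/ u ^ (2 * n + 2) * real (Lub_Rbar (qG_values d p j k n gamma)) +
     / u ^ (2 * n + 1) / (2 * u) * abs_int gamma (C_derive (qG d p j k n))) /
     (1 - 5 / (32 * u) * abs_int gamma (qI j k))).
Proof.
  intros hu hjk hn [[l Hl] [Hj [Hk [_ [Hn0 [Hsec Hmon]]]]]] HI2 HI1 Hb Hkap.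
  destruct (w_Wsol d p u j k hjk) as [c [Hc Hw]].
  set (W := Wsol d p u c j k). set (W1 := Wsol1 d p u c j k).
  assert (DW : forall t, cderiv W t (W1 t)) by (intros; now apply cderiv_Wsol).
  assert (DW1 : forall t, cderiv W1 t (RtoC (u ^ 2) * t * W t + poly_eval d p t)%C) by (intros; now apply cderiv_Wsol1).
  set (mu := mid_dir j k).
  assert (Hslit : forall x, slit mu (gamma x)) by (intros; apply Sector_slit; auto).
  destruct (cpow_ends j k hjk) as [Sj [Sk [s [Hs [Cj Ck]]]]].
  assert (Hs' : - s = 1 \/ - s = -1) by (destruct Hs as [-> | ->]; [right | left]; ring).
  destruct (Wsol_growth d p u hu c j k) as [Kj [sj [HKj [Hsj Gj]]]].
  (* The solution formula is antisymmetric in (j, k): with -c, the same lemma describes the end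
     z^(k). *)
  destruct (Wsol_growth d p u hu (- c)%C k j) as [Kk [sk [HKk [Hsk Gk]]]].
  destruct (end_growth d p u j k n W W1 hu j (- s) Kj sj Hs' Cj Sj HKj Hsj Gj) as [Mj [Rj [dj [HMj [HRj [Hdj Ej]]]]]].
  destruct (end_growth d p u j k n W W1 hu k s Kk sk Hs Ck Sk HKk Hsk) as [Mk [Rk [dk [HMk [HRk [Hdk Ek]]]]]].
  { intros z r H1 H2 H3. destruct (Gk z r H1 H2 H3) as [A1 A2].
    replace (W z) with (Wsol d p u (- c) k j z) by (unfold W, Wsol; ring).
    replace (W1 z) with (Wsol1 d p u (- c) k j z) by (unfold W1, Wsol1; ring). auto. }
  set (m := fun x => s * (2 / 3) * Re (cpow j k (3 / 2) (gamma x))).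
  assert (Endk := to_infty_dir_spec _ _ gamma _ Hk). assert (Endj := to_infty_dir_spec _ _ gamma _ Hj).
  destruct (Endk Rk dk Hdk) as [Xk HXk]. destruct (Endj Rj dj Hdj) as [Xj HXj].
  assert (Mjneg : forall x, x < Xj -> m x <= - (6 / 10 * Rpower (Cmod (gamma x)) (3 / 2))).
  { intros x Hx. destruct (HXj x Hx) as [B1 B2]. destruct (Ej _ B1 B2) as [_ [_ [_ B3]]]. unfold m. lra. }
  assert (Mkpos : forall x, Xk < x -> 6 / 10 * Rpower (Cmod (gamma x)) (3 / 2) <= m x).
  { intros x Hx. destruct (HXk x Hx) as [B1 B2]. destruct (Ek _ B1 B2) as [_ [_ [_ B3]]]. exact B3. }
  (* Monotonicity is given only up to direction. By the choice of s, m is negative towards z^(j) and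
     positive towards z^(k), which excludes that it decreases. *)
  assert (Hm : forall x y, x <= y -> m x <= m y).
  { assert (Hm2 : (forall x y, x <= y -> m x <= m y) \/ (forall x y, x <= y -> m y <= m x)).
    { assert (F : forall x, Re (RtoC u * cpow j k (3 / 2) (gamma x))%C = u * Re (cpow j k (3 / 2) (gamma x)))
        by (intros; apply Re_RtoC_mult).
      assert (G : (forall x y, x <= y -> Re (cpow j k (3 / 2) (gamma x)) <= Re (cpow j k (3 / 2) (gamma y))) \/
        (forall x y, x <= y -> Re (cpow j k (3 / 2) (gamma y)) <= Re (cpow j k (3 / 2) (gamma x)))).
      { destruct Hmon as [Hmon | Hmon]; [left | right]; intros x y Hxy; specialize (Hmon x y Hxy);
        rewrite !F in Hmon; now apply Rmult_le_reg_l in Hmon. }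
      unfold m. destruct Hs as [-> | ->]; destruct G as [G | G].
      - left. intros x y Hxy. specialize (G x y Hxy). lra.
      - right. intros x y Hxy. specialize (G x y Hxy). lra.
      - right. intros x y Hxy. specialize (G x y Hxy). lra.
      - left. intros x y Hxy. specialize (G x y Hxy). lra. }
    destruct Hm2 as [Hm2 | Hm2]; auto. exfalso.
    set (y := Rmax (Xk + 1) Xj).
    assert (H1 := Mkpos y ltac:(unfold y; generalize (Rmax_l (Xk + 1) Xj); lra)).
    assert (H2 := Mjneg (Xj - 1) ltac:(lra)).
    assert (H3 := Hm2 (Xj - 1) y ltac:(unfold y; generalize (Rmax_r (Xk + 1) Xj); lra)).
    assert (P1 : 0 < Rpower (Cmod (gamma y)) (3 / 2)) by apply exp_pos.
    assert (P2 : 0 < Rpower (Cmod (gamma (Xj - 1))) (3 / 2)) by apply exp_pos. lra. }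
  assert (Part1 := abs_int_partial gamma (qI j k) HI1).
  assert (Part2 := abs_int_partial gamma (C_derive (qG d p j k n)) HI2).
  set (I1 := fun x y => RInt (abs_integrand gamma (qI j k)) x y).
  set (I2 := fun x y => RInt (abs_integrand gamma (C_derive (qG d p j k n))) x y).
  set (T1 := abs_int gamma (qI j k)) in *. set (T2 := abs_int gamma (C_derive (qG d p j k n))) in *.
  set (be := / u ^ (2 * n + 1)). assert (hbe : 0 < be) by (apply Rinv_0_lt_compat, pow_lt, hu).
  set (P := Ppm d p u j k n W W1). set (H := fun x => Cmod (eta d p u j k n W (gamma x))).
  assert (Var : forall sg, sg = 1 \/ sg = -1 -> forall x y K1 K2, x <= y ->
    (forall r, x <= r <= y -> exp (- (u * (sg * (2 / 3) * Re (cpow j k (3 / 2) (gamma r))))) * (5 / 16 * H r) <= K1) ->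
    (forall r, x <= r <= y -> exp (- (u * (sg * (2 / 3) * Re (cpow j k (3 / 2) (gamma r))))) * be <= K2) ->
    Cmod (P sg (gamma y) - P sg (gamma x))%C <= K1 * I1 x y + K2 * I2 x y).
  { intros sg Hsg x y K1 K2 Hxy HK1 HK2. destruct (cderiv_Ppm1 d p u j k n W W1 DW sg) as [V2 DV2].
    apply (path_variation (slit mu) (P sg) (Ppm1 d p u j k n W sg) V2 gamma (qI j k) (C_derive (qG d p j k n)))
      with (l := l) (a := m_infty); simpl; auto.
    - intros t Ht. now apply cderiv_Ppm.
    - intros; now apply Part1.
    - intros; now apply Part2.
    - intros r Hr. eapply Rle_trans. now apply Cmod_Ppm1_le.
      apply Rplus_le_compat; apply Rmult_le_compat_r; try apply Cmod_ge_0; auto. }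
  assert (Hle : forall x, H x <= / u ^ (2 * n + 2) * Cmod (qG d p j k n (gamma x)) + 1 / (2 * u) *
     (exp (u * m x) * Cmod (P s (gamma x)) + exp (- (u * m x)) * Cmod (P (- s) (gamma x)))).
  { intros x. now apply eta_le. }
  assert (iu : 0 < / u ^ (2 * n + 2)) by (apply Rinv_0_lt_compat, pow_lt, hu).
  (* The exponential factor is at most e^(-(6/10) u y) and the bracket is O(e^((4/10) u y)) with y =
     |t|^(3/2), whence the rate 2/10. The filter is kept general to cover both ends. *)
  assert (Small : forall sg l' M' R' d' (F : (R -> Prop) -> Prop), Filter F -> to_infty_dir (dir l') F gamma ->
    (sg = 1 \/ sg = -1) -> 0 <= M' -> 0 < d' ->
    (forall t, R' <= Cmod t -> Cmod (t / RtoC (Cmod t) - cis (dir l'))%C < d' ->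
     let y := Rpower (Cmod t) (3 / 2) in
     Cmod t <= y /\ Cmod (eta d p u j k n W t) <= M' * exp (4 / 10 * u * y) /\
     (forall s, s = 1 \/ s = -1 -> Cmod (bracket d p u j k n W W1 s t) <= M' * exp (4 / 10 * u * y)) /\
     6 / 10 * y <= sg * (2 / 3) * Re (cpow j k (3 / 2) t)) ->
    forall eps, 0 < eps -> F (fun x => Cmod (P sg (gamma x)) <= eps)).
  { intros sg l' M' R' d' F FF HF Hsg HM' Hd' HE eps He.
    destruct (exp_opp_small_const M' (2 / 10 * u) eps HM' ltac:(lra) He) as [Y HY].
    eapply filter_imp; [|apply (to_infty_dir_spec _ _ gamma FF HF (Rmax R' Y) d' Hd')].
    intros x [B1 B2].
    destruct (HE (gamma x)) as [Q1 [_ [Q2 Q3]]]; auto. { eapply Rle_trans; [apply Rmax_l | apply B1]. }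
    set (y := Rpower (Cmod (gamma x)) (3 / 2)) in *.
    unfold P. rewrite Cmod_Ppm_exp. specialize (Q2 sg Hsg).
    eapply Rle_trans; [|apply (HY y)]. 2: { generalize (Rmax_r R' Y); lra. }
    eapply Rle_trans. apply Rmult_le_compat_l. left; apply exp_pos. apply Q2.
    rewrite (Rmult_comm M'), <- Rmult_assoc, <- exp_plus, Rmult_comm. apply Rmult_le_compat_l; auto.
    apply exp_le. nra. }
  (* Near the ends eta is O(e^((4/10) u y)) while |m| >= (6/10) y; the remaining part of the path is
     compact. *)
  assert (HC : exists C0, forall x, H x <= C0 * exp (u * Rabs (m x))).
  { destruct (path_bounded (slit mu) (eta d p u j k n W) _ gamma
      (fun t Ht => cderiv_eta d p u j k n W W1 DW t Ht) Hslit l m_infty (Rmin Xj Xk - 1) (Rmax Xj Xk + 1) Hl I) as [K3 HK3].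
    { generalize (Rmin_l Xj Xk) (Rmax_l Xj Xk). lra. }
    assert (K30 : 0 <= K3).
    { eapply Rle_trans; [apply Cmod_ge_0 | apply (HK3 Xj)]. generalize (Rmin_l Xj Xk) (Rmax_l Xj Xk). lra. }
    exists (Mj + Mk + K3). intros x.
    assert (E1 : 1 <= exp (u * Rabs (m x))).
    { rewrite <- exp_0. apply exp_le. apply Rmult_le_pos. lra. apply Rabs_pos. }
    assert (Ends : forall M' y', 0 <= M' -> 0 < y' -> H x <= M' * exp (4 / 10 * u * y') -> 6 / 10 * y' <= Rabs (m x) ->
      M' <= Mj + Mk + K3 -> H x <= (Mj + Mk + K3) * exp (u * Rabs (m x))).
    { intros M' y' H1 H2 H3 H4 H5. eapply Rle_trans. apply H3. apply Rmult_le_compat; auto. left; apply exp_pos.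
      apply exp_le. nra. }
    destruct (Rlt_dec x Xj) as [Hx | Hx]; [|destruct (Rlt_dec Xk x) as [Hx' | Hx']].
    - destruct (HXj x Hx) as [B1 B2]. destruct (Ej _ B1 B2) as [_ [B3 _]].
      apply (Ends Mj (Rpower (Cmod (gamma x)) (3 / 2))); auto. apply exp_pos.
      specialize (Mjneg x Hx). rewrite <- Rabs_Ropp. eapply Rle_trans; [|apply Rle_abs]. lra. lra.
    - destruct (HXk x Hx') as [B1 B2]. destruct (Ek _ B1 B2) as [_ [B3 _]].
      apply (Ends Mk (Rpower (Cmod (gamma x)) (3 / 2))); auto. apply exp_pos.
      specialize (Mkpos x Hx'). eapply Rle_trans; [|apply Rle_abs]. lra. lra.
    - apply Rle_trans with (K3 * 1).
      + rewrite Rmult_1_r. apply HK3. generalize (Rmin_l Xj Xk) (Rmax_r Xj Xk). lra.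
      + apply Rmult_le_compat; lra. }
  destruct HC as [C0 HC].
  set (LG := real (Lub_Rbar (qG_values d p j k n gamma))).
  (* [P s] vanishes at z^(k) and is integrated from there; [P (- s)] vanishes at z^(j). *)
  assert (Fin := weighted_sup_estimate u (5 / 16) be H m (fun x => / u ^ (2 * n + 2) * Cmod (qG d p j k n (gamma x)))
    (fun x => P s (gamma x)) (fun x => P (- s) (gamma x)) I1 I2 T1 T2 (/ u ^ (2 * n + 2) * LG) C0 x0).
  assert (Ekap : 5 / 16 / (2 * u) = 5 / (32 * u)) by (field; lra).
  rewrite Ekap in Fin.
  replace (Rpower (Cmod (gamma x0)) (1 / 4) * Cmod (w d p u j k (gamma x0) - expansion d p u n (gamma x0))%C) with (H x0).
  2: { unfold H, eta, err. rewrite Cmod_mult, Cmod_cpow. unfold W. now rewrite Hw. }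
  apply Fin; try lra; auto.
  - intros; apply Cmod_ge_0.
  - intros; now apply Part1.
  - intros; now apply Part2.
  - intros x y z H1 H2.
    assert (E : I1 x y + I1 y z = I1 x z)
      by exact (RInt_Chasles (V := R_CompleteNormedModule) _ x y z (proj1 (Part1 x y H1)) (proj1 (Part1 y z H2))).
    rewrite E. apply (Part1 x z (Rle_trans _ _ _ H1 H2)).
  - intros x y z H1 H2.
    assert (E : I2 x y + I2 y z = I2 x z)
      by exact (RInt_Chasles (V := R_CompleteNormedModule) _ x y z (proj1 (Part2 x y H1)) (proj1 (Part2 y z H2))).
    rewrite E. apply (Part2 x z (Rle_trans _ _ _ H1 H2)).
  - intros x y K1 K2 Hxy HK1 HK2. apply Var; auto.
    + intros r Hr. replace (- (u * (- s * (2 / 3) * Re (cpow j k (3 / 2) (gamma r))))) with (u * m r) by (unfold m; ring). auto.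
    + intros r Hr. replace (- (u * (- s * (2 / 3) * Re (cpow j k (3 / 2) (gamma r))))) with (u * m r) by (unfold m; ring). auto.
  - intros eps He. destruct (Small s k Mk Rk dk _ _ Hk Hs HMk Hdk Ek eps He) as [M HM].
    exists (M + 1). intros y Hy. apply HM. lra.
  - intros eps He. destruct (Small (- s) j Mj Rj dj _ _ Hj Hs' HMj Hdj Ej eps He) as [M HM].
    exists (M - 1). intros y Hy. apply HM. lra.
  - intros x. split.
    + apply Rmult_le_pos. lra. apply Cmod_ge_0.
    + apply Rmult_le_compat_l. lra. apply Lub_Rbar_ub; auto. now exists x.
Qed.

Theorem theorem6p2
  (u : R) (hu : 0 < u)
  (d : nat) (hd : (1 <= d)%nat)
  (p : nat -> C) (hp : p d <> RtoC 0)
  (j k : Z) (hjk : (-1 <= j /\ j < k /\ k <= 1)%Z) :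
  is_solution d p u (w d p u j k) /\
  forall (delta : R) (z : C) (n : nat) (gamma : R -> C),
    0 < delta ->
    Zdelta delta j k z ->
    (1 <= n)%nat ->
    is_path u j k z gamma ->
    abs_int_exists gamma (C_derive (qG d p j k n)) ->
    abs_int_exists gamma (qI j k) ->
    bound (qG_values d p j k n gamma) ->
    5 / (32 * u) * abs_int gamma (qI j k) < 1 ->
    exists eps : C,
      w d p u j k z = (expansion d p u n z + eps)%C /\
      Cmod eps <=
        1 / u ^ (2 * n + 2) *
          (Cmod (Ghat d p n z) +
           1 / (2 * Rpower (Cmod z) (1 / 4)) *
             abs_int gamma (C_derive (qG d p j k n))) +
        5 * Lhat d p j k n gamma /
            (32 * u ^ (2 * n + 3) * Rpower (Cmod z) (1 / 4)) *
          / (1 - 5 / (32 * u) * abs_int gamma (qI j k)) *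
          abs_int gamma (qI j k).
Proof.
  split. { now apply w_is_solution. }
  intros delta z n gamma _ _ hn Hpath HI2 HI1 Hb Hkap.
  exists (w d p u j k z - expansion d p u n z)%C. split. { ring. }
  assert (Hx := Hpath). destruct Hx as [_ [_ [_ [[x0 <-] _]]]].
  assert (E := eta_path_bound d p u j k n gamma x0 hu hjk hn Hpath HI2 HI1 Hb Hkap).
  unfold qG in E at 1. rewrite Cmod_mult, Cmod_cpow in E.
  set (r := Rpower (Cmod (gamma x0)) (1 / 4)) in *. assert (r0 : 0 < r) by apply exp_pos.
  unfold Lhat. set (LG := real (Lub_Rbar (qG_values d p j k n gamma))) in *.
  set (T1 := abs_int gamma (qI j k)) in *. set (T2 := abs_int gamma (C_derive (qG d p j k n))) in *.
  set (G := Cmod (Ghat d p n (gamma x0))) in *.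
  (* Multiplied by |z|^(1/4), the required bound is equal to the one already obtained, so only an
     identity of rational expressions is left. *)
  apply Rmult_le_reg_l with r; auto. eapply Rle_trans. apply E. right.
  replace (2 * n + 3)%nat with (2 * n + 1 + 2)%nat by lia. replace (2 * n + 2)%nat with (2 * n + 1 + 1)%nat by lia.
  rewrite !(pow_add u (2 * n + 1)). assert (un : u ^ (2 * n + 1) <> 0) by (apply pow_nonzero; lra).
  set (v := u ^ (2 * n + 1)) in *. 
  assert (K : 1 - 5 / (32 * u) * T1 <> 0) by lra.
  assert (K' : 32 * u - 5 * T1 <> 0).
  { intros Z. apply K. replace T1 with (32 * u / 5) by lra. field. lra. }
  field. repeat split; auto; lra.
Qed.
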